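(* There is an isomorphism of $k$-algebras ${\mathcal U}_q^{\widehat w_n}\to({\mathcal U}_q^{w_n})^\#$ given by $X_i\mapsto x_i\#1$, $Y_i\mapsto y_i\#1$, $\overline X_i\mapsto 1\#x_i$, $\overline Y_i\mapsto1\#y_i$ for $i=1,\dots,n$.
   Context: Let $k$ be an algebraically closed field of characteristic $0$ and $q\in k^\times$ transcendental over $\mathbb Q$; $\hat q=q-q^{-1}$; $n\ge3$; $[u,v]=uv-q^{-1}vu$. Let $Q(D_{n+1})$ be the lattice of $(a_1,\dots,a_{n+1})\in\mathbb Z^{n+1}$ with even coordinate sum and standard inner product; $Q(\widehat D_{n+1})=Q(D_{n+1})\oplus\mathbb Z\delta$ with $\delta$ orthogonal to everything. Simple roots $\alpha_0=-e_{n+1}-e_n+\delta$, $\alpha_1=e_1+e_2$, $\alpha_i=e_i-e_{i-1}$ ($2\le i\le n+1$); reflections $s_i(\mu)=\mu-\langle\mu,\alpha_i\rangle\alpha_i$. For an index set $I$ ($I=\{1,\dots,n+1\}$ with lattice $Q(D_{n+1})$, or $I=\{0,\dots,n+1\}$ with lattice $Q(\widehat D_{n+1})$) the quantized enveloping algebra (${\mathcal U}_q(\mathfrak{so}_{2n+2})$, resp. ${\mathcal U}_q(\widehat{\mathfrak{so}}_{2n+2})$) is generated by $E_i,F_i$ ($i\in I$), $K_\mu$ with relations $K_0=1$, $K_\mu K_\lambda=K_{\mu+\lambda}$, $K_\mu E_i=q^{\langle\mu,\alpha_i\rangle}E_iK_\mu$, $K_\mu F_i=q^{-\langle\mu,\alpha_i\rangle}F_iK_\mu$,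 $E_iE_j=E_jE_i$, $F_iF_j=F_jF_i$ if $\langle\alpha_i,\alpha_j\rangle\in\{0,2\}$, $E_i[E_i,E_j]=q[E_i,E_j]E_i$, $F_i[F_i,F_j]=q[F_i,F_j]F_i$ if $\langle\alpha_i,\alpha_j\rangle=-1$, $E_iF_j-F_jE_i=\delta_{ij}(K_{\alpha_i}-K_{-\alpha_i})/\hat q$; Hopf structure $\Delta(E_i)=K_{-\alpha_i}\otimes E_i+E_i\otimes1$, $\Delta(K_\mu)=K_\mu\otimes K_\mu$, $S(E_i)=-K_{\alpha_i}E_i$, $S(K_\mu)=K_{-\mu}$; Lusztig automorphisms $T_iK_\mu=K_{s_i\mu}$, $T_iE_i=-F_iK_{\alpha_i}$, $T_iF_i=-K_{-\alpha_i}E_i$, and for $j\neq i$: $T_iE_j=E_j$ if $\langle\alpha_i,\alpha_j\rangle=0$, $T_iE_j=E_iE_j-q^{-1}E_jE_i$ if $\langle\alpha_i,\alpha_j\rangle=-1$. For a reduced word $w=s_{i_1}\cdots s_{i_t}$ the root vectors are $T_{i_1}\cdots T_{i_{\ell-1}}E_{i_\ell}$ and the De Concini–Kac–Procesi algebra ${\mathcal U}_q^w$ is the subalgebra they generate. Finite type: $w_n=(s_{n+1}\cdots s_1)(s_3\cdots s_{n+1})$ with root vectors $x_i=X_{e_{n+1}-e_i}$, $y_i=X_{e_{n+1}+e_i}$ in ${\mathcal U}_q(\mathfrak{so}_{2n+2})$; ${\mathcal U}_D^{\ge0}$ is the Hopf subalgebra generated by $E_1,\dots,E_{n+1}$ and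 the $K_\mu$; $\pi:{\mathcal U}_D^{\ge0}\to{\mathcal U}_D^{\ge0}$ is the algebra map with $\pi(E_{n+1})=0$, $\pi(E_i)=E_i$ ($i\le n$), $\pi(K_\mu)=K_\mu$; ${\mathcal U}_q^{w_n}$ is a left ${\mathcal U}_D^{\ge0}$-module algebra via $h.v=\sum\pi(h)_{(1)}vS(\pi(h)_{(2)})$; the smash product ${\mathcal U}_q^{w_n}\#{\mathcal U}_D^{\ge0}$ is ${\mathcal U}_q^{w_n}\otimes{\mathcal U}_D^{\ge0}$ with product $(a\#h)(b\#g)=\sum a(h_{(1)}.b)\#h_{(2)}g$, and $({\mathcal U}_q^{w_n})^\#$ is its subalgebra generated by $\{1\#u,\,u\#1:u\in{\mathcal U}_q^{w_n}\}$. Affine type: $\widehat w_n=(s_{n+1}\cdots s_1)(s_3\cdots s_{n+1})s_0(s_n\cdots s_3)(s_1\cdots s_n)s_0$ (reduced, length $4n$) with root vectors in ${\mathcal U}_q(\widehat{\mathfrak{so}}_{2n+2})$ named in order $X_n,\dots,X_1,Y_1,\dots,Y_n,\overline X_n,\dots,\overline X_1,\overline Y_1,\dots,\overline Y_n$, generating ${\mathcal U}_q^{\widehat w_n}$. *)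

(* Defs.v *)
From HB Require Import structures.
From mathcomp Require Import all_boot all_order all_algebra.
Set Implicit Arguments. Unset Strict Implicit. Unset Printing Implicit Defensive.
Import Order.TTheory GRing.Theory Num.Theory.
Local Open Scope ring_scope.

(* Weights.  W n := 'rV[int]_(n.+2):  coordinate 0 is the coefficient  *)
(* of delta, coordinate j (1 <= j <= n+1) is the coefficient of e_j.   *)
Definition W (n : nat) := 'rV[int]_(n.+2).

Definition ecoord (n j : nat) : W n := delta_mx 0 (inord j).
Definition delta (n : nat) : W n := ecoord n 0.

(* standard inner product on Z^{n+1}, delta orthogonal to everything *)
Definition ip (n : nat) (mu la : W n) : int :=
  \sum_(j < n.+2 | (0 < j)%N) mu 0 j * la 0 j.

Definition esum (n : nat) (mu : W n) : int := \sum_(j < n.+2 | (0 < j)%N) mu 0 j.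

(* Q(D_{n+1}) : even coordinate sum, no delta component *)
Definition inLD (n : nat) (mu : W n) : bool := (mu 0 0 == 0) && ~~ odd `|esum mu|%N.
(* Q(\hat D_{n+1}) = Q(D_{n+1}) + Z delta *)
Definition inLA (n : nat) (mu : W n) : bool := ~~ odd `|esum mu|%N.

Definition alpha (n : nat) (i : nat) : W n :=
  if i == 0%N then delta n - ecoord n n.+1 - ecoord n n
  else if i == 1%N then ecoord n 1 + ecoord n 2
  else ecoord n i - ecoord n i.-1.

Definition sref (n i : nat) (mu : W n) : W n := mu - alpha n i *~ ip mu (alpha n i).

Definition ID (n : nat) (i : nat) : bool := (1 <= i <= n.+1)%N.
Definition IA (n : nat) (i : nat) : bool := (i <= n.+1)%N.

Section Alg.
Variable k : fieldType.

Definition alg_hom_on (A B : algType k) (P : A -> Prop) (f : A -> B) : Prop :=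
  f 1 = 1 /\
  (forall x y, P x -> P y -> f (x + y) = f x + f y /\ f (x * y) = f x * f y) /\
  (forall (c : k) x, P x -> f (c *: x) = c *: f x).

Definition alg_hom (A B : algType k) (f : A -> B) : Prop :=
  alg_hom_on (fun _ => True) f.

Definition alg_iso_on (A B : algType k) (P : A -> Prop) (Q : B -> Prop) (f : A -> B) : Prop :=
  alg_hom_on P f /\
  (forall x y, P x -> P y -> f x = f y -> x = y) /\
  (forall x, P x -> Q (f x)) /\
  (forall y, Q y -> exists x, P x /\ f x = y).

Inductive gen_alg (A : algType k) (X : A -> Prop) : A -> Prop :=
| ga_gen x : X x -> gen_alg X x
| ga_one : gen_alg X 1
| ga_add x y : gen_alg X x -> gen_alg X y -> gen_alg X (x + y)
| ga_scale (c : k) x : gen_alg X x -> gen_alg X (c *: x)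
| ga_mul x y : gen_alg X x -> gen_alg X y -> gen_alg X (x * y).

Definition lin_indep (A : algType k) (m : nat) (a : 'I_m -> A) : Prop :=
  forall c : 'I_m -> k, \sum_(j < m) c j *: a j = 0 -> forall j, c j = 0.

End Alg.

Section QG.
Variables (k : fieldType) (q : k) (n : nat) (I : nat -> bool) (inL : W n -> bool).

Definition qhat : k := q - q^-1.
Definition qbr (A : algType k) (u v : A) : A := u * v - q^-1 *: (v * u).

Definition qg_rels (A : algType k) (E F : nat -> A) (K : W n -> A) : Prop :=
  K 0 = 1 /\
  (forall mu la, inL mu -> inL la -> K mu * K la = K (mu + la)) /\
  (forall mu i, inL mu -> I i -> K mu * E i = q ^ (ip mu (alpha n i)) *: (E i * K mu)) /\
  (forall mu i, inL mu -> I i -> K mu * F i = q ^ (- ip mu (alpha n i)) *: (F i * K mu)) /\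
  (forall i j, I i -> I j -> (ip (alpha n i) (alpha n j) == 0) || (ip (alpha n i) (alpha n j) == 2) ->
     E i * E j = E j * E i /\ F i * F j = F j * F i) /\
  (forall i j, I i -> I j -> ip (alpha n i) (alpha n j) = -1 ->
     E i * qbr (E i) (E j) = q *: (qbr (E i) (E j) * E i) /\
     F i * qbr (F i) (F j) = q *: (qbr (F i) (F j) * F i)) /\
  (forall i j, I i -> I j ->
     E i * F j - F j * E i =
       (if i == j then qhat^-1 *: (K (alpha n i) - K (- alpha n i)) else 0)).

Definition qg_agree (A B : algType k) (E F : nat -> A) (K : W n -> A)
  (E' F' : nat -> B) (K' : W n -> B) (f : A -> B) : Prop :=
  (forall i, I i -> f (E i) = E' i /\ f (F i) = F' i) /\
  (forall mu, inL mu -> f (K mu) = K' mu).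

(* (U, E, F, K) is the algebra presented by these generators and relations,
   i.e. it satisfies the relations and is universal for them *)
Definition is_QG (U : algType k) (E F : nat -> U) (K : W n -> U) : Prop :=
  qg_rels E F K /\
  forall (B : algType k) (E' F' : nat -> B) (K' : W n -> B),
    qg_rels E' F' K' ->
    (exists f : U -> B, alg_hom f /\ qg_agree E F K E' F' K' f) /\
    (forall f g : U -> B, alg_hom f -> alg_hom g ->
       qg_agree E F K E' F' K' f -> qg_agree E F K E' F' K' g -> f =1 g).

Definition lusztig (U : algType k) (E F : nat -> U) (K : W n -> U) (T : nat -> U -> U) : Prop :=
  forall i, I i ->
    alg_hom (T i) /\ bijective (T i) /\
    (forall mu, inL mu -> T i (K mu) = K (sref i mu)) /\
    T i (E i) = - (F i * K (alpha n i)) /\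
    T i (F i) = - (K (- alpha n i) * E i) /\
    (forall j, I j -> j != i ->
       (ip (alpha n i) (alpha n j) = 0 -> T i (E j) = E j) /\
       (ip (alpha n i) (alpha n j) = -1 -> T i (E j) = E i * E j - q^-1 *: (E j * E i))).

End QG.

(* root vectors of a word w (0-based):  root_vec w l = T_{w_0} ... T_{w_{l-1}} E_{w_l} *)
Definition root_vec (k : fieldType) (U : algType k) (T : nat -> U -> U) (E : nat -> U)
  (w : seq nat) (l : nat) : U :=
  foldr (fun i x => T i x) (E (nth 0%N w l)) (take l w).

Definition DCKP (k : fieldType) (U : algType k) (T : nat -> U -> U) (E : nat -> U)
  (w : seq nat) : U -> Prop :=
  gen_alg (fun x => exists l, (l < size w)%N /\ x = root_vec T E w l).

(* w_n = (s_{n+1} ... s_1)(s_3 ... s_{n+1}) *)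
Definition wD (n : nat) : seq nat :=
  [seq (n.+1 - j)%N | j <- iota 0 n.+1] ++ iota 3 (n - 1).
(* \hat w_n = w_n s_0 (s_n ... s_3)(s_1 ... s_n) s_0 *)
Definition wA (n : nat) : seq nat :=
  wD n ++ [:: 0%N] ++ [seq (n - j)%N | j <- iota 0 (n - 2)] ++ iota 1 n ++ [:: 0%N].

(* The smash product (U_q^{w_n} # U_D^{>=0}), characterised by:        *)
(*  iA, iH are algebra maps on U_q^{w_n}, resp. U_D^{>=0};             *)
(*  a (x) h |-> iA a * iH h is a linear bijection A (x) H -> S;        *)
(*  iH h * iA a = sum iA (h_(1).a) * iH (h_(2)) for generators h of H  *)
(*  (with the action h.v = sum pi(h)_(1) v S(pi(h)_(2)) written out).  *)
Section Smash.
Variables (k : fieldType) (n : nat) (UD : algType k) (ED : nat -> UD) (KD : W n -> UD)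
  (TD : nat -> UD -> UD).

Definition UDge0 : UD -> Prop :=
  gen_alg (fun x => (exists i, ID n i /\ x = ED i) \/ (exists mu, inLD mu /\ x = KD mu)).

Definition Uwn : UD -> Prop := DCKP TD ED (wD n).

Definition actK (mu : W n) (v : UD) : UD := KD mu * v * KD (- mu).
Definition actE (i : nat) (v : UD) : UD :=
  if (i <= n)%N then ED i * v - KD (- alpha n i) * v * KD (alpha n i) * ED i else 0.

Definition smash_spec (S : algType k) (iA iH : UD -> S) : Prop :=
  alg_hom_on Uwn iA /\ alg_hom_on UDge0 iH /\
  (forall s : S, exists m (a h : 'I_m -> UD),
      (forall j, Uwn (a j) /\ UDge0 (h j)) /\ s = \sum_(j < m) iA (a j) * iH (h j)) /\
  (forall m (a h : 'I_m -> UD), (forall j, Uwn (a j) /\ UDge0 (h j)) ->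
      lin_indep a -> \sum_(j < m) iA (a j) * iH (h j) = 0 -> forall j, h j = 0) /\
  (forall mu a, inLD mu -> Uwn a -> iH (KD mu) * iA a = iA (actK mu a) * iH (KD mu)) /\
  (forall i a, ID n i -> Uwn a ->
      iH (ED i) * iA a = iA (actK (- alpha n i) a) * iH (ED i) + iA (actE i a) * iH 1).

Definition sharp (S : algType k) (iA iH : UD -> S) : S -> Prop :=
  gen_alg (fun s => exists u, Uwn u /\ (s = iA u \/ s = iH u)).

End Smash.

(* Main.v *)
(* The word \hat w_n is w_n followed by its image under the diagram symmetry that
   exchanges the nodes 0 and n + 1.  Hence the first 2n root vectors are the images
   of the x_i, y_i under the inclusion [io] of the finite quantum group, and the last
   2n are their images under [Psi], the symmetry followed by T_{w_n}.  The map [Psi]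
   fixes E_1, .., E_n and sends E_{n+1} to a root vector that q-commutes with the
   first copy, because the corresponding suffix of T_{w_n} E_0 commutes with the
   F_t.  So [io a * Psi h] obeys the same exchange rules as [a # h] in the smash
   product.  It remains to see that products of linearly independent [a]'s with
   [h]'s vanish only trivially: T_{w_n}^{-1} moves the first copy into the
   nonpositive part and the second into the positive part, where the triangular
   decomposition, realized by an action on functionals, separates them.  For this
   T_i^{-1} is replaced by an endomorphism that inverts T_i on the E_j and whose
   values on the F_j are known. *)
Require Import Defs.
From HB Require Import structures.
From mathcomp Require Import all_boot all_order all_algebra.
From mathcomp Require Import ring lra zify.
From mathcomp Require Import boolp classical_sets functions.
Import Order.TTheory GRing.Theory Num.Theory.
Local Open Scope ring_scope.
Set Implicit Arguments. Unset Strict Implicit. Unset Printing Implicit Defensive.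

(** Two gaps in the data shape the proof. The quantum groups are known only through their
    presentations, without bases, so independence has to come from an explicit representation.
    Moreover [lusztig] gives [T i (F i)] but no value of [T i (F j)] for other j. The Chevalley
    involution turns the known values on the E's into values on the F's and yields endomorphisms [S]
    with explicit formulas on all generators. These are compared with T_i on positive elements only,
    which is why every intermediate vector along a word must be shown positive ([pos], [posP]). The
    symmetry also exchanges the nodes 1 and 2 because T_{w_n} exchanges E_1 and E_2; the two
    exchanges cancel in Psi. The exponents agree because T_{w_n} E_0 has weight alpha_{n+1} + delta
    and delta is orthogonal to everything. The map is built as a graph: neither side is presented by
    relations, so that it is well defined and injective is read off from independence, after a
    tensor is rewritten with linearly independent first factors. *)

(** * Identities of noncommutative polynomials by rewriting *)

Module NC.
Section Poly.
Variables (k : fieldType) (A : algType k).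

Inductive expr :=
| Var of nat | Zero | One
| Add of expr & expr | Opp of expr | Mul of expr & expr | Scale of k & expr.

Definition poly := seq (k * seq nat).

Fixpoint norm (e : expr) : poly :=
  match e with
  | Var i => [:: (1, [:: i])]
  | Zero => [::]
  | One => [:: (1, [::])]
  | Add a b => norm a ++ norm b
  | Opp a => map (fun m => (- m.1, m.2)) (norm a)
  | Mul a b =>
      flatten (map (fun m => map (fun p => (m.1 * p.1, m.2 ++ p.2)) (norm b)) (norm a))
  | Scale c a => map (fun m => (c * m.1, m.2)) (norm a)
  end.

(** Letters are compared with [Nat.eqb], so that [fold_coefs] decides equality of closed words by
    unfolding a short list of constants. *)
Fixpoint eqw (u v : seq nat) : bool :=
  match u, v with
  | [::], [::] => true
  | i :: u', j :: v' => if Nat.eqb i j then eqw u' v' else false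
  | _, _ => false
  end.

Fixpoint insert (c : k) (w : seq nat) (l : poly) : poly :=
  match l with
  | [::] => [:: (c, w)]
  | m :: l' => if eqw w m.2 then (c + m.1, m.2) :: l' else m :: insert c w l'
  end.

Definition collect (l : poly) : poly := foldr (fun m => insert m.1 m.2) [::] l.

(** A proposition and not a test: equality in [k] is not decided by computation, so each vanishing
    coefficient becomes a goal. *)
Fixpoint coefs0 (l : poly) : Prop :=
  match l with [::] => True | m :: l' => m.1 = 0 /\ coefs0 l' end.

Definition rule := (seq nat * poly)%type.

Fixpoint strip (p w : seq nat) : option (seq nat) :=
  match p, w with
  | [::], _ => Some w
  | i :: p', j :: w' => if Nat.eqb i j then strip p' w' else None
  | _, _ => None
  end.

Fixpoint head_red (rs : seq rule) (w : seq nat) : option poly :=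
  match rs with
  | [::] => None
  | r :: rs' =>
      match strip r.1 w with
      | Some w' => Some (map (fun m => (m.1, m.2 ++ w')) r.2)
      | None => head_red rs' w
      end
  end.

Fixpoint red1 (rs : seq rule) (w : seq nat) : option poly :=
  match head_red rs w with
  | Some p => Some p
  | None =>
      match w with
      | [::] => None
      | i :: w' =>
          match red1 rs w' with
          | Some p => Some (map (fun m => (m.1, i :: m.2)) p)
          | None => None
          end
      end
  end.

Fixpoint red (fuel : nat) (rs : seq rule) (c : k) (w : seq nat) : poly :=
  match fuel with
  | O => [:: (c, w)]
  | S f =>
      match red1 rs w with
      | None => [:: (c, w)]
      | Some p => flatten (map (fun m => red f rs (c * m.1) m.2) p)
      end
  end.

Definition reduce (fuel : nat) (rs : seq rule) (l : poly) : poly :=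
  flatten (map (fun m => red fuel rs m.1 m.2) l).

Variable env : seq A.

Fixpoint eval (e : expr) : A :=
  match e with
  | Var i => nth 0 env i
  | Zero => 0
  | One => 1
  | Add a b => eval a + eval b
  | Opp a => - eval a
  | Mul a b => eval a * eval b
  | Scale c a => c *: eval a
  end.

Fixpoint word (w : seq nat) : A :=
  match w with [::] => 1 | i :: w' => nth 0 env i * word w' end.

Fixpoint peval (l : poly) : A :=
  match l with [::] => 0 | m :: l' => m.1 *: word m.2 + peval l' end.

Fixpoint rules_ok (rs : seq rule) : Prop :=
  match rs with [::] => True | r :: rs' => word r.1 = peval r.2 /\ rules_ok rs' end.

Lemma word_cat u v : word (u ++ v) = word u * word v.
Proof. by elim: u => [|i u IH] /=; rewrite ?mul1r // IH mulrA. Qed.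

Lemma peval_cat u v : peval (u ++ v) = peval u + peval v.
Proof. by elim: u => [|i u IH] /=; rewrite ?add0r // IH addrA. Qed.

Lemma peval_scale (c : k) l : peval (map (fun m => (c * m.1, m.2)) l) = c *: peval l.
Proof. by elim: l => [|m l IH] /=; rewrite ?scaler0 // IH scalerDr scalerA. Qed.

Lemma peval_mull c w l :
  peval (map (fun p => (c * p.1, w ++ p.2)) l) = (c *: word w) * peval l.
Proof.
elim: l => [|m l IH] /=; first by rewrite mulr0.
by rewrite IH mulrDr word_cat -!(scalerAl, scalerAr) scalerA.
Qed.

Lemma norm_ok e : peval (norm e) = eval e.
Proof.
elim: e => [i|||a IHa b IHb|a IHa|a IHa b IHb|c a IHa] //=.
- by rewrite mulr1 scale1r addr0.
- by rewrite scale1r addr0.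
- by rewrite peval_cat IHa IHb.
- rewrite -IHa; elim: (norm a) => [|m l IH] /=; first by rewrite oppr0.
  by rewrite IH opprD scaleNr.
- rewrite -IHa -IHb; elim: (norm a) => [|m l IH] /=; first by rewrite mul0r.
  by rewrite peval_cat peval_mull IH mulrDl.
- by rewrite peval_scale IHa.
Qed.

Lemma eqwP u v : eqw u v -> u = v.
Proof.
elim: u v => [|i u IH] [|j v] //=.
by case: (PeanoNat.Nat.eqb_spec i j) => // -> /IH ->.
Qed.

Lemma insert_ok c w l : peval (insert c w l) = c *: word w + peval l.
Proof.
elim: l => [|m l IH] //=.
case E: (eqw w m.2) => /=; last by rewrite IH addrCA.
by rewrite (eqwP E) scalerDl addrA.
Qed.

Lemma collect_ok l : peval (collect l) = peval l.
Proof. by elim: l => [|m l IH] //=; rewrite insert_ok IH. Qed.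

Lemma coefs0_ok l : coefs0 l -> peval l = 0.
Proof. by elim: l => [|m l IH] //= [-> /IH ->]; rewrite scale0r addr0. Qed.

Lemma strip_ok p w w' : strip p w = Some w' -> w = p ++ w'.
Proof.
elim: p w => [|i p IH] [|j w] //=; try by case.
by case: (PeanoNat.Nat.eqb_spec i j) => // -> /IH ->.
Qed.

Lemma head_red_ok rs w p : rules_ok rs -> head_red rs w = Some p -> word w = peval p.
Proof.
elim: rs => [|r rs IH] //= [Hr Hrs].
case E: (strip r.1 w) => [w'|]; last exact: IH.
case=> <-; rewrite (strip_ok E) word_cat Hr.
elim: r.2 => [|m l IHl] /=; first by rewrite mul0r.
by rewrite mulrDl IHl word_cat -scalerAl.
Qed.

Lemma red1_ok rs w p : rules_ok rs -> red1 rs w = Some p -> word w = peval p.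
Proof.
move=> Hrs; elim: w p => [|i w IH] p /=.
  by case E: (head_red rs [::]) => [p'|] // [<-]; rewrite -(head_red_ok Hrs E).
case E: (head_red rs (i :: w)) => [p'|].
  by case=> <-; rewrite -(head_red_ok Hrs E).
case E1: (red1 rs w) => [p'|] // [<-]; rewrite (IH _ E1).
elim: p' {E1} => [|m l IHl] /=; first by rewrite mulr0.
by rewrite mulrDr IHl -scalerAr.
Qed.

(** Each rewriting step preserves the value, so the result is correct wherever the fuel runs out;
    termination and confluence affect only the success of the tactic. *)
Lemma red_ok fuel rs c w : rules_ok rs -> peval (red fuel rs c w) = c *: word w.
Proof.
move=> Hrs; elim: fuel c w => [|f IH] c w /=; first by rewrite addr0.
case E: (red1 rs w) => [p|] /=; last by rewrite addr0.
rewrite (red1_ok Hrs E); elim: p {E} => [|m l IHl] /=; first by rewrite scaler0.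
by rewrite peval_cat IH IHl scalerDr scalerA.
Qed.

Lemma reduce_ok fuel rs l : rules_ok rs -> peval (reduce fuel rs l) = peval l.
Proof.
move=> Hrs; rewrite /reduce; elim: l => [|m l IH] //=.
by rewrite peval_cat IH red_ok.
Qed.

Lemma sound fuel (rs : seq rule) a b :
  rules_ok rs -> coefs0 (collect (reduce fuel rs (norm (Add a (Opp b))))) ->
  eval a = eval b.
Proof.
move=> Hrs /coefs0_ok; rewrite collect_ok reduce_ok // norm_ok /= => /eqP.
by rewrite subr_eq0 => /eqP.
Qed.

End Poly.

Ltac index x l :=
  lazymatch l with
  | x :: _ => constr:(O)
  | _ :: ?l' => let n := index x l' in constr:(S n)
  end.

Ltac mem x l :=
  lazymatch l with
  | [::] => constr:(false)
  | x :: _ => constr:(true)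
  | _ :: ?l' => mem x l'
  end.

Ltac add x l := let b := mem x l in
  lazymatch b with true => l | false => constr:(x :: l) end.

Ltac atoms l t :=
  lazymatch t with
  | (?a + ?b)%R => let l1 := atoms l a in atoms l1 b
  | (- ?a)%R => atoms l a
  | (?a * ?b)%R => let l1 := atoms l a in atoms l1 b
  | (_ *: ?a)%R => atoms l a
  | 0%R => l
  | 1%R => l
  | _ => add t l
  end.

Ltac reify k l t :=
  lazymatch t with
  | (?a + ?b)%R => let x := reify k l a in let y := reify k l b in constr:(@Add k x y)
  | (- ?a)%R => let x := reify k l a in constr:(@Opp k x)
  | (?a * ?b)%R => let x := reify k l a in let y := reify k l b in constr:(@Mul k x y)
  | (?c *: ?a)%R => let x := reify k l a in constr:(@Scale k c x)
  | 0%R => constr:(@Zero k)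
  | 1%R => constr:(@One k)
  | _ => let n := index t l in constr:(@Var k n)
  end.

Ltac atoms_rules l rs :=
  lazymatch rs with
  | (?rs', ?r) =>
      let l1 := atoms_rules l rs' in
      lazymatch type of r with ?a = ?b => let l2 := atoms l1 a in atoms l2 b end
  | tt => l
  end.

Ltac word_of e :=
  lazymatch e with
  | Mul ?a ?b => let u := word_of a in let v := word_of b in
                 let w := eval cbv [cat] in (u ++ v) in w
  | Var _ ?n => constr:([:: n])
  | One _ => constr:(@nil nat)
  end.

Ltac reify_rules k l rs :=
  lazymatch rs with
  | (?rs', ?r) =>
      let t := reify_rules k l rs' in
      lazymatch type of r with
      | ?a = ?b =>
          let x := reify k l a in let y := reify k l b in
          let w := word_of x in
          constr:((w, norm y) :: t)
      end
  | tt => constr:(@nil (rule k))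
  end.

Ltac fold_coefs :=
  cbv [norm eqw insert collect coefs0 strip head_red red1 red reduce
       map flatten foldr cat fst snd Nat.eqb].

Ltac prove_rules rs :=
  lazymatch rs with
  | (?rs', ?r) =>
     refine (conj _ _);
     [ lazymatch type of r with ?a = ?b =>
         transitivity a;
         [ cbn [word nth fst]; rewrite ?mulr1 ?mulrA; reflexivity
         | rewrite norm_ok; exact r ] end
     | prove_rules rs' ]
  | tt => exact I
  end.

(* Decides an identity of noncommutative polynomials modulo [rs = (tt, r1, .., rn)],
   equations whose left-hand sides are words and are used as rewriting rules; the
   coefficient identities are left as goals. *)
Ltac reduce_with rs :=
  lazymatch goal with
  | |- @eq ?T ?a ?b =>
      let l0 := constr:(@nil T) in
      let l1 := atoms l0 a in let l2 := atoms l1 b in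
      let l := atoms_rules l2 rs in
      let k := lazymatch goal with kk : fieldType |- _ => constr:(kk : fieldType) | kk : closedFieldType |- _ => constr:(kk : fieldType) end in
      let x := reify k l a in let y := reify k l b in
      let r := reify_rules k l rs in
      refine (@sound k _ l 40 r x y _ _);
      [ prove_rules rs | fold_coefs; repeat split ]
  end.

End NC.

(** The coefficient goals are identities of rational functions in q. The side conditions of [field]
    are looked up among the hypotheses, whence the form [q * q - 1 != 0] for the invertibility of q
    - q^-1. *)
Ltac nc rs :=
  NC.reduce_with rs; try (field; repeat (apply/andP; split); first [assumption | exact isT]).

(** * Weights *)
Section Weights.
Variable n : nat.
Implicit Types mu la nu : W n.

Lemma ipC mu la : ip mu la = ip la mu.
Proof. by apply: eq_bigr => j _; rewrite mulrC. Qed.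

Lemma ipDl mu nu la : ip (mu + nu) la = ip mu la + ip nu la.
Proof. by rewrite /ip -big_split; apply: eq_bigr => j _; rewrite mxE mulrDl. Qed.

Lemma ipDr la mu nu : ip la (mu + nu) = ip la mu + ip la nu.
Proof. by rewrite ipC ipDl !(ipC la). Qed.

Lemma ipNl mu la : ip (- mu) la = - ip mu la.
Proof. by rewrite /ip -sumrN; apply: eq_bigr => j _; rewrite mxE mulNr. Qed.

Lemma ipNr la mu : ip la (- mu) = - ip la mu.
Proof. by rewrite ipC ipNl ipC. Qed.

Lemma ip0l la : ip 0 la = 0.
Proof. by rewrite /ip big1 // => j _; rewrite mxE mul0r. Qed.

Lemma ip0r la : ip la 0 = 0.
Proof. by rewrite ipC ip0l. Qed.

Lemma ipMzl mu la (z : int) : ip (mu *~ z) la = ip mu la * z.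
Proof.
rewrite -scaler_int /ip mulr_suml; apply: eq_bigr => j _.
by rewrite mxE intz; ring.
Qed.

Lemma ipMzr mu la (z : int) : ip mu (la *~ z) = ip mu la * z.
Proof. by rewrite ipC ipMzl ipC. Qed.

Lemma ip_ecoordr mu b : (0 < b <= n.+1)%N -> ip mu (ecoord n b) = mu 0 (inord b).
Proof.
case/andP => b0 bn; rewrite /ip (bigD1 (inord b)) /=; last by rewrite inordK.
rewrite big1 => [|j /andP[_ jb]]; first by rewrite mxE !eqxx mulr1 addr0.
by rewrite mxE (negPf jb) ?andbF mulr0.
Qed.

Lemma ip_delta mu : ip mu (delta n) = 0.
Proof.
rewrite /ip big1 // => j j0; rewrite /delta /ecoord mxE eqxx /=.
case: eqP => [E|]; last by rewrite mulr0.
by move: j0; rewrite E inordK.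
Qed.

Lemma ip_ecoord a b : (0 < a <= n.+1)%N -> (0 < b <= n.+1)%N ->
  ip (ecoord n a) (ecoord n b) = (a == b)%:R.
Proof.
move=> /andP[a0 an] /andP[b0 bn]; rewrite ip_ecoordr ?b0 // mxE eqxx /=.
congr (_%:R); case: (altP (a =P b)) => [->|ab]; first by rewrite eqxx.
apply/eqP; rewrite eqb0; apply: contra ab => /eqP/(congr1 val) /=.
by rewrite !inordK // => ->.
Qed.

Lemma esumD mu la : esum (mu + la) = esum mu + esum la.
Proof. by rewrite /esum -big_split; apply: eq_bigr => j _; rewrite mxE. Qed.

Lemma esumN mu : esum (- mu) = - esum mu.
Proof. by rewrite /esum -sumrN; apply: eq_bigr => j _; rewrite mxE. Qed.

Lemma esumMz mu (z : int) : esum (mu *~ z) = esum mu * z.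
Proof.
rewrite -scaler_int /esum mulr_suml; apply: eq_bigr => j _.
by rewrite mxE intz mulrC.
Qed.

Lemma esum_ecoord a : (0 < a <= n.+1)%N -> esum (ecoord n a) = 1.
Proof.
move=> ha; transitivity (ip (ecoord n a) (ecoord n a)); last by rewrite ip_ecoord ?eqxx.
rewrite /esum /ip; apply: eq_bigr => j _.
by rewrite mxE eqxx /=; case: (_ == _); rewrite ?mulr1 ?mulr0.
Qed.

Lemma esum_delta : esum (delta n) = 0.
Proof.
rewrite /esum big1 // => j j0; rewrite mxE eqxx /=; case: eqP => [E|]; last by [].
by move: j0; rewrite E inordK.
Qed.

Lemma odd_absz_add (x y : int) : ~~ odd `|x|%N -> ~~ odd `|y|%N -> ~~ odd `|(x + y)%R|%N.
Proof. lia. Qed.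

Lemma odd_absz_opp (x : int) : ~~ odd `|x|%N -> ~~ odd `|(- x)%R|%N.
Proof. lia. Qed.

Lemma odd_absz_mul (x y : int) : ~~ odd `|x|%N -> ~~ odd `|(x * y)%R|%N.
Proof. by rewrite abszM oddM negb_and => ->. Qed.

Lemma inLA_D mu la : inLA mu -> inLA la -> inLA (mu + la).
Proof. by rewrite /inLA esumD; apply: odd_absz_add. Qed.

Lemma inLA_N mu : inLA mu -> inLA (- mu).
Proof. by rewrite /inLA esumN; apply: odd_absz_opp. Qed.

Lemma inLA_Mz mu z : inLA mu -> inLA (mu *~ z).
Proof. by rewrite /inLA esumMz; apply: odd_absz_mul. Qed.

Lemma inLA_0 : inLA (0 : W n).
Proof. by rewrite /inLA /esum big1 // => j _; rewrite mxE. Qed.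

Lemma inLD_LA mu : inLD mu -> inLA mu.
Proof. by case/andP. Qed.

Lemma inLD_D mu la : inLD mu -> inLD la -> inLD (mu + la).
Proof.
move=> /andP[/eqP h1 h2] /andP[/eqP h3 h4].
by rewrite /inLD mxE h1 h3 addr0 eqxx; apply: inLA_D.
Qed.

Lemma inLD_N mu : inLD mu -> inLD (- mu).
Proof.
by move=> /andP[/eqP h1 h2]; rewrite /inLD mxE h1 oppr0 eqxx; apply: inLA_N.
Qed.

Lemma inLD_Mz mu z : inLD mu -> inLD (mu *~ z).
Proof.
move=> /andP[/eqP h1 h2]; rewrite /inLD -scaler_int mxE h1 mulr0 eqxx.
by rewrite scaler_int; apply: inLA_Mz.
Qed.

Lemma inLD_0 : inLD (0 : W n).
Proof. by rewrite /inLD mxE eqxx; apply: inLA_0. Qed.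

Hypothesis n3 : (3 <= n)%N.

Lemma alpha_ge2 i : (2 <= i)%N -> alpha n i = ecoord n i - ecoord n i.-1.
Proof. by case: i => [|[|i]]. Qed.

(** Edges of the affine diagram: the path 2, 3, .., n + 1, with the node 1 attached to 3 and the
    node 0 attached to n. *)
Definition adj (i j : nat) : bool :=
  [|| (i == 0%N) && (j == n), (j == 0%N) && (i == n),
      (i == 1%N) && (j == 3%N), (j == 1%N) && (i == 3%N),
      (2 <= i)%N && (j == i.+1) | (2 <= j)%N && (i == j.+1)].

Lemma adjC i j : adj i j = adj j i.
Proof. rewrite /adj; lia. Qed.

Lemma adj_neq i j : adj i j -> i != j.
Proof. rewrite /adj; lia. Qed.

Lemma adj_irr i : adj i i = false.
Proof. rewrite /adj; lia. Qed.

Lemma ip_alpha i j : (i <= n.+1)%N -> (j <= n.+1)%N ->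
  ip (alpha n i) (alpha n j) = if i == j then 2 else if adj i j then -1 else 0.
Proof.
wlog: i j / (i <= j)%N.
  move=> H hi hj; case: (leqP i j) => ij; first exact: H.
  by rewrite ipC H ?(ltnW ij) // adjC eq_sym.
move=> ij hi hj.
(* As an integer combination of truth values the right-hand side is accessible to [lia], which then
   handles all coincidences of coordinates. *)
have -> : (if i == j then 2 else if adj i j then -1 else 0) =
  ((i == j) * 2)%:Z - (~~ (i == j) && adj i j)%:Z :> int by case: eqP; case: adj.
rewrite /adj; case: i ij hi => [|[|i]] ij hi; case: j ij hj => [|[|j]] // ij hj;
  rewrite /alpha /= ?ipDl ?ipDr ?ipNl ?ipNr ?(ipC (delta _)) ?ip_delta ?ip_ecoord ?natz;
  lia.
Qed.

Lemma inLA_alpha i : (i <= n.+1)%N -> inLA (alpha n i).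
Proof.
move=> hi; rewrite /inLA; case: i hi => [|[|i]] hi;
  rewrite /alpha /= ?(esumD, esumN, esum_delta, esum_ecoord) //; try lia.
Qed.

Lemma inLD_alpha i : ID n i -> inLD (alpha n i).
Proof.
move=> /andP[i0 hi]; rewrite /inLD; apply/andP; split; last exact: inLA_alpha.
have e0 a : (0 < a <= n.+1)%N -> (ecoord n a) 0 0 = 0.
  case/andP=> a0 an; rewrite mxE eqxx /=; case: eqP => [/(congr1 val) /=|//].
  by rewrite inordK // => E; rewrite -E in a0.
have eD (u v : W n) : (u + v) 0 0 = u 0 0 + v 0 0 by rewrite mxE.
have eN (u : W n) : (- u) 0 0 = - u 0 0 by rewrite mxE.
by case: i i0 hi => [|[|i]] // _ hi; rewrite /alpha /= eD ?eN !e0 //; lia.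
Qed.

Lemma inLA_sref i mu : (i <= n.+1)%N -> inLA mu -> inLA (sref i mu).
Proof. by move=> hi hm; apply: inLA_D => //; apply/inLA_N/inLA_Mz/inLA_alpha. Qed.

Lemma inLD_sref i mu : ID n i -> inLD mu -> inLD (sref i mu).
Proof. by move=> hi hm; apply: inLD_D => //; apply/inLD_N/inLD_Mz/inLD_alpha. Qed.

Lemma srefD i mu la : sref i (mu + la) = sref i mu + sref i la.
Proof. by rewrite /sref ipDl mulrzDr opprD addrACA. Qed.

Lemma srefN i mu : sref i (- mu) = - sref i mu.
Proof. by rewrite /sref ipNl mulrNz opprB addrC opprK. Qed.

Lemma sref_alpha i : (i <= n.+1)%N -> sref i (alpha n i) = - alpha n i.
Proof.
move=> hi; rewrite /sref ip_alpha // eqxx.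
rewrite -[X in X - _]mulr1z -mulrzBr.
by rewrite (_ : 1 - 2 = -1 :> int) // mulrNz mulr1z.
Qed.

Lemma srefK i mu : (i <= n.+1)%N -> sref i (sref i mu) = mu.
Proof.
move=> hi; have E : ip (sref i mu) (alpha n i) = - ip mu (alpha n i).
  by rewrite /sref ipDl ipNl ipMzl ip_alpha // eqxx; ring.
by rewrite {1}/sref E mulrNz opprK /sref subrK.
Qed.

Lemma ip_sref i mu la : (i <= n.+1)%N -> ip (sref i mu) la = ip mu (sref i la).
Proof.
move=> hi; rewrite /sref !(ipDl, ipDr, ipNl, ipNr, ipMzl, ipMzr).
by rewrite (ipC la (alpha n i)); ring.
Qed.

End Weights.

(* Common features of the finite and of the affine type. *)
Record root_datum (n : nat) (I : nat -> bool) (inL : W n -> bool) : Prop := RootDatum {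
  rd_le : forall i, I i -> (i <= n.+1)%N;
  rd_0 : inL 0;
  rd_D : forall mu la, inL mu -> inL la -> inL (mu + la);
  rd_N : forall mu, inL mu -> inL (- mu);
  rd_alpha : forall i, I i -> inL (alpha n i);
  rd_sref : forall i mu, I i -> inL mu -> inL (sref i mu)
}.

Section RootDatum.
Variable n : nat.
Hypothesis n3 : (3 <= n)%N.

Lemma rd_D_type : root_datum (ID n) (@inLD n).
Proof.
split; first by move=> i /andP[].
- exact: inLD_0.
- exact: inLD_D.
- exact: inLD_N.
- exact: inLD_alpha.
- exact: inLD_sref.
Qed.

Lemma rd_A_type : root_datum (IA n) (@inLA n).
Proof.
split=> //; first exact: inLA_0.
- exact: inLA_D.
- exact: inLA_N.
- exact: inLA_alpha.
- exact: inLA_sref.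
Qed.

Variables (I : nat -> bool) (inL : W n -> bool).
Hypothesis HI : root_datum I inL.
Variables i j : nat.
Hypotheses (hi : I i) (hj : I j).

Lemma ip_self : ip (alpha n i) (alpha n i) = 2.
Proof. by rewrite ip_alpha ?(rd_le HI) // eqxx. Qed.
Lemma ip_adj : adj n i j -> ip (alpha n i) (alpha n j) = -1.
Proof.
by move=> a; rewrite ip_alpha ?(rd_le HI hi) ?(rd_le HI hj) // (negPf (adj_neq n3 a)) a.
Qed.
Lemma ip_nadj : i != j -> ~~ adj n i j -> ip (alpha n i) (alpha n j) = 0.
Proof.
move=> ij a; rewrite ip_alpha ?(rd_le HI hi) ?(rd_le HI hj) //.
by rewrite (negPf ij) (negPf a).
Qed.
End RootDatum.

(** * Algebra maps and generated subalgebras *)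
Section AlgHom.
Variable k : fieldType.

Section On.
Variables (A B : algType k) (P : A -> Prop) (f : A -> B).
Hypothesis Hf : alg_hom_on P f.

Lemma aho1 : f 1 = 1. Proof. by case: Hf. Qed.
Lemma ahoD x y : P x -> P y -> f (x + y) = f x + f y.
Proof. by move=> hx hy; case: Hf => _ [H _]; case: (H x y hx hy). Qed.
Lemma ahoM x y : P x -> P y -> f (x * y) = f x * f y.
Proof. by move=> hx hy; case: Hf => _ [H _]; case: (H x y hx hy). Qed.
Lemma ahoZ c x : P x -> f (c *: x) = c *: f x.
Proof. by case: Hf => _ [_ H]; apply: H. Qed.
End On.

Section Total.
Variables (A B : algType k) (f : A -> B).
Hypothesis Hf : alg_hom f.

Lemma ah1 : f 1 = 1. Proof. exact: aho1 Hf. Qed.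
Lemma ahD x y : f (x + y) = f x + f y. Proof. exact: (ahoD Hf I I). Qed.
Lemma ahM x y : f (x * y) = f x * f y. Proof. exact: (ahoM Hf I I). Qed.
Lemma ahZ c x : f (c *: x) = c *: f x. Proof. exact: (ahoZ Hf _ I). Qed.
Lemma ah0 : f 0 = 0. Proof. by rewrite -(scale0r 0) ahZ scale0r. Qed.
Lemma ahN x : f (- x) = - f x. Proof. by rewrite -scaleN1r ahZ scaleN1r. Qed.
Lemma ahB x y : f (x - y) = f x - f y. Proof. by rewrite ahD ahN. Qed.
Lemma ah_sum (J : finType) (g : J -> A) : f (\sum_j g j) = \sum_j f (g j).
Proof. exact: (big_morph f ahD ah0). Qed.
Lemma ah_qbr q x y : f (qbr q x y) = qbr q (f x) (f y).
Proof. by rewrite /qbr ahB ahZ !ahM. Qed.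
End Total.

Lemma alg_hom_id (A : algType k) : alg_hom (@id A).
Proof. by []. Qed.

Lemma alg_hom_comp (A B C : algType k) (g : B -> C) (f : A -> B) :
  alg_hom g -> alg_hom f -> alg_hom (fun x => g (f x)).
Proof.
move=> hg hf; split; first by rewrite (ah1 hf) (ah1 hg).
split; last by move=> c x _; rewrite (ahZ hf) (ahZ hg).
by move=> x y _ _; rewrite (ahD hf) (ahM hf) (ahD hg) (ahM hg).
Qed.

Lemma alg_hom_inv (A : algType k) (f g : A -> A) :
  alg_hom f -> cancel f g -> cancel g f -> alg_hom g.
Proof.
move=> hf fK gK; have fI := can_inj fK.
split; first by apply: fI; rewrite gK (ah1 hf).
split=> [x y _ _|c x _]; last by apply: fI; rewrite gK (ahZ hf) gK.
by split; apply: fI; rewrite ?(ahD hf) ?(ahM hf) !gK.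
Qed.

Section Gen.
Variable A : algType k.
Implicit Types (X Y : A -> Prop).

Lemma ga_sub X Y x : (forall y, X y -> gen_alg Y y) -> gen_alg X x -> gen_alg Y x.
Proof. by move=> H; elim=> *; [exact: H|exact: ga_one|exact: ga_add|exact: ga_scale|exact: ga_mul]. Qed.

Lemma ga_zero X : gen_alg X 0.
Proof. by rewrite -(scale0r 1); apply/ga_scale/ga_one. Qed.

Lemma ga_opp X x : gen_alg X x -> gen_alg X (- x).
Proof. by rewrite -scaleN1r; apply: ga_scale. Qed.

Lemma ga_subr X x y : gen_alg X x -> gen_alg X y -> gen_alg X (x - y).
Proof. by move=> hx hy; apply: ga_add => //; apply: ga_opp. Qed.

Lemma ga_qbr X q x y : gen_alg X x -> gen_alg X y -> gen_alg X (qbr q x y).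
Proof. by move=> hx hy; apply: ga_subr; last apply: ga_scale; apply: ga_mul. Qed.

End Gen.

Lemma ga_hom (A B : algType k) (X : A -> Prop) (Y : B -> Prop) (f : A -> B) x :
  alg_hom f -> (forall y, X y -> gen_alg Y (f y)) -> gen_alg X x -> gen_alg Y (f x).
Proof.
move=> hf H; elim=> [y Xy||y z _ hy _ hz|c y _ hy|y z _ hy _ hz].
- exact: H.
- by rewrite (ah1 hf); apply: ga_one.
- by rewrite (ahD hf); apply: ga_add.
- by rewrite (ahZ hf); apply: ga_scale.
- by rewrite (ahM hf); apply: ga_mul.
Qed.

Lemma ga_eq (A B : algType k) (X : A -> Prop) (f g : A -> B) x :
  alg_hom f -> alg_hom g -> (forall y, X y -> f y = g y) -> gen_alg X x -> f x = g x.
Proof.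
move=> hf hg H; elim=> [y Xy||y z _ hy _ hz|c y _ hy|y z _ hy _ hz].
- exact: H.
- by rewrite (ah1 hf) (ah1 hg).
- by rewrite (ahD hf) (ahD hg) hy hz.
- by rewrite (ahZ hf) (ahZ hg) hy.
- by rewrite (ahM hf) (ahM hg) hy hz.
Qed.

End AlgHom.

(** * Rank two computations *)
Section RankTwo.
Variables (k : fieldType) (q : k) (A : algType k).
Hypotheses (q0 : q != 0) (q2 : q * q - 1 != 0).

(** Relations of two adjacent nodes, oriented as rewriting rules towards the order F, E, K. The
    q-Serre relations are kept apart, since these rules are also applied to operators for which they
    fail. *)
Record pair_rels (ei ej fi fj ki ki' kj kj' : A) : Prop := PairRels {
  pr_kk1 : ki * ki' = 1;
  pr_kk2 : ki' * ki = 1;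
  pr_kc1 : kj * ki = ki * kj;
  pr_kc2 : kj * ki' = ki' * kj;
  pr_kc3 : kj' * ki = ki * kj';
  pr_kc4 : kj' * ki' = ki' * kj';
  pr_kiei : ki * ei = (q * q) *: (ei * ki);
  pr_kiei' : ki' * ei = (q * q)^-1 *: (ei * ki');
  pr_kifi : ki * fi = (q * q)^-1 *: (fi * ki);
  pr_kifi' : ki' * fi = (q * q) *: (fi * ki');
  pr_kiej : ki * ej = q^-1 *: (ej * ki);
  pr_kiej' : ki' * ej = q *: (ej * ki');
  pr_kifj : ki * fj = q *: (fj * ki);
  pr_kifj' : ki' * fj = q^-1 *: (fj * ki');
  pr_kjei : kj * ei = q^-1 *: (ei * kj);
  pr_kjei' : kj' * ei = q *: (ei * kj');
  pr_kjfi : kj * fi = q *: (fi * kj);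
  pr_kjfi' : kj' * fi = q^-1 *: (fi * kj');
  pr_kjej : kj * ej = (q * q) *: (ej * kj);
  pr_kjej' : kj' * ej = (q * q)^-1 *: (ej * kj');
  pr_kjfj : kj * fj = (q * q)^-1 *: (fj * kj);
  pr_kjfj' : kj' * fj = (q * q) *: (fj * kj');
  pr_eifi : ei * fi = fi * ei + (q - q^-1)^-1 *: (ki - ki');
  pr_ejfj : ej * fj = fj * ej + (q - q^-1)^-1 *: (kj - kj');
  pr_eifj : ei * fj = fj * ei;
  pr_ejfi : ej * fi = fi * ej
}.

Section Pair.
Variables ei ej fi fj ki ki' kj kj' : A.
Hypotheses (R : pair_rels ei ej fi fj ki ki' kj kj').

Ltac go0 := nc (tt, pr_kk1 R, pr_kk2 R, pr_kc1 R, pr_kc2 R, pr_kc3 R, pr_kc4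
    R, pr_kiei R, pr_kiei' R, pr_kifi R, pr_kifi' R, pr_kiej R, pr_kiej' R,
    pr_kifj R, pr_kifj' R, pr_kjei R, pr_kjei' R, pr_kjfi R, pr_kjfi' R,
    pr_kjej R, pr_kjej' R, pr_kjfj R, pr_kjfj' R, pr_eifi R, pr_ejfj R,
    pr_eifj R, pr_ejfi R).

(** The q-Serre elements commute with the opposite generators by the rank two relations alone; this
    and the three lemmas below make functionals killed by these elements stable under the action. *)
Lemma pair_serre_Ei :
  (ei * ei * ej - (q + q^-1) *: (ei * ej * ei) + ej * ei * ei) * fi =
  fi * (ei * ei * ej - (q + q^-1) *: (ei * ej * ei) + ej * ei * ei).
Proof. go0. Qed.
Lemma pair_serre_Ej :
  (ei * ei * ej - (q + q^-1) *: (ei * ej * ei) + ej * ei * ei) * fj =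
  fj * (ei * ei * ej - (q + q^-1) *: (ei * ej * ei) + ej * ei * ei).
Proof. go0. Qed.
Lemma pair_serre_Fi :
  ei * (fi * fi * fj - (q + q^-1) *: (fi * fj * fi) + fj * fi * fi) =
  (fi * fi * fj - (q + q^-1) *: (fi * fj * fi) + fj * fi * fi) * ei.
Proof. go0. Qed.
Lemma pair_serre_Fj :
  ej * (fi * fi * fj - (q + q^-1) *: (fi * fj * fi) + fj * fi * fi) =
  (fi * fi * fj - (q + q^-1) *: (fi * fj * fi) + fj * fi * fi) * ej.
Proof. go0. Qed.

Hypotheses
  (serreE : ei * ei * ej = (q + q^-1) *: (ei * ej * ei) - ej * ei * ei)
  (serreF : fi * fi * fj = (q + q^-1) *: (fi * fj * fi) - fj * fi * fi).

Ltac go := nc (tt, pr_kk1 R, pr_kk2 R, pr_kc1 R, pr_kc2 R, pr_kc3 R, pr_kc4 R,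
    pr_kiei R, pr_kiei' R, pr_kifi R, pr_kifi' R, pr_kiej R, pr_kiej' R,
    pr_kifj R, pr_kifj' R, pr_kjei R, pr_kjei' R, pr_kjfi R, pr_kjfi' R,
    pr_kjej R, pr_kjej' R, pr_kjfj R, pr_kjfj' R, pr_eifi R, pr_ejfj R,
    pr_eifj R, pr_ejfi R, serreE, serreF).

(** [X] and [G] are the values on E_j and F_j of the braid operator at i, [Y] and [H] those of its
    inverse. The lemmas below check that these formulas respect the relations and invert each
    other. *)
Let X := qbr q ei ej.
Let Y := qbr q ej ei.
Let G := fj * fi - q *: (fi * fj).
Let H := fi * fj - q *: (fj * fi).

Lemma pair_XG : X * G - G * X = (q - q^-1)^-1 *: (ki * kj - ki' * kj').
Proof. rewrite /X /G /qbr; go. Qed.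
Lemma pair_YH : Y * H - H * Y = (q - q^-1)^-1 *: (ki * kj - ki' * kj').
Proof. rewrite /Y /H /qbr; go. Qed.
Lemma pair_fkG : fi * ki * G = G * (fi * ki).
Proof. rewrite /G; go. Qed.
Lemma pair_kfH : ki' * fi * H = H * (ki' * fi).
Proof. rewrite /H; go. Qed.
Lemma pair_Xke : X * (ki' * ei) = ki' * ei * X.
Proof. rewrite /X /qbr; go. Qed.
Lemma pair_Yek : Y * (ei * ki) = ei * ki * Y.
Proof. rewrite /Y /qbr; go. Qed.
Lemma pair_TY : qbr q X (- (fi * ki)) = ej.
Proof. rewrite /X /qbr; go. Qed.
Lemma pair_SX : qbr q (- (ki' * fi)) Y = ej.
Proof. rewrite /Y /qbr; go. Qed.
Lemma pair_TH : - (ki' * ei) * G - q *: (G * - (ki' * ei)) = fj.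
Proof. rewrite /G; go. Qed.

Lemma pair_SG : H * - (ei * ki) - q *: (- (ei * ki) * H) = fj.
Proof. rewrite /H; go. Qed.
End Pair.
End RankTwo.

Section Triple.
Variables (k : fieldType) (q : k) (A : algType k).
Hypotheses (q0 : q != 0) (q2 : q * q - 1 != 0).
Variables ei ej fi fl ki ki' : A.
Hypotheses
  (kiej : ki * ej = q^-1 *: (ej * ki)) (kiej' : ki' * ej = q *: (ej * ki'))
  (kifl : ki * fl = q *: (fl * ki)) (kifl' : ki' * fl = q^-1 *: (fl * ki'))
  (eifi : ei * fi = fi * ei + (q - q^-1)^-1 *: (ki - ki'))
  (eifl : ei * fl = fl * ei) (ejfi : ej * fi = fi * ej) (ejfl : ej * fl = fl * ej).
Ltac go := nc (tt, kiej, kiej', kifl, kifl', eifi, eifl, ejfi, ejfl).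

(** The case of two different neighbours j and l of i: both brackets involve the node i, and the
    Cartan terms coming from E_i and F_i cancel. *)
Lemma triple_XG : qbr q ei ej * (fl * fi - q *: (fi * fl)) =
  (fl * fi - q *: (fi * fl)) * qbr q ei ej.
Proof. rewrite /qbr; go. Qed.
Lemma triple_YH : qbr q ej ei * (fi * fl - q *: (fl * fi)) =
  (fi * fl - q *: (fl * fi)) * qbr q ej ei.
Proof. rewrite /qbr; go. Qed.
End Triple.

(* What remains of [qg_rels] for operators that violate the q-Serre relations. *)
Definition pre_rels (k : fieldType) (q : k) (n : nat) (I : nat -> bool)
  (inL : W n -> bool) (A : algType k) (E F : nat -> A) (K : W n -> A) : Prop :=
  [/\ K 0 = 1,
      forall mu la, inL mu -> inL la -> K mu * K la = K (mu + la),
      forall mu i, inL mu -> I i -> K mu * E i = q ^ (ip mu (alpha n i)) *: (E i * K mu),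
      forall mu i, inL mu -> I i -> K mu * F i = q ^ (- ip mu (alpha n i)) *: (F i * K mu) &
      forall i j, I i -> I j -> E i * F j - F j * E i =
        if i == j then (qhat q)^-1 *: (K (alpha n i) - K (- alpha n i)) else 0].

Lemma qg_pre (k : fieldType) (q : k) (n : nat) (I : nat -> bool) (inL : W n -> bool)
  (A : algType k) (E F : nat -> A) (K : W n -> A) :
  qg_rels q I inL E F K -> pre_rels q I inL E F K.
Proof. by case=> h0 [h1 [h2 [h3 [_ [_ h4]]]]]; split. Qed.
Coercion qg_pre : qg_rels >-> pre_rels.

(** * Lusztig automorphisms on the negative part *)
Section QG.
Variables (k : fieldType) (q : k) (n : nat) (I : nat -> bool) (inL : W n -> bool).
Hypotheses (q0 : q != 0) (q2 : q * q - 1 != 0) (n3 : (3 <= n)%N).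
Hypothesis HI : root_datum I inL.
Let I_le := rd_le HI.
Let L0 := rd_0 HI.
Let LD := rd_D HI.
Let LN := rd_N HI.
Let La := rd_alpha HI.
Let Ls := rd_sref HI.
Notation al := (alpha n).

Lemma q_2 : q ^ (2 : int) = q * q. Proof. by rewrite -expr2. Qed.
Lemma q_N2 : q ^ (- 2 : int) = (q * q)^-1. Proof. by rewrite -expr2 -exprnN. Qed.

Section PreRels.
Variables (A : algType k) (E F : nat -> A) (K : W n -> A).
Hypothesis HP : pre_rels q I inL E F K.

Lemma qg_K0 : K 0 = 1. Proof. by case: HP. Qed.
Lemma qg_KD mu la : inL mu -> inL la -> K mu * K la = K (mu + la).
Proof. by case: HP => _ H _ _ _; apply: H. Qed.
Lemma qg_KE mu i : inL mu -> I i -> K mu * E i = q ^ (ip mu (al i)) *: (E i * K mu).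
Proof. by case: HP => _ _ H _ _; apply: H. Qed.
Lemma qg_KF mu i : inL mu -> I i -> K mu * F i = q ^ (- ip mu (al i)) *: (F i * K mu).
Proof. by case: HP => _ _ _ H _; apply: H. Qed.
Lemma qg_EF i j : I i -> I j ->
  E i * F j - F j * E i = if i == j then (qhat q)^-1 *: (K (al i) - K (- al i)) else 0.
Proof. by case: HP => _ _ _ _; apply. Qed.
Lemma qg_KN mu : inL mu -> K mu * K (- mu) = 1.
Proof. by move=> h; rewrite qg_KD ?LN // subrr qg_K0. Qed.
Lemma qg_NK mu : inL mu -> K (- mu) * K mu = 1.
Proof. by move=> h; rewrite qg_KD ?LN // addNr qg_K0. Qed.
Lemma qg_KC mu la : inL mu -> inL la -> K mu * K la = K la * K mu.
Proof. by move=> h1 h2; rewrite !qg_KD // addrC. Qed.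
Lemma qg_EFii i : I i -> E i * F i = F i * E i + (q - q^-1)^-1 *: (K (al i) - K (- al i)).
Proof. by move=> hi; have := qg_EF hi hi; rewrite eqxx => <-; rewrite addrC subrK. Qed.
Lemma qg_EFij i j : I i -> I j -> i != j -> E i * F j = F j * E i.
Proof. by move=> hi hj ij; apply/eqP; rewrite -subr_eq0 (qg_EF hi hj) (negPf ij). Qed.

Section KPair.
Variables i j : nat.
Hypotheses (hi : I i) (hj : I j).
Lemma qg_KEii : K (al i) * E i = (q * q) *: (E i * K (al i)).
Proof. by rewrite qg_KE ?La // (ip_self n3 HI) // q_2. Qed.
Lemma qg_NEii : K (- al i) * E i = (q * q)^-1 *: (E i * K (- al i)).
Proof. by rewrite qg_KE ?LN ?La // ipNl (ip_self n3 HI) // q_N2. Qed.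
Lemma qg_KFii : K (al i) * F i = (q * q)^-1 *: (F i * K (al i)).
Proof. by rewrite qg_KF ?La // (ip_self n3 HI) // q_N2. Qed.
Lemma qg_NFii : K (- al i) * F i = (q * q) *: (F i * K (- al i)).
Proof. by rewrite qg_KF ?LN ?La // ipNl opprK (ip_self n3 HI) // q_2. Qed.
Hypothesis a : adj n i j.
Lemma qg_KEij : K (al i) * E j = q^-1 *: (E j * K (al i)).
Proof. by rewrite qg_KE ?La // (ip_adj n3 HI). Qed.
Lemma qg_NEij : K (- al i) * E j = q *: (E j * K (- al i)).
Proof. by rewrite qg_KE ?LN ?La // ipNl (ip_adj n3 HI). Qed.
Lemma qg_KFij : K (al i) * F j = q *: (F j * K (al i)).
Proof. by rewrite qg_KF ?La // (ip_adj n3 HI). Qed.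
Lemma qg_NFij : K (- al i) * F j = q^-1 *: (F j * K (- al i)).
Proof. by rewrite qg_KF ?LN ?La // ipNl opprK (ip_adj n3 HI). Qed.
End KPair.

Lemma qg_pair i j : I i -> I j -> adj n i j ->
  pair_rels q (E i) (E j) (F i) (F j) (K (al i)) (K (- al i)) (K (al j)) (K (- al j)).
Proof.
move=> hi hj a; have a' : adj n j i by rewrite adjC.
have ij := adj_neq n3 a; have ji := adj_neq n3 a'.
split; rewrite ?(qg_KN, qg_NK, qg_KEii, qg_NEii, qg_KFii, qg_NFii) ?La //;
  try (by rewrite ?(qg_KEij, qg_NEij, qg_KFij, qg_NFij));
  try (by apply: qg_KC; rewrite ?LN ?La).
- exact: qg_EFii _ hi.
- exact: qg_EFii _ hj.
- by apply: qg_EFij.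
- by apply: qg_EFij.
Qed.

End PreRels.

Section Rels.
Variables (A : algType k) (E F : nat -> A) (K : W n -> A).
Hypothesis HR : qg_rels q I inL E F K.

Lemma qg_Ecomm i j : I i -> I j -> i != j -> ~~ adj n i j -> E i * E j = E j * E i.
Proof.
move=> hi hj ij aij; case: HR => _ [_ [_ [_ [H _]]]]; apply: (proj1 (H i j hi hj _)).
by rewrite ip_alpha ?I_le // (negPf ij) (negPf aij).
Qed.
Lemma qg_Fcomm i j : I i -> I j -> i != j -> ~~ adj n i j -> F i * F j = F j * F i.
Proof.
move=> hi hj ij aij; case: HR => _ [_ [_ [_ [H _]]]]; apply: (proj2 (H i j hi hj _)).
by rewrite ip_alpha ?I_le // (negPf ij) (negPf aij).
Qed.
(** The cubic form is solved for one monomial, so that it can serve as a rewriting rule. *)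
Lemma serre_expand (a b : A) :
  a * qbr q a b = q *: (qbr q a b * a) ->
  a * a * b = (q + q^-1) *: (a * b * a) - b * a * a.
Proof.
move=> H; have : a * qbr q a b - q *: (qbr q a b * a) = 0 by rewrite H subrr.
rewrite /qbr => H0; apply/eqP; rewrite -subr_eq0 -H0; apply/eqP; nc tt.
Qed.
Lemma qg_Eserre i j : I i -> I j -> adj n i j ->
  E i * E i * E j = (q + q^-1) *: (E i * E j * E i) - E j * E i * E i.
Proof.
move=> hi hj a; apply: serre_expand; case: HR => _ [_ [_ [_ [_ [H _]]]]].
by case: (H i j hi hj (ip_adj n3 HI hi hj a)).
Qed.
Lemma qg_Fserre i j : I i -> I j -> adj n i j ->
  F i * F i * F j = (q + q^-1) *: (F i * F j * F i) - F j * F i * F i.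
Proof.
move=> hi hj a; apply: serre_expand; case: HR => _ [_ [_ [_ [_ [H _]]]]].
by case: (H i j hi hj (ip_adj n3 HI hi hj a)).
Qed.

End Rels.

Variables (U : algType k) (E F : nat -> U) (K : W n -> U).
Hypothesis HU : is_QG q I inL E F K.
Let HR : qg_rels q I inL E F K := proj1 HU.

Lemma qg_hom (B : algType k) (E' F' : nat -> B) (K' : W n -> B) :
  qg_rels q I inL E' F' K' ->
  exists f : U -> B, [/\ alg_hom f, forall i, I i -> f (E i) = E' i,
    forall i, I i -> f (F i) = F' i & forall mu, inL mu -> f (K mu) = K' mu].
Proof.
move=> H; case: HU => _ /(_ B E' F' K' H) [[f [hf [h1 h2]]] _].
by exists f; split=> // i /h1 [].
Qed.

Lemma qg_hom_id (f : U -> U) : alg_hom f -> (forall i, I i -> f (E i) = E i) ->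
  (forall i, I i -> f (F i) = F i) -> (forall mu, inL mu -> f (K mu) = K mu) -> f =1 id.
Proof.
move=> hf h1 h2 h3; case: HU => _ /(_ U E F K HR) [_ H].
apply: H => //; first by split=> [i hi|mu hm]; rewrite ?h1 ?h2 ?h3.
Qed.

Lemma chevalley : exists om : U -> U, [/\ alg_hom om, forall i, I i -> om (E i) = F i,
    forall i, I i -> om (F i) = E i & forall mu, inL mu -> om (K mu) = K (- mu)].
Proof.
apply: (@qg_hom _ F E (fun mu => K (- mu))).
case: HR => h0 [h1 [h2 [h3 [h4 [h5 h6]]]]].
split; first by rewrite oppr0.
split; first by move=> mu la hm hl; rewrite h1 ?LN // opprD.
split; first by move=> mu i hm hi; rewrite h3 ?LN // ipNl opprK.
split; first by move=> mu i hm hi; rewrite h2 ?LN // ipNl.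
split; first by move=> i j hi hj /(h4 i j hi hj) [].
split; first by move=> i j hi hj /(h5 i j hi hj) [].
move=> i j hi hj; rewrite opprK -opprB (h6 j i hj hi) eq_sym.
by case: eqP => [->|_]; rewrite ?oppr0 // -scalerN opprB.
Qed.

(* Given an endomorphism [th] with prescribed values on the [E]'s and [K]'s, its
   conjugate by the Chevalley involution supplies images of the [F]'s for which
   the relations among the [F]'s hold; only the mixed relations remain. *)
Lemma qg_extend (om th : U -> U) (s : nat) (c : nat -> k) :
  I s -> alg_hom om -> (forall mu, inL mu -> om (K mu) = K (- mu)) ->
  alg_hom th -> (forall mu, inL mu -> th (K mu) = K (sref s mu)) ->
  (forall j l, I j -> I l ->
     th (E j) * (c l *: om (th (E l))) - (c l *: om (th (E l))) * th (E j) =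
     if j == l then (qhat q)^-1 *: (K (sref s (al j)) - K (sref s (- al j))) else 0) ->
  exists f : U -> U, [/\ alg_hom f, forall j, I j -> f (E j) = th (E j),
    forall j, I j -> f (F j) = c j *: om (th (E j)) &
    forall mu, inL mu -> f (K mu) = K (sref s mu)].
Proof.
move=> hs hom omK hth thK mix.
apply: (@qg_hom _ (fun j => th (E j)) (fun j => c j *: om (th (E j)))).
case: HR => h0 [h1 [h2 [_ [h4 [h5 _]]]]].
have hot : alg_hom (fun x => om (th x)) by apply: alg_hom_comp.
split; first by rewrite -thK // h0 (ah1 hth).
split; first by move=> mu la hm hl; rewrite -!thK ?LD // -(ahM hth) h1.
split.
  by move=> mu j hm hj; rewrite -!thK // -!(ahM hth) h2 // (ahZ hth).
split.
  move=> mu j hm hj.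
  have -> : K (sref s mu) = om (th (K (- mu))).
    by rewrite thK ?LN // srefN omK ?opprK // LN ?Ls.
  by rewrite -scalerAr -scalerAl -!(ahM hot) h2 ?LN // ipNl (ahZ hot) !scalerA mulrC.
split.
  move=> i j hi hj H; have [H1 _] := h4 i j hi hj H.
  rewrite -(ahM hth) H1 (ahM hth); split=> //.
  by rewrite -!scalerAl -!scalerAr -!(ahM hot) H1 !scalerA mulrC.
split; last exact: mix.
move=> i j hi hj H; have [H1 _] := h5 i j hi hj H.
split; first by rewrite -(ah_qbr hth) -(ahM hth) H1 (ahZ hth) (ahM hth).
have -> : qbr q (c i *: om (th (E i))) (c j *: om (th (E j))) =
          (c i * c j) *: om (th (qbr q (E i) (E j))).
  rewrite (ah_qbr hot) /qbr; nc tt.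
by rewrite -!scalerAl -!scalerAr -!(ahM hot) H1 (ahZ hot) !scalerA; congr (_ *: _); ring.
Qed.

Variable T : nat -> U -> U.
Hypothesis HT : lusztig q I inL E F K T.

Section OneT.
Variable i : nat.
Hypothesis hi : I i.

Lemma T_hom : alg_hom (T i). Proof. by case: (HT hi). Qed.
Lemma T_K mu : inL mu -> T i (K mu) = K (sref i mu).
Proof. by move=> h; case: (HT hi) => _ [_ [H _]]; apply: H. Qed.
Lemma T_Ei : T i (E i) = - (F i * K (al i)).
Proof. by case: (HT hi) => _ [_ [_ []]]. Qed.
Lemma T_Fi : T i (F i) = - (K (- al i) * E i).
Proof. by case: (HT hi) => _ [_ [_ [_ []]]]. Qed.
Lemma T_Ej j : I j -> j != i -> T i (E j) = if adj n i j then qbr q (E i) (E j) else E j.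
Proof.
move=> hj ji; case: (HT hi) => _ [_ [_ [_ [_ /(_ j hj ji) [h1 h2]]]]].
case: (boolP (adj n i j)) => a; first by rewrite h2 // (ip_adj n3 HI).
by rewrite h1 // (ip_nadj n3 HI) // eq_sym.
Qed.
Lemma T_Eadj j : I j -> adj n i j -> T i (E j) = qbr q (E i) (E j).
Proof. by move=> hj a; rewrite T_Ej ?a // eq_sym; apply: (adj_neq n3 a). Qed.

(** The bracket in this order is the preimage of E_j under T_i; along a word this is what turns long
    brackets back into single letters. *)
Lemma T_back j : I j -> adj n i j -> T i (qbr q (E j) (E i)) = E j.
Proof.
move=> hj a; rewrite (ah_qbr T_hom) T_Eadj // T_Ei //; apply: (pair_TY q0 q2 (qg_pair HR hi hj a)).
  by apply: (qg_Eserre HR).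
by apply: (qg_Fserre HR).
Qed.

End OneT.

Lemma K_sref_adj i j : I i -> I j -> adj n i j ->
  K (sref i (al j)) = K (al i) * K (al j) /\
  K (sref i (- al j)) = K (- al i) * K (- al j).
Proof.
move=> hi hj a; rewrite srefN /sref ipC (ip_adj n3 HI) // mulrN1z opprK addrC.
by rewrite !(qg_KD HR) ?La ?LN ?La // opprD.
Qed.

Lemma K_sref_nadj i j : I i -> I j -> i != j -> ~~ adj n i j ->
  K (sref i (al j)) = K (al j) /\ K (sref i (- al j)) = K (- al j).
Proof.
by move=> hi hj ij a; rewrite srefN /sref ipC (ip_nadj n3 HI) // mulr0z subr0.
Qed.

(** * Endomorphisms with known values on all generators *)

Section Proper.
Variable i : nat.
Hypothesis hi : I i.

(** Standard values of the inverse of T_i ([SE], [SF]) and of T_i ([TE], [TF]). The formula [TF] for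
    j different from i is not part of [lusztig]; it is realized below by a new endomorphism. *)
Let SE j := if j == i then - (K (- al i) * F i)
  else if adj n i j then qbr q (E j) (E i) else E j.
Let SF j := if j == i then - (E i * K (al i))
  else if adj n i j then F i * F j - q *: (F j * F i) else F j.
Let TE j := if j == i then - (F i * K (al i))
  else if adj n i j then qbr q (E i) (E j) else E j.
Let TF j := if j == i then - (K (- al i) * E i)
  else if adj n i j then F j * F i - q *: (F i * F j) else F j.

Let vi := La hi.

Lemma T_E_TE j : I j -> T i (E j) = TE j.
Proof.
by move=> hj; rewrite /TE; case: eqP => [->|/eqP ji]; [apply: T_Ei|apply: T_Ej].
Qed.

Lemma T_SE j : I j -> T i (SE j) = E j.
Proof.
move=> hj; have th := T_hom hi; rewrite /SE; case: eqP => [->|/eqP ji].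
  rewrite (ahN th) (ahM th) T_K ?LN // T_Fi // srefN sref_alpha ?I_le // opprK.
  by rewrite mulrN opprK mulrA (qg_KN HR) // mul1r.
case: (boolP (adj n i j)) => a; last by rewrite T_Ej // (negPf a).
rewrite (ah_qbr th) T_Eadj // T_Ei //; apply: (pair_TY q0 q2 (qg_pair HR hi hj a)).
- by apply: (qg_Eserre HR).
- by apply: (qg_Fserre HR).
Qed.

(** This is the relation that [qg_extend] does not supply. According to the positions of j and l
    relative to i it is a computation with one, two or three nodes. *)
Lemma mixed_SE j l : I j -> I l -> SE j * SF l - SF l * SE j =
  if j == l then (qhat q)^-1 *: (K (sref i (al j)) - K (sref i (- al j))) else 0.
Proof.
move=> hj hl; rewrite /SE /SF.
have [ji|ji] := eqVneq j i; have [li|li] := eqVneq l i; try subst j; try subst l.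
- rewrite eqxx srefN sref_alpha ?I_le // opprK !mulrNN.
  have -> : K (- al i) * F i * (E i * K (al i)) - E i * K (al i) * (K (- al i) * F i) =
            F i * E i - E i * F i.
    have e1 := qg_KN HR vi; have e2 := qg_NK HR vi.
    have e3 := qg_KEii HR hi; have e4 := qg_KFii HR hi.
    have e5 := qg_NEii HR hi; have e6 := qg_NFii HR hi.
    nc (tt, e1, e2, e3, e4, e5, e6).
  by rewrite -opprB (qg_EF HR) // eqxx -scalerN opprB.
- rewrite eq_sym (negPf li) mulNr mulrN opprK; case: (boolP (adj n i l)) => a.
    rewrite (pair_kfH q0 (qg_pair HR hi hl a)); first by rewrite addNr.
      by apply: (qg_Eserre HR).
    by apply: (qg_Fserre HR).
  have e1 : F i * F l = F l * F i by apply: (qg_Fcomm HR) => //; rewrite eq_sym.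
  have e2 : K (- al i) * F l = F l * K (- al i).
    by rewrite (qg_KF HR) ?LN // ipNl opprK (ip_nadj n3 HI) ?scale1r // eq_sym.
  nc (tt, e1, e2).
- rewrite (negPf ji) mulNr mulrN opprK; case: (boolP (adj n i j)) => a.
    rewrite (pair_Yek q0 (qg_pair HR hi hj a)); first by rewrite addNr.
      by apply: (qg_Eserre HR).
    by apply: (qg_Fserre HR).
  have e1 : E i * E j = E j * E i by apply: (qg_Ecomm HR) => //; rewrite eq_sym.
  have e2 : K (al i) * E j = E j * K (al i).
    by rewrite (qg_KE HR) // (ip_nadj n3 HI) ?scale1r // eq_sym.
  nc (tt, e1, e2).
case: (boolP (adj n i j)) => aj; case: (boolP (adj n i l)) => al'.
- have [jl|jl] := eqVneq j l.
    subst l; have [-> ->] := K_sref_adj hi hj aj.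
    apply: (pair_YH q0 q2 (qg_pair HR hi hj aj)).
      by apply: (qg_Eserre HR).
    by apply: (qg_Fserre HR).
  apply/eqP; rewrite subr_eq0; apply/eqP.
  by apply: (triple_YH q0 q2 (qg_KEij HR hi hj aj) (qg_NEij HR hi hj aj)
    (qg_KFij HR hi hl al') (qg_NFij HR hi hl al') (qg_EFii HR hi));
    apply: (qg_EFij HR); rewrite // eq_sym.
- rewrite (_ : (j == l) = false); last by apply/eqP => jl; rewrite -jl aj in al'.
  have e1 : E j * F l = F l * E j.
    by apply: (qg_EFij HR) => //; apply/eqP => jl; rewrite -jl aj in al'.
  have e2 : E i * F l = F l * E i by apply: (qg_EFij HR) => //; rewrite eq_sym.
  rewrite /qbr; nc (tt, e1, e2).
- rewrite (_ : (j == l) = false); last by apply/eqP => jl; rewrite jl al' in aj.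
  have e1 : E j * F l = F l * E j.
    by apply: (qg_EFij HR) => //; apply/eqP => jl; rewrite jl al' in aj.
  have e2 : E j * F i = F i * E j by apply: (qg_EFij HR).
  nc (tt, e1, e2).
- rewrite (qg_EF HR) //; case: eqP => // _.
  have ij : i != j by rewrite eq_sym.
  by have [-> ->] := K_sref_nadj hi hj ij aj.
Qed.

Lemma mixed_TE j l : I j -> I l -> TE j * TF l - TF l * TE j =
  if j == l then (qhat q)^-1 *: (K (sref i (al j)) - K (sref i (- al j))) else 0.
Proof.
move=> hj hl; rewrite /TE /TF.
have [ji|ji] := eqVneq j i; have [li|li] := eqVneq l i; try subst j; try subst l.
- rewrite eqxx srefN sref_alpha ?I_le // opprK !mulrNN.
  have -> : F i * K (al i) * (K (- al i) * E i) - K (- al i) * E i * (F i * K (al i)) =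
            F i * E i - E i * F i.
    have e1 := qg_KN HR vi; have e2 := qg_NK HR vi.
    have e3 := qg_KEii HR hi; have e4 := qg_KFii HR hi.
    have e5 := qg_NEii HR hi; have e6 := qg_NFii HR hi.
    nc (tt, e1, e2, e3, e4, e5, e6).
  by rewrite -opprB (qg_EF HR) // eqxx -scalerN opprB.
- rewrite eq_sym (negPf li) mulNr mulrN opprK; case: (boolP (adj n i l)) => a.
    rewrite (pair_fkG q0 (qg_pair HR hi hl a)); first by rewrite addNr.
      by apply: (qg_Eserre HR).
    by apply: (qg_Fserre HR).
  have e1 : F i * F l = F l * F i by apply: (qg_Fcomm HR) => //; rewrite eq_sym.
  have e2 : K (al i) * F l = F l * K (al i).
    by rewrite (qg_KF HR) // (ip_nadj n3 HI) ?scale1r // eq_sym.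
  nc (tt, e1, e2).
- rewrite (negPf ji) mulNr mulrN opprK; case: (boolP (adj n i j)) => a.
    rewrite (pair_Xke q0 (qg_pair HR hi hj a)); first by rewrite addNr.
      by apply: (qg_Eserre HR).
    by apply: (qg_Fserre HR).
  have e1 : E i * E j = E j * E i by apply: (qg_Ecomm HR) => //; rewrite eq_sym.
  have e2 : K (- al i) * E j = E j * K (- al i).
    by rewrite (qg_KE HR) ?LN // ipNl (ip_nadj n3 HI) ?scale1r // eq_sym.
  nc (tt, e1, e2).
case: (boolP (adj n i j)) => aj; case: (boolP (adj n i l)) => al'.
- have [jl|jl] := eqVneq j l.
    subst l; have [-> ->] := K_sref_adj hi hj aj.
    apply: (pair_XG q0 q2 (qg_pair HR hi hj aj)).
      by apply: (qg_Eserre HR).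
    by apply: (qg_Fserre HR).
  apply/eqP; rewrite subr_eq0; apply/eqP.
  by apply: (triple_XG q0 q2 (qg_KEij HR hi hj aj) (qg_NEij HR hi hj aj)
    (qg_KFij HR hi hl al') (qg_NFij HR hi hl al') (qg_EFii HR hi));
    apply: (qg_EFij HR); rewrite // eq_sym.
- rewrite (_ : (j == l) = false); last by apply/eqP => jl; rewrite -jl aj in al'.
  have e1 : E j * F l = F l * E j.
    by apply: (qg_EFij HR) => //; apply/eqP => jl; rewrite -jl aj in al'.
  have e2 : E i * F l = F l * E i by apply: (qg_EFij HR) => //; rewrite eq_sym.
  rewrite /qbr; nc (tt, e1, e2).
- rewrite (_ : (j == l) = false); last by apply/eqP => jl; rewrite jl al' in aj.
  have e1 : E j * F l = F l * E j.
    by apply: (qg_EFij HR) => //; apply/eqP => jl; rewrite jl al' in aj.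
  have e2 : E j * F i = F i * E j by apply: (qg_EFij HR).
  nc (tt, e1, e2).
- rewrite (qg_EF HR) //; case: eqP => // _.
  have ij : i != j by rewrite eq_sym.
  by have [-> ->] := K_sref_nadj hi hj ij aj.
Qed.

(** Correction factors between the Chevalley image of the value at E_j and the standard value at
    F_j: (q * q)^-1 comes from moving K past E_i, and - q from reversing a q^-1-commutator into a
    q-commutator. They are the same for T_i and for its inverse. *)
Let c j : k := if j == i then (q * q)^-1 else if adj n i j then - q else 1.

(** The actual inverse of [T i] serves as [th] in [qg_extend]: by [T_SE] its values on the E's are
    known, so their relations hold for free, and its unknown values on the F's are replaced. *)
Lemma proper_S : exists S : U -> U, [/\ alg_hom S, forall j, I j -> S (E j) = SE j,
    forall j, I j -> S (F j) = SF j & forall mu, inL mu -> S (K mu) = K (sref i mu)].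
Proof.
have [om [hom omE omF omK]] := chevalley.
have [_ [[T' TK T'K] _]] := HT hi.
have hT' : alg_hom T' by apply: alg_hom_inv (T_hom hi) TK T'K.
have T'E j : I j -> T' (E j) = SE j by move=> hj; rewrite -(T_SE hj) TK.
have T'm mu : inL mu -> T' (K mu) = K (sref i mu).
  by move=> hm; rewrite -{1}[mu](srefK n3 _ (I_le hi)) -T_K ?Ls // TK.
have oSE j : I j -> c j *: om (SE j) = SF j.
  move=> hj; rewrite /c /SE /SF; case: eqP => [_|/eqP ji].
    rewrite (ahN hom) (ahM hom) omK ?LN // omF // opprK (qg_KEii HR) //.
    by rewrite scalerN scalerA mulVf ?scale1r ?mulf_neq0.
  case: ifP => a; last by rewrite scale1r omE.
  by rewrite (ah_qbr hom) !omE // /qbr; nc tt.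
case: (@qg_extend om T' i c hi hom omK hT' T'm).
  by move=> j l hj hl; rewrite !T'E // oSE //; apply: mixed_SE.
move=> S [hS SE' SF' SK].
by exists S; split=> // j hj; rewrite ?SE' ?SF' ?T'E // oSE.
Qed.

Lemma proper_T : exists T' : U -> U, [/\ alg_hom T', forall j, I j -> T' (E j) = TE j,
    forall j, I j -> T' (F j) = TF j & forall mu, inL mu -> T' (K mu) = K (sref i mu)].
Proof.
have [om [hom omE omF omK]] := chevalley.
have oTE j : I j -> c j *: om (TE j) = TF j.
  move=> hj; rewrite /c /TE /TF; case: eqP => [_|/eqP ji].
    rewrite (ahN hom) (ahM hom) omK // omF // (qg_NEii HR) //.
    by rewrite scalerN.
  case: ifP => a; last by rewrite scale1r omE.
  by rewrite (ah_qbr hom) !omE // /qbr; nc tt.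
have TTE j : I j -> T i (E j) = TE j by apply: T_E_TE.
case: (@qg_extend om (T i) i c hi hom omK (T_hom hi) (fun mu => T_K hi (mu := mu))).
  by move=> j l hj hl; rewrite !TTE // oTE //; apply: mixed_TE.
move=> T' [hT' TE' TF' TK].
by exists T'; split=> // j hj; rewrite ?TE' ?TF' ?TTE // oTE.
Qed.

End Proper.

(** [S] undoes [T i] on the E's, and [T'] witnesses that [S] is injective. No relation between [S]
    and the values of [T i] at F_j, for j different from i, is asserted. *)
Definition is_proper_inverse (i : nat) (T' S : U -> U) : Prop :=
  [/\ alg_hom T', alg_hom S, cancel S T',
      forall j, I j -> S (T i (E j)) = E j &
      [/\ S (E i) = - (K (- al i) * F i),
          S (F i) = - (E i * K (al i)),
          forall j, I j -> j != i -> S (E j) = if adj n i j then qbr q (E j) (E i) else E j,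
          forall j, I j -> j != i ->
            S (F j) = if adj n i j then F i * F j - q *: (F j * F i) else F j &
          forall mu, inL mu -> S (K mu) = K (sref i mu)]].

Lemma proper_inverse i : I i -> exists p : (U -> U) * (U -> U), is_proper_inverse i p.1 p.2.
Proof.
move=> hi; have [S [hS SE SF SK]] := proper_S hi; have [T' [hT' TE TF TK]] := proper_T hi.
have adjF := adj_irr n3 i.
have vi := La hi; have ri := I_le hi.
exists (T', S); split=> //=.
- move: SE SF TE TF => SE SF TE TF.
  apply: (@qg_hom_id (fun x => T' (S x))); first exact: alg_hom_comp.
  + move=> j hj; rewrite SE //; case: eqP => [->|/eqP ji].
      rewrite (ahN hT') (ahM hT') TK ?LN // TF // eqxx srefN sref_alpha // opprK.
      by rewrite mulrN opprK mulrA (qg_KN HR) // mul1r.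
    case: (boolP (adj n i j)) => a; last by rewrite TE // (negPf ji) (negPf a).
    rewrite (ah_qbr hT') !TE // eqxx (negPf ji) a.
    apply: (pair_TY q0 q2 (qg_pair HR hi hj a)).
      by apply: (qg_Eserre HR).
    by apply: (qg_Fserre HR).
  + move=> j hj; rewrite SF //; case: eqP => [->|/eqP ji].
      rewrite (ahN hT') (ahM hT') TK // TE // eqxx sref_alpha //.
      by rewrite mulNr opprK -mulrA (qg_KN HR) // mulr1.
    case: (boolP (adj n i j)) => a; last by rewrite TF // (negPf ji) (negPf a).
    rewrite (ahB hT') (ahZ hT') !(ahM hT') !TF // eqxx (negPf ji) a.
    apply: (pair_TH q0 q2 (qg_pair HR hi hj a)).
      by apply: (qg_Eserre HR).
    by apply: (qg_Fserre HR).
  + by move=> mu hm; rewrite SK // TK ?Ls // srefK.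
- move=> j hj; rewrite T_E_TE //; case: eqP => [->|/eqP ji].
    rewrite (ahN hS) (ahM hS) SK // SF // eqxx sref_alpha //.
    by rewrite mulNr opprK -mulrA (qg_KN HR) // mulr1.
  case: (boolP (adj n i j)) => a; last by rewrite SE // (negPf ji) (negPf a).
  rewrite (ah_qbr hS) !SE // eqxx (negPf ji) a.
  apply: (pair_SX q0 q2 (qg_pair HR hi hj a)).
    by apply: (qg_Eserre HR).
  by apply: (qg_Fserre HR).
- split=> //; first by rewrite SE // eqxx.
  + by rewrite SF // eqxx.
  + by move=> j hj ji; rewrite SE // (negPf ji).
  + by move=> j hj ji; rewrite SF // (negPf ji).
Qed.

End QG.

(** * The algebra of linear endomorphisms *)
Section Endo.
Variables (k : fieldType) (V : lmodType k).

Definition lin_map (f : V -> V) : Prop :=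
  (forall x y, f (x + y) = f x + f y) /\ (forall (c : k) x, f (c *: x) = c *: f x).

Definition lin_mapb : {pred (V -> V)} := fun f => `[< lin_map f >].

Lemma lin_mapP f : reflect (lin_map f) (f \in lin_mapb).
Proof. exact: asboolP. Qed.

Lemma lin_map_submod : submod_closed lin_mapb.
Proof.
split.
  apply/lin_mapP; split=> [x y|c x]; first by rewrite addr0.
  by rewrite scaler0.
move=> a f g /lin_mapP[fD fZ] /lin_mapP[gD gZ]; apply/lin_mapP; split=> [x y|c x].
  by rewrite !fctE fD gD scalerDr addrACA.
by rewrite !fctE fZ gZ scalerDr !scalerA mulrC.
Qed.

HB.instance Definition _ := GRing.isSubmodClosed.Build _ _ lin_mapb lin_map_submod.

(* The proof that [V] is nonzero is a parameter because an [algType] is a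
   nonzero ring. *)
Record endo (v : V) (v0 : v != 0) := Endo { efun :> V -> V; _ : efun \in lin_mapb }.

Variables (v : V) (v0 : v != 0).

HB.instance Definition _ := [isSub of endo v0 for @efun v v0].
HB.instance Definition _ := [Choice of endo v0 by <:].
HB.instance Definition _ := [SubChoice_isSubLmodule of endo v0 by <:].

Implicit Types f g : endo v0.

Lemma endoP f g : f =1 g -> f = g.
Proof. by move=> fg; apply/val_inj/funext. Qed.

Lemma endo_lin f : lin_map f.
Proof. by apply/lin_mapP; case: f. Qed.

Lemma id_lin : (id : V -> V) \in lin_mapb.
Proof. exact/lin_mapP. Qed.

Lemma comp_lin f g : (fun x => f (g x)) \in lin_mapb.
Proof.
have [fD fZ] := endo_lin f; have [gD gZ] := endo_lin g.
by apply/lin_mapP; split=> [x y|c x]; rewrite ?gD ?fD ?gZ ?fZ.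
Qed.

Definition endo1 : endo v0 := Endo v0 id_lin.
Definition endoM f g : endo v0 := Endo v0 (comp_lin f g).

Lemma endoMA : associative endoM.
Proof. by move=> f g h; apply: endoP. Qed.
Lemma endo1l : left_id endo1 endoM.
Proof. by move=> f; apply: endoP. Qed.
Lemma endo1r : right_id endo1 endoM.
Proof. by move=> f; apply: endoP. Qed.
Lemma endoDl : left_distributive endoM +%R.
Proof. by move=> f g h; apply: endoP. Qed.
Lemma endoDr : right_distributive endoM +%R.
Proof.
move=> f g h; apply: endoP => x; have [fD _] := endo_lin f.
exact: fD.
Qed.
Lemma endo1_neq0 : endo1 != 0.
Proof.
apply: contraNneq v0 => H; apply/eqP.
by have := congr1 (fun f : endo v0 => f v) H.
Qed.

HB.instance Definition _ := GRing.Zmodule_isNzRing.Build (endo v0)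
  endoMA endo1l endo1r endoDl endoDr endo1_neq0.

Lemma endo_scaleAl (c : k) f g : c *: (f * g) = (c *: f) * g.
Proof. exact: endoP. Qed.
HB.instance Definition _ := GRing.Lmodule_isLalgebra.Build k (endo v0) endo_scaleAl.

Lemma endo_scaleAr (c : k) f g : c *: (f * g) = f * (c *: g).
Proof. by apply: endoP => x; have [_ fZ] := endo_lin f; symmetry; apply: fZ. Qed.
HB.instance Definition _ := GRing.Lalgebra_isAlgebra.Build k (endo v0) endo_scaleAr.

Lemma endo_addE f g x : (f + g) x = f x + g x. Proof. by []. Qed.
Lemma endo_oppE f x : (- f) x = - f x. Proof. by []. Qed.
Lemma endo_zeroE x : (0 : endo v0) x = 0. Proof. by []. Qed.
Lemma endo_scaleE (c : k) f x : (c *: f) x = c *: f x. Proof. by []. Qed.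
Lemma endo_mulE f g x : (f * g) x = f (g x). Proof. by []. Qed.
Lemma endo_oneE x : (1 : endo v0) x = x. Proof. by []. Qed.
Definition endoE := (endo_addE, endo_oppE, endo_zeroE, endo_scaleE, endo_mulE, endo_oneE).

End Endo.

(** * Triangular decomposition *)
Section Verma.
Variables (k : fieldType) (q : k) (n : nat) (I : nat -> bool) (inL : W n -> bool).
Hypotheses (q0 : q != 0) (q2 : q * q - 1 != 0) (n3 : (3 <= n)%N).
Hypothesis HI : root_datum I inL.
Let LN := rd_N HI.
Let La := rd_alpha HI.
Notation al := (alpha n).
Variable (R : lmodType k) (r1 : R) (r1n0 : r1 != 0).

(* [f u mu w] is the value of a functional at [F_u K_mu E_w], both words being
   read from right to left; the operators are those dual to right multiplication. *)
Definition tri_fun := seq nat -> W n -> seq nat -> R.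
HB.instance Definition _ := GRing.Lmodule.copy tri_fun (seq nat -> W n -> seq nat -> R).
Implicit Types (f g : tri_fun) (u w : seq nat) (mu nu : W n).

Lemma tri_addE f g u mu w : (f + g) u mu w = f u mu w + g u mu w. Proof. by []. Qed.
Lemma tri_oppE f u mu w : (- f) u mu w = - f u mu w. Proof. by []. Qed.
Lemma tri_zeroE u mu w : (0 : tri_fun) u mu w = 0. Proof. by []. Qed.
Lemma tri_scaleE (c : k) f u mu w : (c *: f) u mu w = c *: f u mu w. Proof. by []. Qed.
Definition triE := (tri_addE, tri_oppE, tri_zeroE, tri_scaleE).

Definition wt w : W n := foldr (fun i x => al i + x) 0 w.

(* Casts of the scalars to [k], so that the scalar actions below all use the same
   instance. *)
Definition hinv : k := (qhat q)^-1.
Definition qz (z : int) : k := q ^ z.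

Lemma qzD x y : qz (x + y) = qz x * qz y. Proof. exact: expfzDr. Qed.
Lemma qz0 : qz 0 = 1. Proof. exact: expr0z. Qed.

Definition Eop (i : nat) f : tri_fun := fun u mu w => f u mu (i :: w).
Definition Kop nu f : tri_fun := fun u mu w => qz (- ip nu (wt w)) *: f u (mu + nu) w.
Definition Hop (i : nat) f : tri_fun :=
  fun u mu w => hinv *: (Kop (al i) f u mu w - Kop (- al i) f u mu w).
(** Straightens F_u K_mu E_w F_i: F_i passes the letters of E_w one by one, leaving a Cartan term at
    each letter i, and finally passes K_mu at the cost of a power of q. *)
Fixpoint Fop_ (i : nat) f u mu w : R :=
  match w with
  | [::] => qz (- ip mu (al i)) *: f (i :: u) mu [::]
  | j :: w' => Fop_ i (Eop j f) u mu w' + (if j == i then Hop i f u mu w' else 0)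
  end.
Definition Fop i f : tri_fun := Fop_ i f.

Lemma wt_cat w w' : wt (w ++ w') = wt w + wt w'.
Proof. by elim: w => [|i w IH] /=; rewrite ?add0r // IH addrA. Qed.

Lemma tri_ext f g : (forall u mu w, f u mu w = g u mu w) -> f = g.
Proof. by move=> H; do 3!apply: funext => ?. Qed.

Lemma Eop_lin i : lin_map (Eop i). Proof. by []. Qed.

Lemma Kop_lin nu : lin_map (Kop nu).
Proof.
split=> [f g|c f]; apply: tri_ext => u mu w; rewrite /Kop ?triE.
  exact: scalerDr.
by rewrite !scalerA mulrC.
Qed.

Lemma KopD nu f g : Kop nu (f + g) = Kop nu f + Kop nu g.
Proof. exact: (proj1 (Kop_lin nu)). Qed.
Lemma KopZ nu c f : Kop nu (c *: f) = c *: Kop nu f.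
Proof. exact: (proj2 (Kop_lin nu)). Qed.
Lemma KopN nu f : Kop nu (- f) = - Kop nu f.
Proof. by rewrite -scaleN1r KopZ scaleN1r. Qed.

Lemma HopD i f g u mu w : Hop i (f + g) u mu w = Hop i f u mu w + Hop i g u mu w.
Proof. by rewrite /Hop /Kop ?triE !scalerDr opprD addrACA scalerDr. Qed.

Lemma HopZ i c f u mu w : Hop i (c *: f) u mu w = c *: Hop i f u mu w.
Proof.
by rewrite /Hop !KopZ ?triE -scalerBr !scalerA mulrC.
Qed.

Lemma Fop_lin i : lin_map (Fop i).
Proof.
split=> [f g|c f]; apply: tri_ext => u mu w; rewrite /Fop ?triE.
  elim: w f g u mu => [|j w IH] f g u mu /=; first exact: scalerDr.
  have -> : Eop j (f + g) = Eop j f + Eop j g by [].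
  rewrite IH; case: eqP => _; last by rewrite !addr0.
  by rewrite HopD addrACA.
elim: w f u mu => [|j w IH] f u mu /=; first by rewrite !scalerA mulrC.
have -> : Eop j (c *: f) = c *: Eop j f by [].
rewrite IH; case: eqP => _; last by rewrite !addr0.
by rewrite HopZ scalerDr.
Qed.

Lemma FopZ i c f : Fop i (c *: f) = c *: Fop i f.
Proof. exact: (proj2 (Fop_lin i)). Qed.
Lemma Fop0 i : Fop i 0 = 0.
Proof. by rewrite -(scale0r 0) FopZ !scale0r. Qed.

Lemma Kop_Eop nu i f : Kop nu (Eop i f) = qz (ip nu (al i)) *: Eop i (Kop nu f).
Proof.
apply: tri_ext => u mu w; rewrite /Kop /Eop ?triE scalerA -qzD.
by congr (qz _ *: _); rewrite /= ipDr; ring.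
Qed.

Lemma Eop_Kop nu i f : Eop i (Kop nu f) = qz (- ip nu (al i)) *: Kop nu (Eop i f).
Proof. by rewrite Kop_Eop scalerA -qzD addNr qz0 scale1r. Qed.

Lemma Kop_Kop nu nu' f : Kop nu (Kop nu' f) = Kop (nu + nu') f.
Proof.
apply: tri_ext => u mu w; rewrite /Kop scalerA -qzD ipDl opprD.
by rewrite -addrA.
Qed.

Lemma Kop0 f : Kop 0 f = f.
Proof. by apply: tri_ext => u mu w; rewrite /Kop ip0l oppr0 qz0 scale1r addr0. Qed.

Lemma Hop_E i f : Hop i f = hinv *: (Kop (al i) f - Kop (- al i) f).
Proof. by []. Qed.

Lemma Hop_Kop i nu f : Hop i (Kop nu f) = Kop nu (Hop i f).
Proof.
by rewrite !Hop_E KopZ KopD KopN !Kop_Kop !(addrC nu).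
Qed.

Lemma Kop_Fop nu i f : Kop nu (Fop i f) = qz (- ip nu (al i)) *: Fop i (Kop nu f).
Proof.
apply: tri_ext => u mu w; rewrite ?triE.
elim: w f u mu => [|j w IH] f u mu.
  rewrite /Kop /Fop /= !scalerA -!qzD.
  by congr (qz _ *: _); rewrite ip0r ipDl; ring.
transitivity (Eop j (Kop nu (Fop i f)) u mu w); first by [].
have Ej g : Eop j (Fop i g) = Fop i (Eop j g) + (if j == i then Hop i g else 0).
  by apply: tri_ext => u' mu' w'; rewrite /Eop /Fop fctE /=; case: eqP.
rewrite Eop_Kop Ej; have -> : Fop i (Kop nu f) u mu (j :: w) = Eop j (Fop i (Kop nu f)) u mu w by [].
rewrite Ej Eop_Kop FopZ KopD ?triE !scalerDr IH; congr (_ + _).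
  by rewrite !scalerA mulrC.
case: eqP => [->|_]; first by rewrite Hop_Kop.
by rewrite -(scale0r (0 : tri_fun)) KopZ scale0r !scaler0.
Qed.

Lemma Eop_Fop i j f : Eop i (Fop j f) - Fop j (Eop i f) = if i == j then Hop j f else 0.
Proof.
apply: tri_ext => u mu w; rewrite ?triE /Eop /Fop /= addrC addKr.
by case: eqP.
Qed.

Let one_fun : tri_fun := fun u _ w => if nilp u && nilp w then r1 else 0.
Lemma one_fun_neq0 : one_fun != 0.
Proof.
apply: contraNneq r1n0 => /(congr1 (fun f : tri_fun => f [::] 0 [::])).
by rewrite /one_fun /= => ->.
Qed.

(** As words are read from right to left, [[:: j; i; i]] stands for the monomial e_i e_i e_j. *)
Definition serre (i j : nat) (V : lmodType k) (g : seq nat -> V) : V :=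
  if adj n i j then g [:: j; i; i] - (q + q^-1) *: g [:: i; j; i] + g [:: i; i; j]
  else g [:: j; i] - g [:: i; j].

(** Vanishing on the two-sided ideals of q-Serre elements, in the E-words and in the F-words
    separately. *)
Definition serre_fun f : Prop :=
  forall i j, I i -> I j -> i != j ->
    (forall u mu w w', serre i j (fun s => f u mu (w ++ s ++ w')) = 0) /\
    (forall u u' mu w, serre i j (fun s => f (u ++ s ++ u') mu w) = 0).

Lemma serre0 i j (V : lmodType k) : serre i j (fun _ => 0 : V) = 0.
Proof. by rewrite /serre; case: ifP => _; rewrite ?scaler0 !subr0 ?addr0. Qed.

Lemma serreD i j (V : lmodType k) (g h : seq nat -> V) :
  serre i j (fun s => g s + h s) = serre i j g + serre i j h.
Proof.
rewrite /serre; case: ifP => _; last by rewrite opprD addrACA.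
by rewrite scalerDr opprD [X in X + _ = _]addrACA [LHS]addrACA.
Qed.

Lemma serreZ i j (V : lmodType k) c (g : seq nat -> V) :
  serre i j (fun s => c *: g s) = c *: serre i j g.
Proof.
rewrite /serre; case: ifP => _; last by rewrite scalerBr.
by rewrite scalerDr scalerBr !scalerA (mulrC c).
Qed.

(* All words of a Serre relation have the same weight. *)
Lemma serre_wt i j (V : lmodType k) (c : W n -> k) (g : seq nat -> V) :
  exists c0, serre i j (fun s => c (wt s) *: g s) = c0 *: serre i j g.
Proof.
rewrite /serre; case: ifP => _.
  exists (c (wt [:: j; i; i])); rewrite (_ : wt [:: i; j; i] = wt [:: j; i; i]).
    rewrite (_ : wt [:: i; i; j] = wt [:: j; i; i]).
      by rewrite scalerDr scalerBr !scalerA (mulrC (_ + _)).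
    by rewrite /= !addr0 [RHS]addrC addrA.
  by rewrite /= addrCA.
exists (c (wt [:: j; i])); rewrite (_ : wt [:: i; j] = wt [:: j; i]) ?scalerBr //.
by rewrite /= !addr0 addrC.
Qed.

Definition serre_pred : {pred tri_fun} := fun f => `[< serre_fun f >].

Lemma serre_predP f : reflect (serre_fun f) (f \in serre_pred).
Proof. exact: asboolP. Qed.

Lemma serre_pred_submod : submod_closed serre_pred.
Proof.
split; first by apply/serre_predP => i j hi hj ij; split=> *; exact: serre0.
move=> a f g /serre_predP hf /serre_predP hg; apply/serre_predP => i j hi hj ij.
have [f1 f2] := hf i j hi hj ij; have [g1 g2] := hg i j hi hj ij.
split=> [u mu w w'|u u' mu w].
  by rewrite (serreD i j (fun s => a *: f u mu _)) serreZ f1 g1 scaler0 addr0.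
by rewrite (serreD i j (fun s => a *: f _ mu w)) serreZ f2 g2 scaler0 addr0.
Qed.

HB.instance Definition _ := GRing.isSubmodClosed.Build _ _ serre_pred serre_pred_submod.

Lemma one_fun_serre : one_fun \in serre_pred.
Proof.
apply/serre_predP => i j hi hj ij; split=> *;
  rewrite /serre /one_fun /nilp !size_cat /= !addnS ?andbF /=;
  by case: ifP; rewrite ?scaler0 !subr0 ?addr0.
Qed.

Lemma Eop_serre i f : f \in serre_pred -> Eop i f \in serre_pred.
Proof.
move/serre_predP => hf; apply/serre_predP => a b ha hb ab.
by have [f1 f2] := hf a b ha hb ab; split=> *; [apply: (f1 _ _ (i :: _))|apply: f2].
Qed.

Lemma Kop_serre nu f : f \in serre_pred -> Kop nu f \in serre_pred.
Proof.
move/serre_predP => hf; apply/serre_predP => a b ha hb ab.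
have [f1 f2] := hf a b ha hb ab; split=> [u mu w w'|u u' mu w]; last first.
  by rewrite /Kop serreZ f2 scaler0.
rewrite /Kop; have [c0] := serre_wt a b
  (fun x => qz (- ip nu (wt w + (x + wt w')))) (fun s => f u (mu + nu) (w ++ s ++ w')).
rewrite f1 scaler0 => <-; congr (serre _ _ _); apply: funext => s.
by rewrite !wt_cat.
Qed.

Lemma Hop_serre i f : f \in serre_pred -> Hop i f \in serre_pred.
Proof.
move=> hf; rewrite Hop_E; apply: rpredZ; apply: rpredB; exact: Kop_serre.
Qed.

(* On the whole space of functionals the q-Serre relations may fail. *)
Let op (P : tri_fun -> tri_fun) (h : lin_map P) : endo one_fun_neq0 :=
  Endo one_fun_neq0 (introT (lin_mapP P) h).
Let eo i := op (Eop_lin i).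
Let fo i := op (Fop_lin i).
Let ko nu := op (Kop_lin nu).

Lemma ops_pre : pre_rels q I inL eo fo ko.
Proof.
split.
- by apply: endoP => f; exact: Kop0.
- by move=> mu la _ _; apply: endoP => f; exact: Kop_Kop.
- by move=> mu i _ _; apply: endoP => f; exact: Kop_Eop.
- by move=> mu i _ _; apply: endoP => f; exact: Kop_Fop.
- move=> i j _ _; apply: endoP => f.
  rewrite (_ : (eo i * fo j - fo j * eo i) f = Eop i (Fop j f) - Fop j (Eop i f)) //.
  by rewrite Eop_Fop; case: eqP => [->|].
Qed.

Let EFcomm i j : i != j -> eo i * fo j = fo j * eo i.
Proof.
move=> ij; apply: endoP => f; apply/eqP; rewrite -subr_eq0.
by rewrite (Eop_Fop i j f) (negPf ij).
Qed.

Let serreo i j (x : nat -> endo one_fun_neq0) : endo one_fun_neq0 :=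
  if adj n i j then x i * x i * x j - (q + q^-1) *: (x i * x j * x i) + x j * x i * x i
  else x i * x j - x j * x i.

(** For adjacent nodes this is the rank two computation. For nonadjacent ones the Cartan term
    produced at one node commutes with the generator of the other. *)
Lemma serreo_EF i j a : I i -> I j -> i != j -> I a ->
  serreo i j eo * fo a = fo a * serreo i j eo.
Proof.
move=> hi hj ij ha; rewrite /serreo.
have := ops_pre; move: eo fo ko EFcomm => e f kk com HP.
case: ifP => [aij|/negbT nij].
  have [->|ai] := eqVneq a i.
    exact: (pair_serre_Ei q0 q2 (qg_pair n3 HI HP hi hj aij)).
  have [->|aj] := eqVneq a j.
    exact: (pair_serre_Ej q0 q2 (qg_pair n3 HI HP hi hj aij)).
  have e1 : e i * f a = f a * e i by apply: com; rewrite eq_sym.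
  have e2 : e j * f a = f a * e j by apply: com; rewrite eq_sym.
  nc (tt, e1, e2).
have cK c d : I c -> I d -> c != d -> ~~ adj n c d ->
    (kk (al c) * e d = e d * kk (al c)) * (kk (- al c) * e d = e d * kk (- al c)).
  move=> hc hd cd acd; rewrite !(qg_KE HP) ?LN ?La //.
  by rewrite ipNl (ip_nadj n3 HI) // oppr0 !expr0z !scale1r.
have [->|ai] := eqVneq a i.
  have e1 := qg_EFii HP hi; have e2 : e j * f i = f i * e j by apply: com; rewrite eq_sym.
  have [e3 e4] := cK i j hi hj ij nij.
  nc (tt, e1, e2, e3, e4).
have [->|aj] := eqVneq a j.
  have e1 := qg_EFii HP hj; have e2 : e i * f j = f j * e i by apply: com.
  have ji : j != i by rewrite eq_sym.
  have [e3 e4] : (kk (al j) * e i = e i * kk (al j)) * (kk (- al j) * e i = e i * kk (- al j)).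
    by apply: cK => //; rewrite adjC.
  nc (tt, e1, e2, e3, e4).
have e1 : e i * f a = f a * e i by apply: com; rewrite eq_sym.
have e2 : e j * f a = f a * e j by apply: com; rewrite eq_sym.
nc (tt, e1, e2).
Qed.

Lemma serreo_FE i j a : I i -> I j -> i != j -> eo a * serreo i j fo = serreo i j fo * eo a.
Proof.
move=> hi hj ij; rewrite /serreo.
have := ops_pre; move: eo fo ko EFcomm => e f kk com HP.
case: ifP => [aij|/negbT nij].
  have [->|ai] := eqVneq a i.
    exact: (pair_serre_Fi q0 q2 (qg_pair n3 HI HP hi hj aij)).
  have [->|aj] := eqVneq a j.
    exact: (pair_serre_Fj q0 q2 (qg_pair n3 HI HP hi hj aij)).
  have e1 := com a i ai; have e2 := com a j aj.
  nc (tt, e1, e2).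
have cK c d : I c -> I d -> c != d -> ~~ adj n c d ->
    (kk (al c) * f d = f d * kk (al c)) * (kk (- al c) * f d = f d * kk (- al c)).
  move=> hc hd cd acd; rewrite !(qg_KF HP) ?LN ?La //.
  by rewrite ipNl (ip_nadj n3 HI) // oppr0 !expr0z !scale1r.
have [->|ai] := eqVneq a i.
  have e1 := qg_EFii HP hi; have e2 := com i j ij.
  have [e3 e4] := cK i j hi hj ij nij.
  nc (tt, e1, e2, e3, e4).
have [->|aj] := eqVneq a j.
  have ji : j != i by rewrite eq_sym.
  have e1 := qg_EFii HP hj; have e2 := com j i ji.
  have [e3 e4] : (kk (al j) * f i = f i * kk (al j)) * (kk (- al j) * f i = f i * kk (- al j)).
    by apply: cK => //; rewrite adjC.
  nc (tt, e1, e2, e3, e4).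
have e1 := com a i ai; have e2 := com a j aj.
nc (tt, e1, e2).
Qed.

Lemma serreo_E i j f u mu w : serreo i j eo f u mu w = serre i j (fun s => f u mu (s ++ w)).
Proof. by rewrite /serreo /serre; case: ifP. Qed.

Lemma serreo_E0 i j f : I i -> I j -> i != j -> f \in serre_pred -> serreo i j eo f = 0.
Proof.
move=> hi hj ij /serre_predP hf; apply: tri_ext => u mu w; rewrite serreo_E.
by have [f1 _] := hf i j hi hj ij; apply: (f1 u mu [::] w).
Qed.

(** Induction on the E-word: its first letter is an operator [eo a], which commutes with the Serre
    element in the F's. On the empty word the F's merely prepend letters with powers of q, and the
    condition on F-words applies. *)
Lemma serreo_F0 i j f : I i -> I j -> i != j -> f \in serre_pred -> serreo i j fo f = 0.
Proof.
move=> hi hj ij hf; apply: tri_ext => u mu w.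
elim: w f hf u mu => [|a w IH] f hf u mu.
  have [_ f2] := elimT (serre_predP f) hf i j hi hj ij.
  have [c ->] : exists c, serreo i j fo f u mu [::] = c *: serre i j (fun s => f (s ++ u) mu [::]).
    rewrite /serreo /serre; case: ifP => _.
      exists (qz (- ip mu (al i)) * (qz (- ip mu (al i)) * qz (- ip mu (al j)))).
      rewrite !endoE !triE /fo /Fop /= !scalerDr !scalerN !scalerA.
      by congr (_ *: _ - _ *: _ + _ *: _); ring.
    exists (qz (- ip mu (al i)) * qz (- ip mu (al j))).
    rewrite !endoE !triE /fo /Fop /= scalerBr !scalerA.
    by congr (_ *: _ - _ *: _); ring.
  by rewrite (f2 [::] u) scaler0.
have E1 : (eo a * serreo i j fo) f = (serreo i j fo * eo a) f by rewrite serreo_FE.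
have E2 := congr1 (fun g : tri_fun => g u mu w) E1.
by rewrite -[LHS]/((eo a * serreo i j fo) f u mu w) E2; apply: IH; exact: Eop_serre.
Qed.

(** The recursion of [Fop_] peels off the letters in front of a Serre block in the E-word; the block
    then passes [fo a] by [serreo_EF]. For blocks in the F-word the whole E-word is peeled off. *)
Lemma Fop_serre a f : I a -> f \in serre_pred -> Fop a f \in serre_pred.
Proof.
move=> ha hf; apply/serre_predP => i j hi hj ij; split=> [u mu w w'|u u' mu w].
  elim: w f hf u mu => [|b w IH] f hf u mu /=.
    rewrite -(serreo_E i j (Fop a f)) -[serreo i j eo _]/((serreo i j eo * fo a) f).
    by rewrite serreo_EF // endoE serreo_E0 // [fo a 0]Fop0.
  rewrite (serreD i j (fun s => Fop_ a (Eop b f) u mu (w ++ s ++ w'))).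
  rewrite (IH (Eop b f) (Eop_serre b hf)) add0r; case: eqP => _; last exact: serre0.
  by have [h _] := elimT (serre_predP _) (Hop_serre a hf) i j hi hj ij; apply: h.
elim: w f hf mu => [|b w IH] f hf mu.
  rewrite /Fop /= serreZ; have [_ h] := elimT (serre_predP _) hf i j hi hj ij.
  by rewrite (h (a :: u) u') scaler0.
rewrite /Fop /= (serreD i j (fun s => Fop_ a (Eop b f) (u ++ s ++ u') mu w)).
rewrite (IH (Eop b f) (Eop_serre b hf)) add0r; case: eqP => _; last exact: serre0.
by have [_ h] := elimT (serre_predP _) (Hop_serre a hf) i j hi hj ij; apply: h.
Qed.

Record serre_mod := SerreMod { smod_val :> tri_fun; _ : smod_val \in serre_pred }.
HB.instance Definition _ := [isSub for smod_val].
HB.instance Definition _ := [Choice of serre_mod by <:].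
HB.instance Definition _ := [SubChoice_isSubLmodule of serre_mod by <:].

Let m1 : serre_mod := SerreMod one_fun_serre.
Let m1_neq0 : m1 != 0.
Proof. exact: one_fun_neq0. Qed.

Lemma smod_addE (x y : serre_mod) : val (x + y) = val x + val y.
Proof. exact: raddfD. Qed.
Lemma smod_oppE (x : serre_mod) : val (- x) = - val x.
Proof. exact: raddfN. Qed.
Lemma smod_scaleE (c : k) (x : serre_mod) : val (c *: x) = c *: val x.
Proof. exact: linearZ. Qed.
Definition smodE := (smod_addE, smod_oppE, smod_scaleE).

Lemma smodP (x : serre_mod) : smod_val x \in serre_pred.
Proof. by case: x. Qed.

Section Lift.
Variable P : tri_fun -> tri_fun.
Hypotheses (Plin : lin_map P) (PM : forall f, f \in serre_pred -> P f \in serre_pred).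

Let lift_fun (x : serre_mod) : serre_mod := SerreMod (PM (smodP x)).
Let lift_lin : lin_map lift_fun.
Proof.
by split=> [x y|c x]; apply: val_inj; rewrite !smodE /= ?smodE;
  [rewrite (proj1 Plin)|rewrite (proj2 Plin)].
Qed.
Definition lift_op : endo m1_neq0 := Endo m1_neq0 (introT (lin_mapP _) lift_lin).

Lemma lift_opE x : val (lift_op x) = P (val x).
Proof. by []. Qed.
End Lift.

Let eM i := lift_op (Eop_lin i) (@Eop_serre i).
Let kM nu := lift_op (Kop_lin nu) (@Kop_serre nu).
(** Stability under [Fop i] needs i in [I]; the value 0 elsewhere is a dummy. *)
Let fM i := if pselect (I i) is left h then lift_op (Fop_lin i) (fun f => @Fop_serre i f h)
            else 0.

Let fME i x : I i -> val (fM i x) = Fop i (val x).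
Proof. by rewrite /fM; case: pselect. Qed.

Lemma tri_rels : qg_rels q I inL eM fM kM.
Proof.
split; first by apply: endoP => x; apply: val_inj; exact: Kop0.
split; first by move=> mu la _ _; apply: endoP => x; apply: val_inj; exact: Kop_Kop.
split; first by move=> mu i _ _; apply: endoP => x; apply: val_inj; exact: Kop_Eop.
split.
  move=> mu i _ hi; apply: endoP => x; apply: val_inj.
  by rewrite endo_mulE lift_opE fME // Kop_Fop endo_scaleE endo_mulE smod_scaleE fME // lift_opE.
have comm i j : I i -> I j -> ip (al i) (al j) = 0 \/ ip (al i) (al j) = 2 ->
    i = j \/ (i != j /\ ~~ adj n i j).
  move=> hi hj; rewrite ip_alpha ?(rd_le HI hi) ?(rd_le HI hj) //.
  case: eqP => [|_]; first by left.
  by case: (adj n i j) => -[] //; right.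
have zero_val x : val x = 0 -> x = 0 :> serre_mod by move=> h; apply: val_inj.
split.
  move=> i j hi hj H.
  have [->//|[ij nij]] : i = j \/ (i != j /\ ~~ adj n i j).
    by apply: comm => //; case/orP: H => /eqP; [left|right].
  split; apply: endoP => x; apply/eqP; rewrite -subr_eq0; apply/eqP/val_inj.
    have := serreo_E0 hi hj ij (smodP x); rewrite /serreo (negPf nij).
    exact.
  have := serreo_F0 hi hj ij (smodP x); rewrite /serreo (negPf nij) => H0.
  by rewrite !smodE !endo_mulE !fME //; exact: H0.
split.
  move=> i j hi hj H.
  have aij : adj n i j.
    move: H; rewrite ip_alpha ?(rd_le HI hi) ?(rd_le HI hj) //.
    by case: eqP => // _; case: adj.
  have ij := adj_neq n3 aij.
  have back (A : algType k) (a b : A) :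
      a * a * b - (q + q^-1) *: (a * b * a) + b * a * a = 0 ->
      a * qbr q a b = q *: (qbr q a b * a).
    move=> H0; apply/eqP; rewrite -subr_eq0 -H0; apply/eqP; rewrite /qbr; nc tt.
  have {}back (a b : endo m1_neq0) :
      a * a * b - (q + q^-1) *: (a * b * a) + b * a * a = 0 ->
      a * qbr q a b = q *: (qbr q a b * a) := @back (endo m1_neq0) a b.
  split; apply: back; apply: endoP => x; apply: val_inj.
    have := serreo_E0 hi hj ij (smodP x); rewrite /serreo aij.
    exact.
  have := serreo_F0 hi hj ij (smodP x); rewrite /serreo aij => H0.
  by rewrite !endoE ?smodE ?endoE ?smodE !fME //; exact: H0.
move=> i j hi hj; apply: endoP => x; apply: val_inj.
rewrite !endoE !smodE ?endoE ?fME // ?lift_opE ?fME // Eop_Fop.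
by case: eqP => [->|_].
Qed.

Theorem tri_action (U : algType k) (E F : nat -> U) (K : W n -> U) :
  is_QG q I inL E F K ->
  exists act : U -> tri_fun -> tri_fun,
    [/\ forall x f, f \in serre_pred -> act x f \in serre_pred,
        forall x y f, act (x + y) f = act x f + act y f,
        forall (c : k) x f, act (c *: x) f = c *: act x f,
        forall x y f, f \in serre_pred -> act (x * y) f = act x (act y f) &
        [/\ forall f, f \in serre_pred -> act 1 f = f,
            forall i f, I i -> f \in serre_pred -> act (E i) f = Eop i f,
            forall i f, I i -> f \in serre_pred -> act (F i) f = Fop i f &
            forall mu f, inL mu -> f \in serre_pred -> act (K mu) f = Kop mu f]].
Proof.
move=> HU; have [rho [hr rE rF rK]] := qg_hom HU tri_rels.
(* [insubd] replaces functionals outside the Serre submodule by 0, so that the action is total; all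
   multiplicative claims are restricted to the submodule. *)
exists (fun x f => val (rho x (insubd (0 : serre_mod) f))).
split.
- by move=> x f _; apply: smodP.
- by move=> x y f; rewrite (ahD hr) endo_addE smod_addE.
- by move=> c x f; rewrite (ahZ hr) endo_scaleE smod_scaleE.
- by move=> x y f hf; rewrite (ahM hr) endo_mulE valKd.
split.
- by move=> f hf; rewrite (ah1 hr) endo_oneE insubdK.
- by move=> i f hi hf; rewrite rE // lift_opE insubdK.
- by move=> i f hi hf; rewrite rF // fME // insubdK.
- by move=> mu f hm hf; rewrite rK // lift_opE insubdK.
Qed.

End Verma.

(** * Linear independence *)
Section Functional.
Variables (k : fieldType) (V : lmodType k) (m : nat) (v : 'I_m -> V) (j0 : 'I_m).
Hypothesis v_free : forall c : 'I_m -> k, \sum_j c j *: v j = 0 -> forall j, c j = 0.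

Let span0 (x : V) : Prop := exists c : 'I_m -> k, x = \sum_(j | j != j0) c j *: v j.

Let span0_0 : span0 0.
Proof. by exists (fun=> 0); rewrite big1 // => j _; rewrite scale0r. Qed.

Let span0_lin a x y : span0 x -> span0 y -> span0 (a *: x + y).
Proof.
move=> [c ->] [d ->]; exists (fun j => a * c j + d j).
rewrite scaler_sumr -big_split; apply: eq_bigr => j _.
by rewrite scalerDl scalerA.
Qed.

Let v0_notin : ~ span0 (v j0).
Proof.
case=> c E; have := v_free (c := fun j => if j == j0 then -1 else c j) _ j0.
rewrite eqxx => H; have /eqP : -1 = 0 :> k.
  apply: H; rewrite (bigD1 j0) //= eqxx scaleN1r {1}E.
  by apply/eqP; rewrite addrC subr_eq0; apply/eqP/eq_bigr => j /negPf ->.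
by rewrite oppr_eq0 oner_eq0.
Qed.

(** Zorn's lemma also meets the empty chain, whose union is empty. Hence [A] may be empty and zero
    is added by hand. *)
Let P (A : set V) : Prop :=
  (forall a x y, A x -> A y -> A (a *: x + y)) /\
  (forall x s, A x \/ x = 0 -> span0 s -> v j0 <> x + s).

(** The space may have infinite dimension. A maximal subspace that contains the other v_j and avoids
    v_{j0} is a hyperplane, and l is the coefficient of v_{j0} modulo it. *)
Lemma exists_dual : exists l : V -> k,
  [/\ forall x y, l (x + y) = l x + l y, forall c x, l (c *: x) = c * l x &
      forall j, l (v j) = (j == j0)%:R].
Proof.
have [A [[Alin Av] Amax]] : exists A, P A /\ forall B, (A `<` B)%classic -> ~ P B.
  apply: Zorn_bigcup => F FP Ftot; split.
    move=> a x y [X FX Xx] [Y FY Yy].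
    have [XY|YX] := Ftot X Y FX FY.
      by exists Y => //; apply: (proj1 (FP Y FY)) => //; apply: XY.
    by exists X => //; apply: (proj1 (FP X FX)) => //; apply: YX.
  move=> x s [[X FX Xx]|->] hs; first by apply: (proj2 (FP X FX)) => //; left.
  by rewrite add0r => E; apply: v0_notin; rewrite E.
pose H x := exists a s, [/\ A a \/ a = 0, span0 s & x = a + s].
have Alin' a x y : A x \/ x = 0 -> A y \/ y = 0 -> A (a *: x + y) \/ a *: x + y = 0.
  move=> [hx|->] [hy|->].
  - by left; apply: Alin.
  - have A0 : A 0 by rewrite -(addNr x) -scaleN1r; apply: Alin.
    by left; apply: Alin.
  - by left; rewrite scaler0 add0r.
  - by right; rewrite scaler0 addr0.
have Hlin a x y : H x -> H y -> H (a *: x + y).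
  move=> [x1 [s1 [h1 h2 ->]]] [x2 [s2 [h3 h4 ->]]].
  exists (a *: x1 + x2), (a *: s1 + s2); split; [exact: Alin'|exact: span0_lin|].
  by rewrite scalerDr addrACA.
have Hv : ~ H (v j0) by move=> [a [s [ha hs E]]]; apply: (Av a s).
have H0 : H 0 by exists 0, 0; split; [right|exact: span0_0|rewrite addr0].
have HZ a x : H x -> H (a *: x) by move=> hx; rewrite -[_ *: _]addr0; apply: Hlin.
have decomp y : exists c, H (y - c *: v j0).
  apply: contrapT => nex.
  have nA : ~ A y.
    by move=> Ay; apply: nex; exists 0, y, 0; split; [left| |rewrite scale0r subr0 addr0].
  (* If no translate of y along v_{j0} lies in [H], adjoining y to [A] still avoids v_{j0}, against
     maximality. *)
  pose B := [set x | exists a d, (A a \/ a = 0) /\ x = a + d *: y]%classic.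
  apply: (Amax B).
    split; first by move=> x Ax; exists x, 0; split; [left|rewrite scale0r addr0].
    move=> BA; apply/nA/BA; exists 0, 1; split; [by right|by rewrite add0r scale1r].
  split.
    move=> a x1 x2 [a1 [d1 [h1 ->]]] [a2 [d2 [h2 ->]]].
    exists (a *: a1 + a2), (a * d1 + d2); split; first exact: Alin'.
    by rewrite scalerDr scalerA addrACA -scalerDl.
  move=> x s hx hs E.
  have [a [d [ha Ex]]] : exists a d, (A a \/ a = 0) /\ x = a + d *: y.
    by case: hx => [//|->]; exists 0, 0; split; [right|rewrite scale0r addr0].
  have [d0|d0] := eqVneq d 0.
    by apply: (Av a s) => //; rewrite E Ex d0 scale0r addr0.
  apply: nex; exists d^-1.
  have -> : y - d^-1 *: v j0 = (- d^-1) *: (a + s).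
    rewrite E Ex -addrA [d *: y + s]addrC addrA (scalerDr _ (a + s)) scalerA mulVf //.
    by rewrite scale1r opprD addrCA subrr addr0 scaleNr.
  by apply: HZ; exists a, s.
have uniq c d x : H (x - c *: v j0) -> H (x - d *: v j0) -> c = d.
  move=> h1 h2; apply/eqP; rewrite -subr_eq0; apply/negPn/negP => cd; apply: Hv.
  have : H ((c - d)^-1 *: ((-1) *: (x - c *: v j0) + (x - d *: v j0))) by apply/HZ/Hlin.
  rewrite scaleN1r opprB addrA subrK -scalerBl scalerA mulVf ?scale1r //.
have [l hl] := choice decomp.
exists l; split.
- move=> x y; apply: (uniq _ _ (x + y)) => //.
  rewrite scalerDl opprD addrACA -[X in X + _]scale1r.
  exact: Hlin.
- move=> c x; apply: (uniq _ _ (c *: x)) => //.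
  by rewrite -scalerA -scalerBr; apply: HZ.
move=> j; apply: (uniq _ _ (v j)) => //.
have [->|jj] := eqVneq j j0; first by rewrite scale1r subrr.
rewrite scale0r subr0; exists 0, (v j); split; [by right| |by rewrite add0r].
exists (fun i => (i == j)%:R); rewrite (bigD1 j) //= eqxx scale1r big1 ?addr0 //.
by move=> i /andP[_ /negPf ->]; rewrite scale0r.
Qed.
End Functional.

(* Tensors are represented through the balanced biadditive maps [b] on them. *)
Lemma tensor_free (k : fieldType) (A B : algType k) (P : A -> Prop) (Q : B -> Prop)
  (Q0 : Q 0) (QD : forall x y, Q x -> Q y -> Q (x + y))
  (QZ : forall (c : k) x, Q x -> Q (c *: x))
  (m : nat) (a : 'I_m -> A) (h : 'I_m -> B) :
  (forall j, P (a j) /\ Q (h j)) ->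
  exists m' (a' : 'I_m' -> A) (h' : 'I_m' -> B),
    [/\ forall j, P (a' j) /\ Q (h' j), lin_indep a' &
        forall (V : lmodType k) (b : A -> B -> V),
          (forall x y z, P x -> Q y -> Q z -> b x (y + z) = b x y + b x z) ->
          (forall (n : nat) (c : 'I_n -> k) (x : 'I_n -> A) y,
            (forall i, P (x i)) -> P (\sum_i c i *: x i) -> Q y ->
            b (\sum_i c i *: x i) y = \sum_i b (x i) (c i *: y)) ->
          \sum_j b (a j) (h j) = \sum_j b (a' j) (h' j)].
Proof.
elim: m a h => [|m IH] a h Hah.
  by exists 0%N, a, h; split=> // c _ [].
have [free|] := pselect (lin_indep a); first by exists m.+1, a, h; split.
move=> /existsNP[c /not_implyP[Ec /existsNP[j0 /eqP cj0]]].
(* The dependency expresses [a j0] through the other a's; its partner [h j0] is distributed over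
   their partners, and the tensor becomes one term shorter. *)
pose d i := - (c j0)^-1 * c (lift j0 i).
have Ea : a j0 = \sum_(i < m) d i *: a (lift j0 i).
  move: Ec; rewrite (bigD1_ord j0) //= => /(congr1 (fun x => (c j0)^-1 *: x)).
  rewrite scaler0 scalerDr scalerA mulVf // scale1r => /eqP.
  rewrite addr_eq0 => /eqP ->; rewrite scaler_sumr -sumrN.
  by apply: eq_bigr => i _; rewrite scalerA -scaleNr /d mulNr.
have [|m' [a' [h' [H1 H2 H3]]]] :=
    IH (fun i => a (lift j0 i)) (fun i => h (lift j0 i) + d i *: h j0).
  move=> i; split; first exact: (proj1 (Hah _)).
  by apply: QD; [exact: (proj2 (Hah _))|apply: QZ; exact: (proj2 (Hah _))].
exists m', a', h'; split=> // V b bD bS; rewrite -H3 // (bigD1_ord j0) //= {1}Ea bS.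
- rewrite -big_split; apply: eq_bigr => i _.
  rewrite bD; [exact: addrC|exact: (proj1 (Hah _))|exact: (proj2 (Hah _))|].
  by apply: QZ; exact: (proj2 (Hah _)).
- by move=> i; exact: (proj1 (Hah _)).
- by rewrite -Ea; exact: (proj1 (Hah _)).
- exact: (proj2 (Hah _)).
Qed.

(** * Root vectors of the word w_n *)

(* [op] stands for the braid operators acting on either the positive or the
   negative generators [e], with [qcomm] the q-commutator that they produce. *)
Definition qcomm (k : fieldType) (kap : k) (A : algType k) (a b : A) : A :=
  a * b - kap *: (b * a).

(** Indices run over the finite diagram only. Relabelled letters in the affine algebra give further
    instances, so that each computation with root vectors is done once. *)
Record chain (k : fieldType) (n : nat) (A : algType k) (kap : k)
    (e : nat -> A) (op : nat -> A -> A) : Prop := Chain {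
  ch_hom : forall i, ID n i -> alg_hom (op i);
  ch_fix : forall i j, ID n i -> ID n j -> i != j -> ~~ adj n i j -> op i (e j) = e j;
  ch_br : forall i j, ID n i -> ID n j -> adj n i j -> op i (e j) = qcomm kap (e i) (e j);
  ch_back : forall i j, ID n i -> ID n j -> adj n i j -> op i (qcomm kap (e j) (e i)) = e j;
  ch_comm : forall i j, ID n i -> ID n j -> i != j -> ~~ adj n i j ->
    e i * e j = e j * e i
}.

Definition ops (A : Type) (op : nat -> A -> A) (s : seq nat) (x : A) : A :=
  foldr (fun i y => op i y) x s.

(* [:: m; m - 1; ...; j + 1] *)
Definition desc (m j : nat) : seq nat := [seq (m - i)%N | i <- iota 0 (m - j)].

Section Words.
Variables (A : Type) (op : nat -> A -> A).

Lemma ops_cat s1 s2 x : ops op (s1 ++ s2) x = ops op s1 (ops op s2 x).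
Proof. by rewrite /ops foldr_cat. Qed.

Lemma descS m j : (j <= m)%N -> desc m.+1 j = m.+1 :: desc m j.
Proof.
move=> jm; rewrite /desc subSn //= subn0; congr (_ :: _).
rewrite (iotaDl 1 0) -map_comp; apply/eq_in_map => i /=.
by rewrite mem_iota => /andP[_ h]; rewrite add1n subSS.
Qed.

Lemma desc_nil m : desc m m = [::].
Proof. by rewrite /desc subnn. Qed.

Lemma desc_cat m l j : (j <= l)%N -> (l <= m)%N -> desc m j = desc m l ++ desc l j.
Proof.
move=> jl; elim: m => [|m IH]; first by rewrite leqn0 => /eqP ->; rewrite desc_nil.
rewrite leq_eqVlt => /orP[/eqP ->|]; first by rewrite desc_nil.
rewrite ltnS => lm; rewrite !descS ?IH //; exact: leq_trans lm.
Qed.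

Lemma mem_desc m j i : (i \in desc m j) = (j < i <= m)%N.
Proof.
elim: m => [|m IH]; first by rewrite /desc sub0n in_nil; lia.
case: (leqP j m) => jm; first by rewrite descS // inE IH; lia.
have -> : desc m.+1 j = [::] by rewrite /desc (_ : m.+1 - j = 0)%N; last lia.
rewrite in_nil; lia.
Qed.

End Words.

Section Chain.
Variables (k : fieldType) (n : nat) (n3 : (3 <= n)%N) (A : algType k) (kap : k).
Variables (e : nat -> A) (op : nat -> A -> A).
Hypothesis C : chain n kap e op.
Notation br := (qcomm kap).
Implicit Types x y z : A.
Notation ops := (ops op).

Definition gen (J : pred nat) : A -> Prop := gen_alg (fun x => exists i, [/\ ID n i, J i & x = e i]).

Lemma gen_e (J : pred nat) i : ID n i -> J i -> gen J (e i).
Proof. by move=> hi Ji; apply: ga_gen; exists i. Qed.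

Lemma gen_sub (J J' : pred nat) x : (forall i, J i -> J' i) -> gen J x -> gen J' x.
Proof. by move=> H; apply: ga_sub => _ [i [hi /H Ji ->]]; apply: gen_e. Qed.

Lemma gen_br (J : pred nat) x y : gen J x -> gen J y -> gen J (br x y).
Proof. by move=> hx hy; apply: ga_subr; last apply: ga_scale; apply: ga_mul. Qed.

Lemma op_br i x y : ID n i -> op i (br x y) = br (op i x) (op i y).
Proof.
by move=> hi; have h := ch_hom C hi; rewrite /qcomm (ahB h) (ahZ h) !(ahM h).
Qed.

(** The letter m must be absent from x, because nothing is assumed on [op m (e m)], which is not
    positive in the intended instances. *)
Lemma op_gen (J : pred nat) m x : ID n m -> ~~ J m -> gen J x ->
  gen (fun i => J i || (i == m)) (op m x).
Proof.
move=> hm nJm; apply: ga_hom (ch_hom C hm) _ => _ [i [hi Ji ->]].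
have im : m != i by apply: contraNneq nJm => ->.
case: (boolP (adj n m i)) => a.
  by rewrite (ch_br C) //; apply: gen_br; apply: gen_e; rewrite // ?eqxx ?orbT ?Ji.
by rewrite (ch_fix C) //; apply: gen_e; rewrite ?Ji.
Qed.

Lemma op_id (J : pred nat) m x : ID n m ->
  (forall i, ID n i -> J i -> (m != i) && ~~ adj n m i) -> gen J x -> op m x = x.
Proof.
move=> hm HJ; apply: (ga_eq (ch_hom C hm) (@alg_hom_id _ A)) => _ [i [hi Ji ->]].
by have /andP[im a] := HJ i hi Ji; rewrite (ch_fix C).
Qed.

Lemma ops_id (J : pred nat) s x : all (ID n) s ->
  (forall m i, m \in s -> ID n i -> J i -> (m != i) && ~~ adj n m i) ->
  gen J x -> ops s x = x.
Proof.
move=> + + hx; elim: s => [//|m s IH] /= /andP[hm hs] HJ.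
rewrite IH //; last by move=> a i ha; apply: HJ; rewrite inE ha orbT.
by apply: op_id hx => // i; apply: HJ; rewrite inE eqxx.
Qed.

Lemma gen_comm (J J' : pred nat) x y :
  (forall i j, ID n i -> ID n j -> J i -> J' j -> (i != j) && ~~ adj n i j) ->
  gen J x -> gen J' y -> x * y = y * x.
Proof.
have com1 (P : A -> Prop) z u : (forall v, P v -> z * v = v * z) ->
    gen_alg P u -> z * u = u * z.
  move=> HP; elim=> [v hv||v v' _ hv _ hv'|c v _ hv|v v' _ hv _ hv'].
  - exact: HP.
  - by rewrite mulr1 mul1r.
  - by rewrite mulrDl mulrDr hv hv'.
  - by rewrite -scalerAl -scalerAr hv.
  - by rewrite mulrA hv -mulrA hv' mulrA.
move=> H hx hy; apply: (com1 _ _ _ _ hy) => _ [j [hj Jj ->]].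
symmetry; apply: (com1 _ _ _ _ hx) => _ [i [hi Ji ->]]; symmetry.
by have /andP[h1 h2] := H i j hi hj Ji Jj; rewrite (ch_comm C).
Qed.

Lemma br_assoc x y z : x * z = z * x -> br (br x y) z = br x (br y z).
Proof. by move=> H; rewrite /qcomm; nc (tt, H). Qed.

Lemma ops_br s x y : all (ID n) s -> ops s (br x y) = br (ops s x) (ops s y).
Proof. by elim: s => [//|m s IH] /= /andP[hm hs]; rewrite IH // op_br. Qed.

Lemma all_desc m j : (m <= n.+1)%N -> all (ID n) (desc m j).
Proof. by move=> hm; apply/allP => i; rewrite mem_desc /ID; lia. Qed.

(** Every suffix of the word keeps x in the subalgebra of the e's. The braid operators can be undone
    or transported only along such words. *)
Fixpoint pos (s : seq nat) (x : A) : Prop :=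
  match s with
  | [::] => gen xpredT x
  | i :: s' => pos s' x /\ gen xpredT (ops s x)
  end.

Lemma pos_cat s1 s2 x : pos s2 x -> pos s1 (ops s2 x) -> pos (s1 ++ s2) x.
Proof.
by move=> h2; elim: s1 => [//|i s IH] /= [h1 h3]; split; [exact: IH|rewrite ops_cat].
Qed.

Lemma pos_gen s x : pos s x -> gen xpredT (ops s x).
Proof. by case: s => [|i s] //= []. Qed.

Lemma genT (J : pred nat) x : gen J x -> gen xpredT x.
Proof. exact: gen_sub. Qed.

Lemma pos_desc t m x : (t <= m)%N -> (m <= n.+1)%N -> gen (fun i => (i <= t)%N) x ->
  pos (desc m t) x /\ gen (fun i => (i <= m)%N) (ops (desc m t) x).
Proof.
move=> tm + hx; elim: m tm => [|m IH].
  rewrite leqn0 => /eqP t0 _; subst t.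
  by rewrite desc_nil; split=> //; apply: genT hx.
rewrite leq_eqVlt => /orP[/eqP t0 _|tm hm].
  by subst t; rewrite desc_nil; split=> //; apply: genT hx.
have [|h1 h2] := IH tm _; first exact: ltnW.
rewrite descS //=; have h3 : gen (fun i => (i <= m.+1)%N) (op m.+1 (ops (desc m t) x)).
  have := op_gen (m := m.+1) _ _ h2; rewrite /ID; move/(_ _ _)/gen_sub; apply; lia.
by split=> //; split=> //; apply: genT h3.
Qed.

Lemma pos_fix (J : pred nat) s x : all (ID n) s ->
  (forall m i, m \in s -> ID n i -> J i -> (m != i) && ~~ adj n m i) ->
  gen J x -> pos s x.
Proof.
move=> + + hx; elim: s => [|m s IH] /=; first by move=> _ _; apply: genT hx.
move=> hs HJ; have H : ops (m :: s) x = x by apply: ops_id hx.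
split; last by rewrite -[op m _]/(ops (m :: s) x) H; apply: genT hx.
case/andP: hs => _ hs.
by apply: IH => // a i ha; apply: HJ; rewrite inE ha orbT.
Qed.

Notation N := n.+1.

(** The vector x_j belongs to the letter j + 1 of the descending factor of w_n, y_1 to its last
    letter 1, and y_j for j >= 2 to the letter j + 1 of the ascending factor; [zs] is the
    contribution of the ascending factor. *)
Definition xs j : A := ops (desc N j.+1) (e j.+1).
Definition zs t : A := ops (iota 3 (t - 3)) (e t).
Definition ys j : A := if j == 1%N then ops (desc N 1) (e 1) else ops (desc N 0) (zs j.+1).

Lemma adj_ge2 i : (2 <= i)%N -> adj n i i.+1.
Proof. rewrite /adj; lia. Qed.

Ltac id_tac := rewrite /ID /adj /=; lia.

Lemma IDE i : ID n i = (1 <= i <= n.+1)%N. Proof. by []. Qed.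

Lemma desc1 m j : j = m -> desc m.+1 j = [:: m.+1].
Proof. by move=> ->; rewrite descS // desc_nil. Qed.

Lemma desc_above (J : pred nat) t x : (t <= N)%N ->
  (forall i, ID n i -> J i -> (i < t)%N /\ ((i == 1) ==> (3 <= t))%N) ->
  gen J x -> ops (desc N t) x = x.
Proof.
move=> tN HJ; apply: ops_id; first exact: all_desc.
move=> m i; rewrite mem_desc => hm hi Ji; have [] := HJ i hi Ji.
move: hm hi; id_tac.
Qed.

Lemma desc_below (J : pred nat) m j x : (m <= N)%N ->
  (forall i, ID n i -> J i -> (m.+1 < i)%N && ((m == 1) ==> (3 < i))%N) ->
  gen J x -> ops (desc m j) x = x.
Proof.
move=> mN HJ; apply: ops_id; first exact: all_desc.
move=> l i; rewrite mem_desc => hm hi Ji; have := HJ i hi Ji.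
move: hm hi; id_tac.
Qed.

Lemma xs_n : xs n = e N.
Proof. by rewrite /xs desc_nil. Qed.

Lemma desc_split m j : (j < m)%N -> desc m j = desc m j.+1 ++ [:: j.+1].
Proof. by move=> jm; rewrite (@desc_cat m j.+1 j) // desc1. Qed.

(** Only the last letter of the prefix, j + 2, moves e_{j+1}; all larger ones fix it. *)
Lemma xs_rec j : (1 <= j < n)%N -> xs j = br (xs j.+1) (e j.+1).
Proof.
move=> hj; rewrite /xs desc_split ?ops_cat /=; last lia.
rewrite (ch_br C); [|id_tac..]; rewrite ops_br; last by apply: all_desc.
rewrite [X in br _ X](desc_above (J := pred1 j.+1)) //; first lia.
  by move=> i; rewrite IDE /= => hi /eqP ->; split; lia.
by apply: gen_e; rewrite ?IDE /=; lia.
Qed.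

Lemma ys1E : ys 1 = br (xs 2) (e 1).
Proof.
rewrite /ys eqxx (@desc_cat N 3 1) //; last lia.
rewrite ops_cat /xs (_ : desc 3 1 = [:: 3; 2]) //=.
rewrite (ch_fix C); [|id_tac..]; rewrite (ch_br C); [|id_tac..].
rewrite ops_br; last by apply: all_desc.
rewrite [X in br _ X](desc_above (J := pred1 1%N)) //; first lia.
  by move=> i hi /= /eqP ->.
by apply: gen_e; rewrite ?IDE /=; lia.
Qed.

Lemma desc3 : desc N 0 = desc N 3 ++ [:: 3; 2; 1].
Proof. by rewrite (@desc_cat N 3 0) //; lia. Qed.

(** The turn around the branching node 3, on which all brackets with indices beyond it are built. *)
Lemma ops321 : op 3 (op 2 (op 1 (e 3))) = br (br (e 3) (e 1)) (e 2).
Proof.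
rewrite (ch_br C); [|id_tac..]; rewrite op_br; [|id_tac].
rewrite (ch_fix C (i := 2) (j := 1)); [|id_tac..].
rewrite (ch_br C (i := 2)); [|id_tac..]; rewrite op_br; [|id_tac].
rewrite (ch_br C); [|id_tac..]; rewrite (ch_back C) //; [id_tac..].
Qed.

Lemma fix_above3 i : (1 <= i <= 2)%N -> ops (desc N 3) (e i) = e i.
Proof.
move=> hi; apply: (desc_above (J := pred1 i)); first lia.
  by move=> i0 _ /= /eqP ->; split; lia.
by apply: gen_e; rewrite ?IDE /=; lia.
Qed.

Lemma ys2E : ys 2 = br (ys 1) (e 2).
Proof.
rewrite ys1E (_ : ys 2 = ops (desc N 0) (e 3)) // desc3 ops_cat /= ops321.
rewrite !ops_br; [|by apply: all_desc..].
by rewrite (fix_above3 (i := 1)) ?(fix_above3 (i := 2)).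
Qed.

Lemma iota3_last t : (4 <= t)%N -> iota 3 (t - 3) = iota 3 (t.-1 - 3) ++ [:: t.-1].
Proof.
move=> ht; rewrite (_ : t - 3 = (t.-1 - 3) + 1)%N; last lia.
by rewrite iotaD; congr (_ ++ [:: _]); lia.
Qed.

Lemma all_iota t : (t <= N.+1)%N -> all (ID n) (iota 3 (t - 3)).
Proof. by move=> ht; apply/allP => i; rewrite mem_iota IDE; lia. Qed.

Lemma zs_rec t : (4 <= t <= N)%N -> zs t = br (zs t.-1) (e t).
Proof.
move=> ht; rewrite /zs iota3_last ?ops_cat /=; last lia.
rewrite (ch_br C); [|by move: ht; id_tac..|by move: ht; case: t => [//|t] ht; apply: adj_ge2; move: ht; lia].
rewrite ops_br; last by apply: all_iota; lia.
congr (br _ _); apply: (ops_id (J := pred1 t)); first by apply: all_iota; lia.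
  by move=> m i; rewrite mem_iota => hm hi /= /eqP ->; move: hm ht; id_tac.
by apply: gen_e; rewrite ?IDE /=; lia.
Qed.

Lemma zs_gen t : (3 <= t <= N)%N -> gen (fun i => (3 <= i <= t)%N) (zs t).
Proof.
elim: t => [//|t IH] ht; have [t2|t3] := eqVneq t 2%N.
  by rewrite t2 /zs /=; apply: gen_e; rewrite ?IDE; lia.
rewrite zs_rec; last lia.
apply: gen_br; last by apply: gen_e; rewrite ?IDE; lia.
by apply: gen_sub (IH _) => [i|]; lia.
Qed.

(** The descending factor shifts letters down: the pair j + 1, j carries e_{j+1} to e_j by [ch_br]
    and [ch_back], and the letters below and above act trivially. *)
Lemma theta j : (3 <= j <= n)%N -> ops (desc N 0) (e j.+1) = e j.
Proof.
move=> hj; rewrite (@desc_cat N j.+1 0) ?(@desc_cat j.+1 j.-1 0) ?ops_cat //; try lia.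
rewrite [X in ops _ (ops _ X)](desc_below (J := pred1 j.+1));
  [|lia|by move=> i _ /= /eqP ->; lia|by apply: gen_e; rewrite ?IDE /=; lia].
have -> : desc j.+1 j.-1 = [:: j.+1; j].
  by case: j hj => [//|j] hj /=; rewrite descS // desc1.
rewrite /= (ch_br C) ?(ch_back C); try by [move: hj; id_tac].
apply: (desc_above (J := pred1 j)); first lia.
  by move=> i _ /= /eqP ->; split; lia.
by apply: gen_e; rewrite ?IDE /=; lia.
Qed.

Lemma ys_rec j : (3 <= j <= n)%N -> ys j = br (ys j.-1) (e j).
Proof.
move=> hj; rewrite /ys !ifF; try by [lia | apply/eqP; lia].
rewrite zs_rec; last lia.
rewrite succnK prednK; last lia.
by rewrite ops_br ?theta //; apply: all_desc.
Qed.

Lemma wDE : wD n = desc N 0 ++ iota 3 (n - 1).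
Proof. by rewrite /wD /desc subn0. Qed.

Lemma all_wD : all (ID n) (wD n).
Proof.
by rewrite wDE all_cat all_desc //; apply/allP => i; rewrite mem_iota IDE; lia.
Qed.

(** The left factor that remains when the last two letters of a partially descended [zs] are split
    off as a bracket. *)
Fixpoint chainA (t : nat) : A :=
  if t is t'.+1 then br (op t.+3 (chainA t')) (e t.+2) else br (br (e 3) (e 1)) (e 2).

Lemma chainA_gen t : (t.+3 <= N)%N -> gen (fun i => (i <= t.+3)%N) (chainA t).
Proof.
elim: t => [|t IH] ht.
  by apply: gen_br; [apply: gen_br|]; apply: gen_e; rewrite ?IDE; lia.
apply: gen_br; last by apply: gen_e; rewrite ?IDE; lia.
have h := IH (ltnW ht).
have hID : ID n t.+4 by rewrite IDE; lia.
by apply: gen_sub (op_gen hID _ h) => [i|]; lia.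
Qed.

(** In the step, operator t + 4 collapses [e_{t+3}, e_{t+4}] to e_{t+3}, which joins the left
    factor, while e_{t+5} becomes [e_{t+4}, e_{t+5}]. *)
Lemma mid_desc t : (t.+4 <= N)%N ->
  ops (desc t.+3 0) (zs t.+4) = br (chainA t) (br (e t.+3) (e t.+4)).
Proof.
elim: t => [|t IH] ht.
  rewrite zs_rec ?succnK; last lia.
  rewrite ops_br; last by apply: all_desc; lia.
  rewrite [X in br X _](_ : _ = br (br (e 3) (e 1)) (e 2)); last exact: ops321.
  congr (br _ _); rewrite -[LHS]/(op 3 (op 2 (op 1 (e 4)))).
  rewrite (ch_fix C (i := 1)); [|id_tac..]; rewrite (ch_fix C (i := 2)); [|id_tac..].
  by rewrite (ch_br C); [|id_tac..].
rewrite zs_rec ?succnK; last lia.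
rewrite ops_br; last by apply: all_desc; lia.
rewrite descS // -[ops _ (zs _)]/(op t.+4 (ops (desc t.+3 0) (zs t.+4))) IH; last lia.
rewrite op_br; [|rewrite IDE; lia].
rewrite (ch_back C); [|rewrite IDE; lia..|by rewrite (adjC n3); apply: adj_ge2].
rewrite -[ops _ (e _)]/(op t.+4 (ops (desc t.+3 0) (e t.+4.+1))).
rewrite (desc_below (J := pred1 t.+4.+1));
  [|lia|by move=> i _ /= /eqP ->; lia|by apply: gen_e; rewrite ?IDE /=; lia].
by rewrite (ch_br C); [|rewrite IDE; lia..|exact: adj_ge2].
Qed.

(** Isolates the single occurrence of e_t, both for applying operator t and for commutators with
    F_t. The disjunction keeps the shape of Y, from which its weight is computed later. *)
Lemma mid_form t : (3 <= t <= N)%N -> exists Y,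
  [/\ gen (fun i => (i < t)%N) Y, t = 3%N /\ Y = e 1 \/ (exists s, t = s.+4 /\ Y = chainA s) &
      ops (desc t.-1 0) (zs t) = br Y (br (e t.-1) (e t))].
Proof.
move=> ht; have [->|t3] := eqVneq t 3%N.
  exists (e 1); split; [by apply: gen_e|by left|].
  rewrite -[LHS]/(op 2 (op 1 (e 3))) (ch_br C); [|id_tac..].
  rewrite op_br; [|id_tac].
  rewrite (ch_fix C (i := 2) (j := 1)); [|id_tac..].
  by rewrite (ch_br C (i := 2)); [|id_tac..].
case: t ht t3 => [|[|[|[|t]]]] // ht _; exists (chainA t).
split; [|by right; exists t|exact: mid_desc].
by apply: gen_sub (chainA_gen _) => [i|]; lia.
Qed.

Lemma pos_zs t : (3 <= t <= N)%N -> pos (iota 3 (t - 3)) (e t).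
Proof.
move=> ht; suff H i : (i <= t - 3)%N -> pos (iota (t - i) i) (e t) /\
    gen (fun l => (t - i <= l <= t)%N) (ops (iota (t - i) i) (e t)).
  by have [] := H (t - 3)%N (leqnn _); rewrite (_ : t - (t - 3) = 3)%N //; lia.
elim: i => [|i IH] hi; first by split; apply: gen_e; rewrite ?IDE /=; lia.
have [h1 h2] := IH (ltnW hi).
rewrite /= (_ : (t - i.+1).+1 = t - i)%N; last lia.
have hID : ID n (t - i.+1) by rewrite IDE; lia.
have h3 : gen (fun l => (t - i.+1 <= l <= t)%N) (op (t - i.+1) (ops (iota (t - i) i) (e t))).
  by apply: gen_sub (op_gen hID _ h2) => [l|]; lia.
by split=> //; split=> //; apply: genT h3.
Qed.

Lemma desc_zs_gen t m : (3 <= t <= N)%N -> (m < t)%N ->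
  gen (fun i => (i <= t)%N) (ops (desc m 0) (zs t)).
Proof.
elim: t => [//|t IH] ht hm; have [t2|t3] := eqVneq t 2%N.
  subst t => {IH}; have h0 : gen (pred1 3%N) (zs 3) by apply: gen_e.
  have h1 : gen (fun i => pred1 3 i || (i == 1))%N (op 1 (zs 3)) by apply: op_gen.
  case: m hm => [|[|[|m]]] // _.
  - by apply: gen_sub h0 => i /eqP ->.
  - by apply: gen_sub h1 => i /orP[] /eqP ->.
  have hID : ID n 2 by rewrite IDE; lia.
  have h2 := op_gen hID (J := fun i => pred1 3 i || (i == 1))%N isT h1.
  by apply: gen_sub h2 => i /orP[/orP[]|] /eqP ->.
have [mt|mt] := eqVneq m t.
  have [Y [hY _]] := mid_form ht; rewrite succnK mt => ->.
  apply: gen_br; last by apply: gen_br; apply: gen_e; rewrite ?IDE; lia.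
  by apply: gen_sub hY => i; lia.
rewrite zs_rec ?succnK; last lia.
rewrite ops_br; last by apply: all_desc; lia.
rewrite [X in br _ X](desc_below (J := pred1 t.+1));
  [|lia|by move=> i _ /= /eqP ->; lia|by apply: gen_e; rewrite ?IDE /=; lia].
apply: gen_br; last by apply: gen_e; rewrite ?IDE; lia.
by apply: gen_sub (IH _ _) => [i||]; lia.
Qed.

(** The critical letter: operator t meets an element containing e_t, so [op_gen] does not apply. By
    [mid_form] the letter sits in [e_{t-1}, e_t], which [ch_back] turns into e_{t-1}. *)
Lemma desc_zs_top t : (3 <= t <= N)%N -> gen (fun i => (i <= t)%N) (ops (desc t 0) (zs t)).
Proof.
move=> ht; have [->|t3] := eqVneq t 3%N.
  by rewrite -[ops _ _]/(op 3 (op 2 (op 1 (e 3)))) ops321; apply: gen_br;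
     [apply: gen_br|]; apply: gen_e; rewrite ?IDE; lia.
have [Y [hY _ mid]] := mid_form ht.
have -> : desc t 0 = t :: desc t.-1 0 by case: t ht {t3 hY mid} => // t _; rewrite descS.
rewrite -[ops _ _]/(op t (ops (desc t.-1 0) (zs t))) mid.
have hID : ID n t by rewrite IDE; lia.
have hID' : ID n t.-1 by rewrite IDE; lia.
have adjt : adj n t t.-1 by move: ht t3; id_tac.
rewrite op_br // (ch_back C) //.
apply: gen_br; last by apply: gen_e; lia.
by apply: gen_sub (op_gen hID _ hY) => [i|]; lia.
Qed.

Lemma pos_ys t : (3 <= t <= N)%N -> pos (desc N 0 ++ iota 3 (t - 3)) (e t).
Proof.
move=> ht; apply: pos_cat; first exact: pos_zs.
rewrite (@desc_cat N t 0) //; last lia.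
apply: pos_cat; last by apply: (proj1 (pos_desc _ _ (desc_zs_top ht))); lia.
have H m : (m <= t)%N -> pos (desc m 0) (zs t).
  elim: m => [|m IH] hm.
    by rewrite desc_nil; apply: genT (zs_gen ht).
  rewrite descS //; split; first by apply: IH; lia.
  rewrite -descS //; have [->|mt] := eqVneq m.+1 t; first exact: genT (desc_zs_top ht).
  by apply: (genT (J := fun i => (i <= t)%N)); apply: desc_zs_gen => //; lia.
exact: H.
Qed.

Lemma pos_xs t : (1 <= t <= N)%N -> pos (desc N t) (e t).
Proof.
move=> ht; apply: (proj1 (pos_desc _ _ _)) => //; try lia.
by apply: gen_e; rewrite ?IDE; lia.
Qed.

(** The ascending factor moves e_j up to e_{j+1} and the descending one moves it back, as in
    [theta]. *)
Lemma wD_e j : (3 <= j <= n)%N -> ops (wD n) (e j) = e j /\ pos (wD n) (e j).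
Proof.
move=> hj.
have hID : ID n j by rewrite IDE; lia.
have hIDS : ID n j.+1 by rewrite IDE; lia.
have a : adj n j j.+1 by apply: adj_ge2; lia.
have a' : adj n j.+1 j by rewrite (adjC n3).
have E : iota 3 (n - 1) = iota 3 (j - 3) ++ [:: j; j.+1] ++ iota j.+2 (n - j).
  rewrite (_ : n - 1 = (j - 3) + (2 + (n - j)))%N; last lia.
  by rewrite !iotaD (_ : 3 + (j - 3) = j)%N ?addn2 //; lia.
have ej : gen (pred1 j) (e j) by apply: gen_e => //=.
have ejS : gen (pred1 j.+1) (e j.+1) by apply: gen_e => //=.
have al1 : all (ID n) (iota j.+2 (n - j)).
  by apply/allP => i; rewrite mem_iota IDE; lia.
have al2 : all (ID n) (iota 3 (j - 3)) by apply: all_iota; lia.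
have c1 m i : m \in iota j.+2 (n - j) -> ID n i -> pred1 j i -> (m != i) && ~~ adj n m i.
  by rewrite mem_iota => hm hi /= /eqP ->; move: hm hj; id_tac.
have c2 m i : m \in iota 3 (j - 3) -> ID n i -> pred1 j.+1 i -> (m != i) && ~~ adj n m i.
  by rewrite mem_iota => hm hi /= /eqP ->; move: hm hj; id_tac.
have E1 : ops (iota j.+2 (n - j)) (e j) = e j by apply: ops_id ej.
have E2 : ops [:: j; j.+1] (e j) = e j.+1.
  by rewrite /= (ch_br C) // (ch_back C).
have E3 : ops (iota 3 (j - 3)) (e j.+1) = e j.+1 by apply: ops_id ejS.
have E4 : ops (iota 3 (n - 1)) (e j) = e j.+1 by rewrite E !ops_cat E1 E2 E3.
split; first by rewrite wDE ops_cat E4 theta.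
rewrite wDE; apply: pos_cat.
  rewrite E; apply: pos_cat; last by rewrite ops_cat E1 E2; apply: pos_fix ejS.
  apply: pos_cat; first by apply: pos_fix ej.
  rewrite E1 /= (ch_br C) // (ch_back C) //.
  by split; [split|]; [apply: genT ej|apply: gen_br; apply: gen_e|apply: genT ejS].
rewrite E4; rewrite (@desc_cat N j.+1 0); [|lia..].
have F1 : ops (desc j.-1 0) (e j.+1) = e j.+1.
  by apply: (desc_below (J := pred1 j.+1)) ejS => [|i _ /= /eqP ->]; lia.
have F2 : desc j.+1 0 = [:: j.+1; j] ++ desc j.-1 0.
  by case: j hj {hID hIDS a a' E ej ejS al1 al2 c1 c2 E1 E2 E3 E4 F1} => [//|j] hj; rewrite !descS.
apply: pos_cat.
  rewrite F2; apply: pos_cat.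
    apply: (pos_fix (J := pred1 j.+1)) ejS; first by apply: all_desc; lia.
    by move=> m i; rewrite mem_desc => hm hi /= /eqP ->; move: hm hj; id_tac.
  rewrite F1 /= (ch_br C) // (ch_back C) //.
  by split; [split|]; [apply: genT ejS|apply: gen_br; apply: gen_e|apply: genT ej].
have -> : ops (desc j.+1 0) (e j.+1) = e j.
  by rewrite F2 ops_cat F1 /= (ch_br C) // (ch_back C).
apply: (pos_fix (J := pred1 j)) ej; first exact: all_desc.
by move=> m i; rewrite mem_desc => hm hi /= /eqP ->; move: hm hj; id_tac.
Qed.

(** Letters from 4 on do not touch the nodes 1 and 2, so only the block 3, 2, 1, 3 in the middle of
    w_n matters. This exchange is the reason for the exchange of 1 and 2 in [aswap]. *)
Lemma wD_e12 : [/\ ops (wD n) (e 1) = e 2, ops (wD n) (e 2) = e 1,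
  pos (wD n) (e 1) & pos (wD n) (e 2)].
Proof.
have h1 : ID n 1 by []. have h2 : ID n 2 by rewrite IDE; lia. have h3 : ID n 3 by rewrite IDE; lia.
have E : wD n = desc N 3 ++ [:: 3; 2; 1; 3] ++ iota 4 (n - 2).
  rewrite wDE desc3 -catA (_ : n - 1 = 1 + (n - 2))%N; last lia.
  by rewrite iotaD.
have g i : (1 <= i <= 2)%N -> gen (pred1 i) (e i) by move=> hi; apply: gen_e => //=; rewrite IDE; lia.
have al4 : all (ID n) (iota 4 (n - 2)) by apply/allP => i; rewrite mem_iota IDE; lia.
have c4 i m l : (1 <= i <= 2)%N -> m \in iota 4 (n - 2) -> ID n l -> pred1 i l ->
    (m != l) && ~~ adj n m l.
  by rewrite mem_iota => hi hm hl /= /eqP ->; move: hi hm; id_tac.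
have E4 i : (1 <= i <= 2)%N -> ops (iota 4 (n - 2)) (e i) = e i.
  by move=> hi; apply: ops_id (g i hi) => // m l; apply: c4.
have P4 i : (1 <= i <= 2)%N -> pos (iota 4 (n - 2)) (e i).
  by move=> hi; apply: pos_fix (g i hi) => // m l; apply: c4.
have P3 i : (1 <= i <= 2)%N -> pos (desc N 3) (e i).
  move=> hi; apply: pos_fix (g i hi); first exact: all_desc.
  by move=> m l; rewrite mem_desc => hm hl /= /eqP ->; move: hi hm; id_tac.
have a13 : adj n 1 3 by id_tac.
have a31 : adj n 3 1 by id_tac.
have a23 : adj n 2 3 by id_tac.
have a32 : adj n 3 2 by id_tac.
have n12 : ~~ adj n 1 2 by id_tac.
have n21 : ~~ adj n 2 1 by id_tac.
have com : e 1 * e 2 = e 2 * e 1 by apply: (ch_comm C).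
(* the four stages of the central factor s3 s2 s1 s3 *)
have A1 : op 3 (e 1) = br (e 3) (e 1) by apply: (ch_br C).
have A2 : op 1 (br (e 3) (e 1)) = e 3 by apply: (ch_back C).
have A3 : op 2 (e 3) = br (e 2) (e 3) by apply: (ch_br C).
have A4 : op 3 (br (e 2) (e 3)) = e 2 by apply: (ch_back C).
have B1 : op 3 (e 2) = br (e 3) (e 2) by apply: (ch_br C).
have B2 : op 1 (br (e 3) (e 2)) = br (e 1) (br (e 3) (e 2)).
  by rewrite op_br // (ch_br C) // (ch_fix C) // br_assoc.
have B3 : op 2 (br (e 1) (br (e 3) (e 2))) = br (e 1) (e 3).
  by rewrite op_br // (ch_back C) // (ch_fix C).
have B4 : op 3 (br (e 1) (e 3)) = e 1 by apply: (ch_back C).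
have gb i j : ID n i -> ID n j -> gen xpredT (br (e i) (e j)).
  by move=> hi hj; apply: gen_br; apply: gen_e.
have ge i : ID n i -> gen xpredT (e i) by move=> hi; apply: gen_e.
split.
- by rewrite E !ops_cat E4 //= A1 A2 A3 A4 fix_above3.
- by rewrite E !ops_cat E4 //= B1 B2 B3 B4 fix_above3.
- rewrite E; apply: pos_cat; last by rewrite ops_cat E4 //= A1 A2 A3 A4; apply: P3.
  apply: pos_cat; first exact: P4.
  by rewrite E4 //= A1 A2 A3 A4; do ?split; do ?[apply: gb|apply: ge].
- rewrite E; apply: pos_cat; last by rewrite ops_cat E4 //= B1 B2 B3 B4; apply: P3.
  apply: pos_cat; first exact: P4.
  rewrite E4 //= B1 B2 B3 B4; do ?split; do ?[by apply: gb|by apply: ge].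
  by apply: gen_br; [apply: ge|apply: gb].
Qed.

(** Tails of [zs N]. After the relabelling [p0map] the letter n + 1 stands for the node 0, and these
    become images of E_0 under ends of w_n. *)
Definition Qs j : A := ops (iota j (N - j)) (e N).

Lemma Qs_gen j : (1 <= j <= N)%N -> gen (fun i => (j <= i)%N) (Qs j).
Proof.
move=> hj; suff H i : (i <= N - 1)%N ->
    gen (fun l => (N - i <= l)%N) (ops (iota (N - i) i) (e N)).
  have := H (N - j)%N; rewrite (_ : N - (N - j) = j)%N; last lia.
  by apply; lia.
elim: i => [|i IH] hi; first by apply: gen_e; rewrite ?IDE /=; lia.
rewrite /= (_ : (N - i.+1).+1 = N - i)%N; last lia.
have hID : ID n (N - i.+1) by rewrite IDE; lia.
by apply: gen_sub (op_gen hID _ (IH _)) => [l||]; lia.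
Qed.

Lemma QsE j : (2 <= j < N)%N -> Qs j = op j (Qs j.+1).
Proof. by move=> hj; rewrite /Qs (_ : N - j = (N - j.+1).+1)%N; last lia. Qed.

Lemma Qs_rec j : (2 <= j < N)%N -> Qs j = br (e j) (Qs j.+1).
Proof.
move=> hj; have [i Ei] : exists i, N = (j + i.+1)%N by exists (N - j.+1)%N; lia.
elim: i j hj Ei => [|i IH] j hj Ei.
  rewrite QsE // /Qs (_ : N - j.+1 = 0)%N /=; last lia.
  rewrite (ch_br C) //; [by rewrite IDE; lia|by rewrite IDE; lia|].
  by rewrite (_ : N = j.+1); [apply: adj_ge2; lia|lia].
rewrite QsE // IH; [|lia..].
have hID : ID n j by rewrite IDE; lia.
have hIDS : ID n j.+1 by rewrite IDE; lia.
have hg := Qs_gen (j := j.+2); rewrite op_br // (ch_br C) //; last by apply: adj_ge2; lia.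
rewrite [X in br _ X](op_id _ _ (hg _)) //; [|by move=> l hl /= h; move: hl h hj; id_tac|lia].
rewrite br_assoc //.
apply: (gen_comm (J := pred1 j)) (hg _); [|by apply: gen_e => /=|lia].
by move=> a b ha hb /= /eqP -> h; move: hb h hj; id_tac.
Qed.

Lemma zs_N : zs N = Qs 3. Proof. by []. Qed.

Lemma zs_split j : (3 <= j < N)%N -> zs N = br (zs j) (Qs j.+1).
Proof.
move=> hj; rewrite zs_N /Qs (_ : N - 3 = (j - 3) + (N - j))%N; last lia.
rewrite iotaD ops_cat (_ : 3 + (j - 3) = j)%N; last lia.
rewrite -/(Qs j) Qs_rec; last lia.
rewrite ops_br; last by apply: all_iota; lia.
congr (br _ _); apply: ops_id (Qs_gen (j := j.+1) _); last lia.
  by apply: all_iota; lia.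
by move=> m i; rewrite mem_iota => hm hi h; move: hm hi h hj; id_tac.
Qed.

Lemma desc_zs_split j : (3 <= j < N)%N ->
  ops (desc j.-1 0) (zs N) = br (ops (desc j.-1 0) (zs j)) (Qs j.+1).
Proof.
move=> hj; rewrite (zs_split hj) ops_br; last by apply: all_desc; lia.
congr (br _ _); apply: desc_below (Qs_gen (j := j.+1) _); [lia| |lia].
by move=> i hi h; lia.
Qed.

(** As e_1 and e_2 commute, they may be attached to x_2 in either order. *)
Lemma ys2E' : ys 2 = br (xs 1) (e 1).
Proof.
rewrite ys2E ys1E (xs_rec (j := 1)); last lia.
have H : e 1 * e 2 = e 2 * e 1 by apply: (ch_comm C); id_tac.
rewrite /qcomm; nc (tt, H).
Qed.

Lemma desc_lower a i : (1 <= a < i)%N -> (i <= n)%N -> ops (desc N a) (e i.+1) = e i.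
Proof.
move=> ha hi; have hID : ID n i by rewrite IDE; lia.
have hIDS : ID n i.+1 by rewrite IDE; lia.
have ai : adj n i i.+1 by apply: adj_ge2; lia.
have ai' : adj n i.+1 i by rewrite (adjC n3).
rewrite (@desc_cat N i.+1 a) ?(@desc_cat i.+1 i.-1 a) ?ops_cat //; try lia.
have -> : ops (desc i.-1 a) (e i.+1) = e i.+1.
  apply: (ops_id (J := pred1 i.+1)); [by apply: all_desc; lia| |by apply: gen_e => //=].
  by move=> m l; rewrite mem_desc => hm hl /= /eqP ->; move: hm ha hi; id_tac.
have -> : desc i.+1 i.-1 = [:: i.+1; i].
  by case: i ha hi {hID hIDS ai ai'} => [|i] ha hi; [lia|rewrite /= descS // desc1].
rewrite /= (ch_br C) // (ch_back C) //.
apply: (desc_above (J := pred1 i)); first lia.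
  by move=> l _ /= /eqP ->; split; lia.
by apply: gen_e => /=.
Qed.

Section Serre.
Hypothesis serre : forall i j, ID n i -> ID n j -> adj n i j ->
  e i * br (e j) (e i) = kap *: (br (e j) (e i) * e i).

Let com_ops s x y : all (ID n) s -> x * y = y * x -> ops s x * ops s y = ops s y * ops s x.
Proof.
move=> + H; elim: s => [//|m s IH] /= /andP[hm hs].
by have h := ch_hom C hm; rewrite -!(ahM h) IH.
Qed.

Let kcom_ops s x y : all (ID n) s -> x * y = kap *: (y * x) ->
  ops s x * ops s y = kap *: (ops s y * ops s x).
Proof.
move=> + H; elim: s => [//|m s IH] /= /andP[hm hs].
by have h := ch_hom C hm; rewrite -!(ahM h) IH // (ahZ h).
Qed.

Lemma xs_gen j : (1 <= j <= n)%N -> gen (fun l => (j < l)%N) (xs j).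
Proof.
move=> hj; suff H m : (j < m <= N)%N ->
    gen (fun l => (j < l <= m)%N) (ops (desc m j.+1) (e j.+1)).
  by apply: gen_sub (H N _) => [l|]; lia.
elim: m => [|m IH] hm; first by lia.
have [->|mj] := eqVneq m j.
  by rewrite desc_nil; apply: gen_e; rewrite ?IDE; lia.
rewrite descS; last lia.
have hID : ID n m.+1 by rewrite IDE; lia.
by apply: gen_sub (op_gen hID _ (IH _)) => [l||]; lia.
Qed.

(** For i < j no letter of x_j touches i. For i > j + 1, [desc_lower] writes e_i as the image of
    e_{i+1} under the prefix that carries e_{j+1} to x_j. *)
Lemma e_xs_comm i j : (1 <= i <= n)%N -> (1 <= j <= n)%N -> i != j -> i != j.+1 ->
  ~~ ((i == 1) && (j == 2))%N -> e i * xs j = xs j * e i.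
Proof.
move=> hi hj ij ijS i1; case: (ltnP i j) => lij.
  apply: (gen_comm (J := pred1 i)) (xs_gen hj); last by apply: gen_e; rewrite ?IDE /=; lia.
  by move=> a b ha hb /= /eqP -> h; move: hi hj ij ijS i1 lij hb h; id_tac.
have E : e i = ops (desc N j.+1) (e i.+1) by rewrite desc_lower //; lia.
rewrite {1}E [in RHS]E /xs; apply: com_ops; first exact: all_desc.
by apply: (ch_comm C); rewrite ?IDE; move: hi hj ij ijS i1 lij; id_tac.
Qed.

(** The letters above j + 2 fix e_{j+1}; stripping them reduces the claim to the q-Serre relation
    for e_{j+1} and e_{j+2}. *)
Lemma e_xs_kcomm j : (1 <= j < n)%N -> e j.+1 * xs j = kap *: (xs j * e j.+1).
Proof.
move=> hj; rewrite /xs desc_split ?ops_cat /=; last lia.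
have E : e j.+1 = ops (desc N j.+2) (e j.+1).
  rewrite (desc_above (J := pred1 j.+1)) //; first lia.
    by move=> l _ /= /eqP ->; split; lia.
  by apply: gen_e; rewrite ?IDE /=; lia.
rewrite {1 4}E; apply: kcom_ops; first exact: all_desc.
rewrite (ch_br C); [|by rewrite IDE; lia..|by rewrite (adjC n3); apply: adj_ge2; lia].
by apply: serre; [rewrite IDE; lia..|apply: adj_ge2; lia].
Qed.

Lemma e1_ys1 : e 1 * ys 1 = kap *: (ys 1 * e 1).
Proof.
rewrite ys1E /xs -(fix_above3 (i := 1)) // -ops_br; last exact: all_desc.
apply: kcom_ops; first exact: all_desc.
by apply: serre; id_tac.
Qed.

Lemma e_ys1_comm i : (3 <= i <= n)%N -> e i * ys 1 = ys 1 * e i.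
Proof.
move=> hi; have E : e i = ops (desc N 2) (e i.+1) by rewrite desc_lower //; lia.
have -> : ys 1 = ops (desc N 2) (e 1).
  rewrite /ys /= (@desc_cat N 2 1) //; last lia.
  by rewrite ops_cat (_ : desc 2 1 = [:: 2]) //= (ch_fix C) //; id_tac.
rewrite {1}E [in RHS]E; apply: com_ops; first exact: all_desc.
by apply: (ch_comm C); rewrite ?IDE; move: hi; id_tac.
Qed.

Lemma ys_zs j : (2 <= j)%N -> ys j = ops (desc N 0) (zs j.+1).
Proof. by move=> hj; rewrite /ys ifF //; lia. Qed.

Lemma e_ys_kcomm j : (3 <= j <= n)%N -> e j * ys j = kap *: (ys j * e j).
Proof.
move=> hj; rewrite -(theta hj) ys_zs; last lia.
apply: kcom_ops; first exact: all_desc.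
have E : e j.+1 = ops (iota 3 (j - 3)) (e j.+1).
  rewrite (ops_id (J := pred1 j.+1)) //; first by apply: all_iota; lia.
    by move=> m l; rewrite mem_iota => hm hl /= /eqP ->; move: hm hj; id_tac.
  by apply: gen_e; rewrite ?IDE /=; lia.
rewrite /zs iota3_last ?ops_cat ?succnK /=; last lia.
rewrite (ch_br C); [|by rewrite IDE; lia..|by apply: adj_ge2; lia].
rewrite {1 4}E; apply: kcom_ops; first by apply: all_iota; lia.
by apply: serre; [rewrite IDE; lia..|rewrite (adjC n3); apply: adj_ge2; lia].
Qed.

(** Stripping the descending factor by [theta] replaces e_i by e_{i+1}. This lies beyond the letters
    of [zs] if i > j; if i < j it is the image of e_i under the ascending factor, which can be
    stripped as well. *)
Lemma e_ys_comm i j : (3 <= i <= n)%N -> (2 <= j <= n)%N -> i != j -> i != j.+1 ->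
  e i * ys j = ys j * e i.
Proof.
move=> hi hj ij ijS; rewrite -(theta hi) ys_zs; last lia.
apply: com_ops; first exact: all_desc.
case: (ltnP i j) => lij; last first.
  apply: (gen_comm (J := pred1 i.+1)) (zs_gen (t := j.+1) _); last lia.
    by move=> a b ha hb /= /eqP -> h; move: hi hj ij ijS lij hb h; id_tac.
  by apply: gen_e; rewrite ?IDE /=; lia.
have E : e i.+1 = ops (iota 3 (j.+1 - 3)) (e i).
  rewrite (_ : j.+1 - 3 = (i - 3) + (2 + (j - i.+1)))%N; last lia.
  rewrite !iotaD !ops_cat (_ : 3 + (i - 3) = i)%N; last lia.
  rewrite (ops_id (J := pred1 i) (x := e i)); first last.
  - by apply: gen_e; rewrite ?IDE /=; lia.
  - by move=> m l; rewrite mem_iota => hm hl /= /eqP ->; move: hm hi; id_tac.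
  - by apply/allP => l; rewrite mem_iota IDE; lia.
  have ai : adj n i i.+1 by apply: adj_ge2; lia.
  rewrite /= (ch_br C); [|by rewrite IDE; lia..|by rewrite (adjC n3)].
  rewrite (ch_back C); [|by rewrite IDE; lia..|by []].
  rewrite (ops_id (J := pred1 i.+1)) //; first by apply: all_iota; lia.
    by move=> m l; rewrite mem_iota => hm hl /= /eqP ->; move: hm hi; id_tac.
  by apply: gen_e; rewrite ?IDE /=; lia.
rewrite E /zs; apply: com_ops; first by apply: all_iota; lia.
by apply: (ch_comm C); rewrite ?IDE; move: hi hj ij ijS lij; id_tac.
Qed.

Lemma e12_ys_comm i j : (1 <= i <= 2)%N -> (3 <= j <= n)%N -> e i * ys j = ys j * e i.
Proof.
move=> hi hj.
(* By [wD_e12], e_i is the image of the other end letter under w_n, and the letters from 4 on drop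
   out. Then e_i and y_j share the descending factor and the operator 3. *)
have [i' [hi' E]] : exists i', (1 <= i' <= 2)%N /\ e i = ops (desc N 0) (op 3 (e i')).
  have E4 l : (1 <= l <= 2)%N -> ops (iota 4 (n - 2)) (e l) = e l.
    move=> hl; apply: (ops_id (J := pred1 l)).
    - by apply/allP => m; rewrite mem_iota IDE; lia.
    - by move=> a b; rewrite mem_iota => ha hb /= /eqP ->; move: hl ha; id_tac.
    - by apply: gen_e; rewrite ?IDE /=; lia.
  have W l : (1 <= l <= 2)%N -> ops (wD n) (e l) = ops (desc N 0) (op 3 (e l)).
    move=> hl; rewrite wDE ops_cat (_ : n - 1 = 1 + (n - 2))%N; last lia.
    by rewrite iotaD ops_cat E4.
  have [W1 W2 _ _] := wD_e12.
  case: i hi => [|[|[|i]]] // _; [exists 2%N|exists 1%N].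
    by rewrite -W ?W2.
  by rewrite -W ?W1.
rewrite {1}E [in RHS]E ys_zs; last lia.
apply: com_ops; first exact: all_desc.
rewrite /zs (_ : j.+1 - 3 = (j - 3).+1)%N /=; last lia.
have hID : ID n 3 by rewrite IDE; lia.
have h := ch_hom C hID; rewrite -!(ahM h); congr (op 3 _).
have hg : gen (fun l => (4 <= l)%N) (ops (iota 4 (j - 3)) (e j.+1)).
  suff H m : (m <= j - 3)%N ->
      gen (fun l => (j.+1 - m <= l)%N) (ops (iota (j.+1 - m) m) (e j.+1)).
    have := H (j - 3)%N; rewrite (_ : j.+1 - (j - 3) = 4)%N; last lia.
    by apply.
  elim: m => [|m IH] hm; first by apply: gen_e; rewrite ?IDE /=; lia.
  rewrite /= (_ : (j.+1 - m.+1).+1 = j.+1 - m)%N; last lia.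
  have hIm : ID n (j.+1 - m.+1) by rewrite IDE; lia.
  by apply: gen_sub (op_gen hIm _ (IH _)) => [l||]; lia.
apply: (gen_comm (J := pred1 i')) hg; last by apply: gen_e; rewrite ?IDE /=; lia.
by move=> a b ha hb /= /eqP -> h4; move: hi' hb h4; id_tac.
Qed.

Lemma e2_ys2 : e 2 * ys 2 = kap *: (ys 2 * e 2).
Proof.
rewrite ys2E'.
have H0 : (1 <= 1 < n)%N by lia.
have H1 := e_xs_kcomm H0.
have H2 : e 2 * e 1 = e 1 * e 2 by apply: (ch_comm C); id_tac.
rewrite /qcomm; nc (tt, H1, H2).
Qed.

Lemma e1_ys2 : e 1 * ys 2 = kap *: (ys 2 * e 1).
Proof.
rewrite ys2E; have H1 := e1_ys1.
have H2 : e 1 * e 2 = e 2 * e 1 by apply: (ch_comm C); id_tac.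
rewrite /qcomm; nc (tt, H1, H2).
Qed.

End Serre.
End Chain.

(** * Words of operators that preserve a predicate *)

Section OpsPos.
Variables (A : Type) (P : A -> Prop) (op : nat -> A -> A).

Fixpoint posP (s : seq nat) (x : A) : Prop :=
  match s with
  | [::] => P x
  | i :: s' => posP s' x /\ P (ops op s x)
  end.

Lemma posP_gen s x : posP s x -> P (ops op s x).
Proof. by case: s => [|i s] //= []. Qed.

Lemma posP_cat s1 s2 x : posP (s1 ++ s2) x <-> posP s2 x /\ posP s1 (ops op s2 x).
Proof.
elim: s1 => [|i s IH] /=; first by split=> [h|[]//]; split=> //; apply: posP_gen h.
by rewrite ops_cat IH; split=> [[[h1 h2] h3]|[h1 [h2 h3]]].
Qed.
End OpsPos.

Lemma ops_map (A : Type) (op : nat -> A -> A) p s x :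
  ops op (map p s) x = ops (fun i => op (p i)) s x.
Proof. by elim: s => [|i s IH] //=; rewrite IH. Qed.

Lemma eq_ops (A : Type) (op op' : nat -> A -> A) s x :
  (forall i y, i \in s -> op i y = op' i y) -> ops op s x = ops op' s x.
Proof.
elim: s => [|i s IH] //= H; rewrite IH => [|j y hj]; first by apply: H; rewrite inE eqxx.
by apply: H; rewrite inE hj orbT.
Qed.

Lemma ops_rcons (A : Type) (op : nat -> A -> A) s i x : ops op (rcons s i) x = ops op s (op i x).
Proof. by rewrite -cats1 ops_cat. Qed.

Lemma ops_hom (k : fieldType) (A : algType k) (op : nat -> A -> A) s :
  (forall i, i \in s -> alg_hom (op i)) -> alg_hom (ops op s).
Proof.
elim: s => [|i s IH] H; first exact: alg_hom_id.
apply: alg_hom_comp; first by apply: H; rewrite inE eqxx.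
by apply: IH => j hj; apply: H; rewrite inE hj orbT.
Qed.

Definition sw (n : nat) (s : seq nat) (mu : W n) : W n := foldr (fun i la => sref i la) mu s.

(** * Instances of chains in a quantum group *)

Section Inst.
Variables (k : fieldType) (q : k) (n : nat) (I : nat -> bool) (inL : W n -> bool).
Hypotheses (q0 : q != 0) (q2 : q * q - 1 != 0) (n3 : (3 <= n)%N).
Hypothesis HI : root_datum I inL.
Variables (U : algType k) (E F : nat -> U) (K : W n -> U).
Hypothesis HU : is_QG q I inL E F K.
Let HR : qg_rels q I inL E F K := proj1 HU.
Variable T : nat -> U -> U.
Hypothesis HT : lusztig q I inL E F K T.
Notation al := (alpha n).

Section Letters.
Variable p : nat -> nat.
Hypotheses (pI : forall i, ID n i -> I (p i))
  (padj : forall i j, ID n i -> ID n j -> adj n (p i) (p j) = adj n i j)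
  (pinj : forall i j, ID n i -> ID n j -> i != j -> p i != p j).

(** The relabelling [p] embeds the finite diagram into that of [I]. It is the identity in some uses,
    and [p0map] when E_0 takes the place of E_{n+1}. *)
Lemma chain_T : chain n q^-1 (fun i => E (p i)) (fun i => T (p i)).
Proof.
split=> [i hi|i j hi hj ij a|i j hi hj a|i j hi hj a|i j hi hj ij a].
- exact: T_hom HT _ (pI hi).
- by rewrite (T_Ej n3 HI HT (pI hi) (pI hj)) ?padj ?(negPf a) // pinj // eq_sym.
- by rewrite (T_Eadj n3 HI HT (pI hi) (pI hj)) ?padj.
- by rewrite -[qcomm _ _ _]/(qbr q _ _) (T_back q0 q2 n3 HI HU HT (pI hi) (pI hj)) ?padj.
- by apply: (qg_Ecomm n3 HI HR); rewrite ?pI ?padj ?pinj.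
Qed.

Lemma chain_serre i j : ID n i -> ID n j -> adj n i j ->
  E (p i) * qcomm q^-1 (E (p j)) (E (p i)) =
  q^-1 *: (qcomm q^-1 (E (p j)) (E (p i)) * E (p i)).
Proof.
move=> hi hj a; have := qg_Eserre q0 n3 HI HR (pI hi) (pI hj).
rewrite padj // => /(_ a) H; rewrite /qcomm; nc (tt, H).
Qed.

Variables (S' S : nat -> U -> U).
Hypothesis HS : forall i, I i -> is_proper_inverse q I inL E F K T i (S' i) (S i).

Lemma chain_S : chain n q (fun i => F (p i)) (fun i => S (p i)).
Proof.
split=> [i hi|i j hi hj ij a|i j hi hj a|i j hi hj a|i j hi hj ij a].
- by case: (HS (pI hi)).
- case: (HS (pI hi)) => _ _ _ _ [_ _ _ H _]; rewrite H ?pI ?padj ?(negPf a) //.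
  by rewrite pinj // eq_sym.
- case: (HS (pI hi)) => _ _ _ _ [_ _ _ H _]; rewrite H ?pI ?padj ?a //.
  by rewrite pinj // eq_sym (adj_neq n3 a).
- have aji : j != i by rewrite eq_sym (adj_neq n3 a).
  case: (HS (pI hi)) => _ h _ _ [_ H1 _ H2 _].
  rewrite /qcomm (ahB h) (ahZ h) !(ahM h) H1 H2 ?pI ?pinj // padj // a.
  have a' : adj n (p i) (p j) by rewrite padj.
  apply: (pair_SG q0 q2 (qg_pair n3 HI HR (pI hi) (pI hj) a')).
    by apply: (qg_Eserre q0 n3 HI HR) => //; apply: pI.
  by apply: (qg_Fserre q0 n3 HI HR) => //; apply: pI.
- by apply: (qg_Fcomm n3 HI HR); rewrite ?pI ?padj ?pinj.
Qed.

End Letters.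

Definition GE : U -> Prop := gen_alg (fun x => exists i, I i /\ x = E i).

Lemma GE_E i : I i -> GE (E i).
Proof. by move=> hi; apply: ga_gen; exists i. Qed.

Definition hasw (z : U) (b : W n) : Prop :=
  forall mu, inL mu -> K mu * z = q ^ (ip mu b) *: (z * K mu).

Lemma hasw_E i : I i -> hasw (E i) (al i).
Proof. by move=> hi mu hm; rewrite (qg_KE HR). Qed.

Lemma hasw_mul x y a b : hasw x a -> hasw y b -> hasw (x * y) (a + b).
Proof.
move=> hx hy mu hm; have e1 := hx mu hm; have e2 := hy mu hm.
rewrite ipDr expfzDr //; nc (tt, e1, e2).
Qed.

Lemma hasw_add x y a : hasw x a -> hasw y a -> hasw (x + y) a.
Proof. by move=> hx hy mu hm; rewrite mulrDr hx // hy // -scalerDr mulrDl. Qed.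

Lemma hasw_scale (c : k) x a : hasw x a -> hasw (c *: x) a.
Proof. by move=> hx mu hm; rewrite -scalerAr hx // -scalerAl !scalerA mulrC. Qed.

Lemma hasw_br kap x y a b : hasw x a -> hasw y b -> hasw (qcomm kap x y) (a + b).
Proof.
move=> hx hy; apply: hasw_add; first exact: hasw_mul.
by rewrite -scaleNr; apply: hasw_scale; rewrite addrC; apply: hasw_mul.
Qed.

Lemma hasw_T i x a : I i -> hasw x a -> hasw (T i x) (sref i a).
Proof.
move=> hi hx mu hm; have h := T_hom HT hi; have hs := rd_sref HI hi hm.
have -> : K mu = T i (K (sref i mu)) by rewrite (T_K HT) // srefK ?(rd_le HI hi).
by rewrite -!(ahM h) hx // (ahZ h) ip_sref ?(rd_le HI hi).
Qed.

Lemma hasw_ops s x a : all I s -> hasw x a -> hasw (ops T s x) (sw s a).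
Proof.
by move=> + hx; elim: s => [//|i s IH] /= /andP[hi hs]; apply: hasw_T => //; apply: IH.
Qed.

Section Undo.
Variables (S' S : nat -> U -> U).
Hypothesis HS : forall i, I i -> is_proper_inverse q I inL E F K T i (S' i) (S i).

Lemma S_hom i : I i -> alg_hom (S i). Proof. by move=> hi; case: (HS hi). Qed.
Lemma S'_hom i : I i -> alg_hom (S' i). Proof. by move=> hi; case: (HS hi). Qed.

(** Limited to the positive part, because [S i] is known to undo [T i] on the E's. *)
Lemma S_T i z : I i -> GE z -> S i (T i z) = z.
Proof.
move=> hi; apply: (ga_eq (alg_hom_comp (S_hom hi) (T_hom HT hi)) (@alg_hom_id _ U)).
by move=> _ [j [hj ->]]; case: (HS hi) => _ _ _ ->.
Qed.

Lemma ops_S_T s z : all I s -> posP GE T s z -> ops S (rev s) (ops T s z) = z.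
Proof.
elim: s => [//|i s IH] /= /andP[hi hs] [h1 h2].
by rewrite rev_cons ops_rcons S_T ?IH //; apply: posP_gen h1.
Qed.

Lemma ops_S'_S s z : all I s -> ops S' s (ops S (rev s) z) = z.
Proof.
elim: s z => [//|i s IH] z /= /andP[hi hs].
rewrite rev_cons ops_rcons IH //.
by case: (HS hi) => _ _ ->.
Qed.
End Undo.

Lemma pos_posP p s x : (forall i, ID n i -> I (p i)) ->
  pos n (fun i => E (p i)) (fun i => T (p i)) s x ->
  posP GE T (map p s) x.
Proof.
move=> hp; have sub y : gen n (fun i => E (p i)) xpredT y -> GE y.
  by apply: ga_sub => _ [i [hi _ ->]]; apply/GE_E/hp.
elim: s => [|i s IH] /=; first exact: sub.
by move=> [/IH h1 h2]; split=> //; rewrite ops_map; apply: sub.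
Qed.

End Inst.

(** * The words w_n and \hat w_n *)
Section WordsD.
Variable n : nat.
Hypothesis n3 : (3 <= n)%N.
Notation N := n.+1.

Lemma size_desc m j : size (desc m j) = (m - j)%N.
Proof. by rewrite size_map size_iota. Qed.

Lemma size_wD : size (wD n) = (2 * n)%N.
Proof. by rewrite wDE size_cat size_desc size_iota; lia. Qed.

Lemma wD_cut1 t : (1 <= t <= N)%N -> wD n = desc N t ++ t :: (desc t.-1 0 ++ iota 3 (n - 1)).
Proof.
move=> ht; rewrite wDE (@desc_cat N t 0) ?leq0n //; last lia.
by case: t ht => // t _; rewrite -catA; congr (_ ++ _); rewrite (descS (j := 0)).
Qed.

Lemma wD_cut2 t : (3 <= t <= N)%N ->
  wD n = (desc N 0 ++ iota 3 (t - 3)) ++ t :: iota t.+1 (N - t).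
Proof.
move=> ht; rewrite wDE -catA; congr (_ ++ _).
rewrite (_ : n - 1 = (t - 3) + (N - t).+1)%N; last lia.
by rewrite iotaD /= (_ : 3 + (t - 3) = t)%N //; lia.
Qed.

Lemma take_cut (A : Type) (s1 s2 : seq A) (a : A) l : l = size s1 ->
  take l (s1 ++ a :: s2) = s1.
Proof. by move=> ->; rewrite take_size_cat. Qed.

Lemma nth_cut (s1 s2 : seq nat) (a : nat) l : l = size s1 ->
  nth 0%N (s1 ++ a :: s2) l = a.
Proof. by move=> ->; rewrite nth_cat ltnn subnn. Qed.

Lemma wD_cases l : (l < 2 * n)%N -> exists s1 t s2,
  [/\ wD n = s1 ++ t :: s2, l = size s1 &
      ((1 <= t <= N)%N /\ s1 = desc N t /\ s2 = desc t.-1 0 ++ iota 3 (n - 1)) \/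
      ((3 <= t <= N)%N /\ s1 = desc N 0 ++ iota 3 (t - 3) /\ s2 = iota t.+1 (N - t))].
Proof.
move=> hl; case: (ltnP l N) => lN.
  exists (desc N (N - l)), (N - l)%N, (desc (N - l).-1 0 ++ iota 3 (n - 1)).
  split; [by apply: wD_cut1; lia|by rewrite size_desc; lia|left].
  by split=> //; lia.
pose t := (l - N + 3)%N; exists (desc N 0 ++ iota 3 (t - 3)), t, (iota t.+1 (N - t)).
have ht : (3 <= t <= N)%N by rewrite /t; lia.
split; [exact: wD_cut2|by rewrite size_cat size_desc size_iota /t; lia|by right].
Qed.

Section RootVec.
Variables (k : fieldType) (U : algType k) (T : nat -> U -> U) (E : nat -> U).

Lemma root_vecE s1 t s2 : root_vec T E (s1 ++ t :: s2) (size s1) = ops T s1 (E t).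
Proof. by rewrite /root_vec take_cut // nth_cut. Qed.

Lemma root_vec_x i : (1 <= i <= n)%N -> root_vec T E (wD n) (n - i) = xs n E T i.
Proof.
move=> hi; rewrite (wD_cut1 (t := i.+1)); last lia.
by rewrite (_ : n - i = size (desc N i.+1))%N ?root_vecE // size_desc; lia.
Qed.

Lemma root_vec_y i : (1 <= i <= n)%N -> root_vec T E (wD n) (n + i - 1) = ys n E T i.
Proof.
move=> hi; rewrite /ys; case: eqP => [->|/eqP i1].
  rewrite (wD_cut1 (t := 1)) // (_ : n + 1 - 1 = size (desc N 1))%N ?root_vecE //.
  by rewrite size_desc; lia.
rewrite (wD_cut2 (t := i.+1)); last lia.
rewrite (_ : n + i - 1 = size (desc N 0 ++ iota 3 (i.+1 - 3)))%N ?root_vecE ?ops_cat //.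
by rewrite size_cat size_desc size_iota; lia.
Qed.

Lemma root_vec_xy l : (l < 2 * n)%N -> exists i, (1 <= i <= n)%N /\
  (root_vec T E (wD n) l = xs n E T i \/ root_vec T E (wD n) l = ys n E T i).
Proof.
move=> hl; case: (ltnP l n) => ln.
  exists (n - l)%N; split; first lia; left.
  by rewrite -root_vec_x; [congr (root_vec _ _ _ _)|]; lia.
exists (l - n).+1; split; first lia; right.
by rewrite -root_vec_y; [congr (root_vec _ _ _ _)|]; lia.
Qed.

End RootVec.

(* The affine diagram symmetry that turns [wD n] into the second half of [wA n]. *)
Definition aswap (i : nat) : nat :=
  if i == N then 0%N else if i == 0%N then N else if i == 1%N then 2 else if i == 2 then 1%N else i.
(** The nodes 1, .., n together with 0 in place of n + 1 again form a diagram of type D_{n+1}; [s12]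
    is the symmetry of the fork at node 3. *)
Definition p0map (i : nat) : nat := if i == N then 0%N else i.
Definition s12 (i : nat) : nat := if i == 1%N then 2 else if i == 2 then 1%N else i.

Lemma aswapP i : [\/ i = N /\ aswap i = 0%N, i = 0%N /\ aswap i = N,
  (1 <= i <= 2)%N /\ aswap i = (3 - i)%N | (3 <= i)%N /\ i <> N /\ aswap i = i].
Proof.
rewrite /aswap; case: eqP => [->|h1]; first by constructor 1.
case: eqP => [->|h2]; first by constructor 2.
case: eqP => [->|h3]; first by constructor 3.
by case: eqP => [->|h4]; [constructor 3|constructor 4; lia].
Qed.

Lemma p0mapP i : (i = N /\ p0map i = 0%N) \/ (i <> N /\ p0map i = i).
Proof. by rewrite /p0map; case: eqP => h; [left|right]. Qed.

Lemma s12P i : ((1 <= i <= 2)%N /\ s12 i = (3 - i)%N) \/ (~~ (1 <= i <= 2)%N /\ s12 i = i).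
Proof.
rewrite /s12; case: eqP => [->|h1]; first by left.
by case: eqP => [->|h2]; [left|right; lia].
Qed.

Lemma aswapK i : (i <= N)%N -> aswap (aswap i) = i.
Proof. by move=> hi; case: (aswapP i); case: (aswapP (aswap i)); lia. Qed.

Lemma aswap_le i : (i <= N)%N -> (aswap i <= N)%N.
Proof. by move=> hi; case: (aswapP i); lia. Qed.

Lemma adj_0 i : (i <= N)%N -> adj n 0 i = (i == n).
Proof. rewrite /adj /=; lia. Qed.

Lemma adj_N i : (i <= n)%N -> adj n N i = (i == n).
Proof. rewrite /adj /=; lia. Qed.

Lemma adj_12 i j : (1 <= i <= 2)%N -> (j <= n)%N -> adj n i j = (j == 3).
Proof. by case: i => [|[|[|i]]] // _; rewrite /adj /=; lia. Qed.

Lemma s12_adj i j : ID n i -> ID n j -> adj n (s12 i) (s12 j) = adj n i j.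
Proof.
move=> /andP[i0 hi] /andP[j0 hj].
case: (s12P i) => [] [E1 ->]; case: (s12P j) => [] [E2 ->] //.
- by rewrite !adj_12 //; lia.
- have [->|jN] := eqVneq j N; last by rewrite !adj_12 //; lia.
  by rewrite !(adjC n3 _ N) !adj_N; lia.
- have [->|iN] := eqVneq i N; first by rewrite !adj_N; lia.
  by rewrite !(adjC n3 i) !adj_12 //; lia.
Qed.

Lemma p0map_adj i j : ID n i -> ID n j -> adj n (p0map i) (p0map j) = adj n i j.
Proof.
move=> /andP[i0 hi] /andP[j0 hj].
case: (p0mapP i) => [] [E1 ->]; case: (p0mapP j) => [] [E2 ->] //.
- by rewrite E1 E2 !adj_irr.
- by rewrite E1 adj_0 ?adj_N //; lia.
- by rewrite E2 (adjC n3 i 0) (adjC n3 i N) adj_0 ?adj_N //; lia.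
Qed.

Lemma p0map_IA i : ID n i -> IA n (p0map i).
Proof. by move=> /andP[_ hi]; rewrite /p0map; case: ifP. Qed.

Lemma p0map_inj i j : ID n i -> ID n j -> i != j -> p0map i != p0map j.
Proof.
clear n3; move=> /andP[h1 h2] /andP[h3 h4] ij.
by case: (p0mapP i) => [] [e1 ->]; case: (p0mapP j) => [] [e2 ->]; lia.
Qed.

Lemma p0map_id i : i != N -> p0map i = i.
Proof. by move=> h; rewrite /p0map (negPf h). Qed.

Lemma aswap_s12 i : (1 <= i <= n)%N -> aswap i = s12 i.
Proof. by move=> hi; rewrite /aswap; do 2![rewrite ifF; last lia]. Qed.

Lemma aswap_adj i j : (i <= N)%N -> (j <= N)%N -> adj n (aswap i) (aswap j) = adj n i j.
Proof.
have s12_n l : (1 <= l <= n)%N -> (s12 l == n) = (l == n) by case: (s12P l) => [] [h ->]; lia.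
have s12_le l : (1 <= l <= n)%N -> (1 <= s12 l <= n)%N by case: (s12P l) => [] [h ->]; lia.
have p0 : aswap 0 = N by rewrite /aswap; case: eqP.
have pN : aswap N = 0%N by rewrite /aswap eqxx.
have H0 l m : (l == 0)%N || (l == N) -> (1 <= m <= n)%N -> adj n (aswap l) (aswap m) = adj n l m.
  move=> hl hm; rewrite (aswap_s12 hm); have := s12_le m hm.
  case/orP: hl => /eqP ->; rewrite ?p0 ?pN => hs.
    by rewrite adj_N ?adj_0 ?s12_n //; lia.
  by rewrite adj_0 ?adj_N ?s12_n //; lia.
have H1 l m : (l == 0)%N || (l == N) -> (m == 0)%N || (m == N) -> adj n (aswap l) (aswap m) = adj n l m.
  by move=> /orP[] /eqP -> /orP[] /eqP ->; rewrite ?p0 ?pN ?adj_irr ?adj_0 // (adjC n3 N) adj_0.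
move=> hi hj.
have ci : (i == 0)%N || (i == N) \/ (1 <= i <= n)%N by lia.
have cj : (j == 0)%N || (j == N) \/ (1 <= j <= n)%N by lia.
case: ci cj => ci [] cj; [exact: H1|exact: H0|by rewrite (adjC n3) (adjC n3 i) H0|].
by rewrite !aswap_s12 // s12_adj // IDE; lia.
Qed.

Lemma map_desc p m j : (forall i, (j < i <= m)%N -> p i = i) -> map p (desc m j) = desc m j.
Proof. by move=> H; rewrite -[RHS]map_id; apply/eq_in_map => i; rewrite mem_desc => /H. Qed.

Lemma map_iota p m j : (forall i, (m <= i < m + j)%N -> p i = i) -> map p (iota m j) = iota m j.
Proof. by move=> H; rewrite -[RHS]map_id; apply/eq_in_map => i; rewrite mem_iota => /H. Qed.

Lemma wD_word : wD n = N :: desc n 2 ++ [:: 2; 1] ++ iota 3 (n - 2) ++ [:: N].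
Proof.
rewrite wDE descS // (@desc_cat n 2 0) //; last lia.
rewrite (_ : n - 1 = (n - 2) + 1)%N; last lia.
by rewrite iotaD (_ : 3 + (n - 2) = N)%N ?catA //; lia.
Qed.

Lemma wAE : wA n = wD n ++ map aswap (wD n).
Proof.
rewrite /wA; congr (_ ++ _).
have -> : [seq (n - j)%N | j <- iota 0 (n - 2)] = desc n 2 by [].
rewrite wD_word map_cons !map_cat map_desc; last by move=> i hi; case: (aswapP i); lia.
rewrite map_iota; last by move=> i hi; case: (aswapP i); lia.
(* The symmetry turns the middle block 2, 1 of w_n into 1, 2, which merges with the ascending run
   that follows. *)
have -> : iota 1 n = [:: 1%N; 2] ++ iota 3 (n - 2).
  by rewrite {1}(_ : n = 2 + (n - 2))%N ?iotaD //; lia.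
have -> : aswap N = 0%N by rewrite /aswap eqxx.
have -> : map aswap [:: 2; 1%N] = [:: 1%N; 2].
  have p2 : aswap 2 = 1%N by case: (aswapP 2) => [] [h E]; move: h E; lia.
  have p1 : aswap 1 = 2%N by case: (aswapP 1) => [] [h E]; move: h E; lia.
  by rewrite !map_cons p1 p2.
by have -> : map aswap [:: N] = [:: 0%N] by rewrite /= /aswap eqxx.
Qed.

End WordsD.

(** * Weights under w_n and under the diagram symmetry *)

Section Coord.
Variable n : nat.
Hypothesis n3 : (3 <= n)%N.
Notation N := n.+1.
Notation ec := (ecoord n).

Lemma sref_e i j : (2 <= i <= N)%N -> (1 <= j <= N)%N ->
  sref i (ec j) = if j == i then ec i.-1 else if j == i.-1 then ec i else ec j.
Proof.
move=> hi hj; rewrite /sref alpha_ge2; last lia.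
rewrite ipDr ipNr !ip_ecoord; try lia.
have [->|ji] := eqVneq j i.
  by rewrite (_ : (i == i.-1) = false) ?subr0 ?mulr1z ?opprB 1?addrC ?subrK //; lia.
have [->|ji'] := eqVneq j i.-1.
  by rewrite sub0r mulrN1z opprK addrC subrK.
by rewrite /= subrr mulr0z subr0.
Qed.

Lemma sref_delta i : sref i (delta n) = delta n.
Proof. by rewrite /sref ipC ip_delta mulr0z subr0. Qed.

Lemma sref_1 j : (3 <= j <= N)%N -> sref 1 (ec j) = ec j.
Proof.
move=> hj; rewrite /sref /alpha /= ipDr !ip_ecoord; try lia.
rewrite (_ : (j == 1%N) = false); last lia.
by rewrite (_ : (j == 2) = false) ?addr0 ?mulr0z ?subr0 //; lia.
Qed.

Lemma sref_12 : sref 1 (ec 2) = - ec 1.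
Proof.
rewrite /sref /alpha /= ipDr !ip_ecoord; try lia.
by rewrite (_ : _ + _ = 1 :> int) // mulr1z opprD addrCA subrr addr0.
Qed.

Lemma sref_e_id i j : (2 <= i <= N)%N -> (1 <= j <= N)%N -> j != i -> j != i.-1 ->
  sref i (ec j) = ec j.
Proof. by move=> hi hj h1 h2; rewrite sref_e // (negPf h1) (negPf h2). Qed.

Lemma sref_e_i i : (2 <= i <= N)%N -> sref i (ec i) = ec i.-1.
Proof. by move=> hi; rewrite sref_e ?eqxx //; lia. Qed.

Lemma sref_e_p i : (2 <= i <= N)%N -> sref i (ec i.-1) = ec i.
Proof.
move=> hi; rewrite sref_e ?eqxx //; last lia.
by case: eqP => [E|//]; lia.
Qed.

Lemma sw_cat s1 s2 (mu : W n) : sw (s1 ++ s2) mu = sw s1 (sw s2 mu).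
Proof. by rewrite /sw foldr_cat. Qed.

Lemma sw_Qs j : (3 <= j <= N)%N -> sw (iota j (N - j)) (alpha n 0) = delta n - ec N - ec j.-1.
Proof.
move=> hj; have [i Ei] : exists i, N = (j + i)%N by exists (N - j)%N; lia.
elim: i j hj Ei => [|i IH] j hj Ei.
  have -> : j = N by lia.
  by rewrite subnn /= /alpha /=.
have -> : (N - j = (N - j.+1).+1)%N by lia.
have H : sw (iota j.+1 (N - j.+1)) (alpha n 0) = delta n - ec N - ec j by apply: IH; lia.
rewrite [iota _ _]/= /sw /= -/(sw _ _) H.
rewrite !srefD !srefN sref_delta sref_e_i; last lia.
by rewrite sref_e_id //; lia.
Qed.

Lemma sw_cons i s (mu : W n) : sw (i :: s) mu = sref i (sw s mu). Proof. by []. Qed.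

(** As delta is orthogonal to everything, the image of E_0 under T_{w_n} pairs with weights exactly
    as E_{n+1} does. *)
Lemma sw_wD : sw (wD n) (alpha n 0) = alpha n N + delta n.
Proof.
have E1 : sref N (alpha n 0) = alpha n 0.
  rewrite /alpha /= !srefD !srefN sref_delta sref_e_i ?sref_e_p //; try lia.
  by rewrite -!addrA [- ec n - _]addrC.
have H m : (2 <= m <= n)%N -> sw (desc m 2) (delta n - ec N + ec 2) = delta n - ec N + ec m.
  elim: m => [//|m IH] hm; have [->|m1] := eqVneq m 1%N; first by rewrite desc_nil.
  rewrite descS ?sw_cons ?IH; try lia.
  rewrite !srefD !srefN sref_delta sref_e_id; try lia.
  by rewrite (sref_e_p (i := m.+1)) //; lia.
rewrite wD_word // -cat_cons !sw_cat sw_cons [sw [:: N] _]/= E1.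
have -> : (n - 2 = N - 3)%N by lia.
rewrite sw_Qs; last lia.
have -> : sw [:: 2; 1%N] (delta n - ec N - ec 2) = delta n - ec N + ec 2.
  have -> : sw [:: 2; 1%N] (delta n - ec N - ec 2) = sref 2 (delta n - ec N + ec 1).
    rewrite !sw_cons [sw [::] _]/=; congr sref.
    by rewrite 2!(srefD 1) 2!(srefN 1) sref_delta sref_12 opprK sref_1 //; lia.
  rewrite 2!(srefD 2) (srefN 2) sref_delta sref_e_id; try lia.
  by rewrite (sref_e_p (i := 2)) //; lia.
rewrite H; last lia.
rewrite !srefD !srefN sref_delta sref_e_i; last lia.
rewrite (sref_e_p (i := N)); last lia.
rewrite alpha_ge2; last lia.
by rewrite [in RHS]addrC addrA addrAC.
Qed.

(* The linear map on weights induced by the diagram symmetry [aswap]. *)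
Definition cmap (mu : W n) : W n :=
  mu - ec 1 *~ (2 * ip mu (ec 1)) - ec N *~ (2 * ip mu (ec N)) + delta n *~ ip mu (ec N).

Lemma cmapD mu la : cmap (mu + la) = cmap mu + cmap la.
Proof.
rewrite /cmap !ipDl !mulrDr !mulrzDr !opprD.
by rewrite (addrACA mu la) (addrACA (mu - _)) (addrACA (mu - _ - _)).
Qed.

Lemma cmapN mu : cmap (- mu) = - cmap mu.
Proof. by rewrite /cmap !ipNl !mulrN !mulrNz !opprD !opprK. Qed.

Lemma cmap0 : cmap 0 = 0.
Proof. by rewrite /cmap !ip0l !mulr0 !mulr0z !subr0 addr0. Qed.

Lemma cmap_e1 : cmap (ec 1) = - ec 1.
Proof.
rewrite /cmap !ip_ecoord; try lia.
rewrite (_ : (1%N == N) = false) ?eqxx; last lia.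
rewrite mulr1 mulr0 !mulr0z subr0 addr0 (_ : 2 = 1 + 1) // mulrzDr mulr1z opprD addrA.
by rewrite subrr sub0r.
Qed.

Lemma cmap_eN : cmap (ec N) = delta n - ec N.
Proof.
rewrite /cmap !ip_ecoord; try lia.
rewrite (_ : (N == 1%N) = false) ?eqxx; last lia.
rewrite mulr1 mulr0 mulr0z subr0 (_ : 2 = 1 + 1) // mulrzDr mulr1z opprD addrA.
by rewrite subrr sub0r addrC.
Qed.

Lemma cmap_e j : (2 <= j <= n)%N -> cmap (ec j) = ec j.
Proof.
move=> hj; rewrite /cmap !ip_ecoord; try lia.
rewrite (_ : (j == N) = false); last lia.
rewrite (_ : (j == 1%N) = false); last lia.
by rewrite mulr0 !mulr0z !subr0 addr0.
Qed.

Lemma cmap_alpha i : ID n i -> cmap (alpha n i) = alpha n (aswap n i).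
Proof.
move=> hi; have {}hi : (1 <= i <= N)%N by [].
have [->|i1] := eqVneq i 1%N.
  have -> : aswap n 1 = 2 by case: (aswapP n3 1) => [] [h E]; move: h E; lia.
  rewrite [alpha n 1]/alpha /= cmapD cmap_e1 cmap_e ?alpha_ge2 //; last lia.
  by rewrite addrC.
have [->|i2] := eqVneq i 2.
  have -> : aswap n 2 = 1%N by case: (aswapP n3 2) => [] [h E]; move: h E; lia.
  rewrite alpha_ge2 // cmapD cmapN cmap_e1 opprK cmap_e; last lia.
  by rewrite addrC /alpha.
rewrite alpha_ge2; last lia.
have [->|iN] := eqVneq i N.
  have -> : aswap n N = 0%N by rewrite /aswap eqxx.
  by rewrite cmapD cmapN cmap_eN cmap_e /alpha //=; lia.
have -> : aswap n i = i by case: (aswapP n3 i); lia.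
rewrite cmapD cmapN !cmap_e ?alpha_ge2 //; lia.
Qed.

Lemma inLA_cmap mu : inLD mu -> inLA (cmap mu).
Proof.
move/inLD_LA; rewrite /inLA /cmap !(esumD, esumN, esumMz) esum_delta !esum_ecoord; try lia.
Qed.

Lemma ip_cmap mu la : ip (cmap mu) (cmap la) = ip mu la.
Proof.
have d l : ip (delta n) l = 0 by rewrite ipC ip_delta.
rewrite /cmap !(ipDl, ipDr, ipNl, ipNr, ipMzl, ipMzr) !(d, ip_delta) !(ipC (ec _) la).
rewrite !ip_ecoord ?eqxx; try lia.
Qed.

(** Forgets delta, so that affine weights can be evaluated in the finite quantum group without
    changing inner products. *)
Definition pr (mu : W n) : W n := mu - delta n *~ mu 0 0.

Lemma prD mu la : pr (mu + la) = pr mu + pr la.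
Proof. by rewrite /pr mxE mulrzDr opprD addrACA. Qed.

Lemma pr0 : pr 0 = 0.
Proof. by rewrite /pr mxE mulr0z subr0. Qed.

Lemma ip_pr mu la : ip (pr mu) la = ip mu la.
Proof. by rewrite /pr ipDl ipNl ipMzl ipC [ip _ la]ipC ip_delta mul0r subr0 ipC. Qed.

Lemma inLD_pr mu : inLA mu -> inLD (pr mu).
Proof.
rewrite /inLA /inLD => h; apply/andP; split.
  rewrite /pr !mxE -scaler_int mxE mxE eqxx /= (_ : (0 : 'I_n.+2) == inord 0).
    by rewrite intz mulr1 subrr.
  by apply/eqP/val_inj; rewrite /= inordK.
by rewrite /pr esumD esumN esumMz esum_delta mul0r subr0.
Qed.

Lemma pr_id mu : inLD mu -> pr mu = mu.
Proof. by case/andP=> /eqP h _; rewrite /pr h mulr0z subr0. Qed.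

End Coord.

(** * Maps between quantum groups permuting the generators *)
Section Transport.
Variables (k : fieldType) (q : k) (n : nat).
Hypotheses (q0 : q != 0) (q2 : q * q - 1 != 0) (n3 : (3 <= n)%N).
Variables (I J : nat -> bool) (inL inM : W n -> bool).
Hypotheses (HI : root_datum I inL) (HJ : root_datum J inM).
Variables (UD : algType k) (ED FD : nat -> UD) (KD : W n -> UD).
Hypothesis HUD : is_QG q I inL ED FD KD.
Variables (UA : algType k) (EA FA : nat -> UA) (KA : W n -> UA).
Hypothesis HUA : is_QG q J inM EA FA KA.
Variables (p : nat -> nat) (c : W n -> W n).
Hypotheses (pJ : forall i, I i -> J (p i))
  (pinj : forall i j, I i -> I j -> p i = p j -> i = j)
  (c0 : c 0 = 0) (cD : forall mu la, c (mu + la) = c mu + c la)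
  (cM : forall mu, inL mu -> inM (c mu))
  (c_ip : forall mu i, inL mu -> I i -> ip (c mu) (alpha n (p i)) = ip mu (alpha n i))
  (c_al : forall i, I i -> c (alpha n i) = alpha n (p i)).

Lemma qg_rels_transport :
  qg_rels q I inL (fun i => EA (p i)) (fun i => FA (p i)) (fun mu => KA (c mu)).
Proof.
have cN mu : c (- mu) = - c mu.
  by apply/eqP; rewrite -subr_eq0 opprK -cD addNr c0.
have ipE i j : I i -> I j -> ip (alpha n (p i)) (alpha n (p j)) = ip (alpha n i) (alpha n j).
  by move=> hi hj; rewrite -c_al // c_ip // (rd_alpha HI).
case: HUA => [[r0 [rD [rE [rF [rC [rS rEF]]]]]] _].
split; last split; last split; last split; last split; last split.
- by rewrite c0.
- by move=> mu la hm hl; rewrite rD ?cM // cD.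
- by move=> mu i hm hi; rewrite rE ?cM ?pJ // c_ip.
- by move=> mu i hm hi; rewrite rF ?cM ?pJ // c_ip.
- by move=> i j hi hj; rewrite -ipE // => h; apply: rC => //; apply: pJ.
- by move=> i j hi hj; rewrite -ipE // => h; apply: rS => //; apply: pJ.
- move=> i j hi hj; rewrite rEF ?pJ // cN c_al //.
  have -> // : (p i == p j) = (i == j).
  by apply/eqP/eqP => [|->] //; apply: pinj.
Qed.

Lemma qg_transport : exists f : UD -> UA, [/\ alg_hom f, forall i, I i -> f (ED i) = EA (p i),
  forall i, I i -> f (FD i) = FA (p i) & forall mu, inL mu -> f (KD mu) = KA (c mu)].
Proof. exact: (qg_hom HUD qg_rels_transport). Qed.

Variable f : UD -> UA.
Hypotheses (fH : alg_hom f) (fE : forall i, I i -> f (ED i) = EA (p i))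
  (fF : forall i, I i -> f (FD i) = FA (p i))
  (fK : forall mu, inL mu -> f (KD mu) = KA (c mu)).
Variables (TD : nat -> UD -> UD) (TA : nat -> UA -> UA).
Hypotheses (HTD : lusztig q I inL ED FD KD TD) (HTA : lusztig q J inM EA FA KA TA).
Hypothesis padj : forall i j, I i -> I j -> adj n (p i) (p j) = adj n i j.

(** Both sides are compared on the E's only, where [lusztig] determines the two braid operators. *)
Lemma transport_T i z : I i -> GE I ED z -> f (TD i z) = TA (p i) (f z).
Proof.
move=> hi; have hp := pJ hi.
apply: (ga_eq (alg_hom_comp fH (T_hom HTD hi)) (alg_hom_comp (T_hom HTA hp) fH)).
move=> _ [j [hj ->]]; have hpj := pJ hj; rewrite fE //.
have [ji|ji] := eqVneq j i.
  rewrite ji (T_Ei HTD) // (T_Ei HTA) // (ahN fH) (ahM fH) fF // fK ?c_al //.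
  exact: (rd_alpha HI).
rewrite (T_Ej n3 HI HTD) // (T_Ej n3 HJ HTA) //; last first.
  by apply: contraNneq ji => e; apply/eqP/pinj.
by rewrite padj //; case: ifP => _; rewrite ?(ah_qbr fH) !fE.
Qed.

Lemma transport_ops s z : all I s -> posP (GE I ED) TD s z ->
  f (ops TD s z) = ops TA (map p s) (f z).
Proof.
elim: s => [//|i s IH] /= /andP[hi hs] [h1 h2].
by rewrite transport_T ?IH //; apply: posP_gen h1.
Qed.

End Transport.

(** * The two copies of [U_D] in the affine algebra *)
Section Copies.
Variables (k : fieldType) (q : k) (n : nat).
Hypotheses (q0 : q != 0) (q2 : q * q - 1 != 0) (n3 : (3 <= n)%N).
Notation N := n.+1.
Variables (UD : algType k) (ED FD : nat -> UD) (KD : W n -> UD).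
Hypothesis HUD : is_QG q (ID n) (@inLD n) ED FD KD.
Variable TD : nat -> UD -> UD.
Hypothesis HTD : lusztig q (ID n) (@inLD n) ED FD KD TD.
Variables (UA : algType k) (EA FA : nat -> UA) (KA : W n -> UA).
Hypothesis HUA : is_QG q (IA n) (@inLA n) EA FA KA.
Variable TA : nat -> UA -> UA.
Hypothesis HTA : lusztig q (IA n) (@inLA n) EA FA KA TA.
Let HD := rd_D_type n3.
Let HA := rd_A_type n3.

Lemma ID_IA i : ID n i -> IA n i. Proof. by case/andP. Qed.

Lemma aswap_inj i j : ID n i -> ID n j -> aswap n i = aswap n j -> i = j.
Proof.
by move=> /andP[_ hi] /andP[_ hj] e; rewrite -(aswapK n3 hi) e (aswapK n3 hj).
Qed.

Definition is_iota (f : UD -> UA) : Prop := [/\ alg_hom f, forall i, ID n i -> f (ED i) = EA i,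
  forall i, ID n i -> f (FD i) = FA i & forall mu, inLD mu -> f (KD mu) = KA mu].

Definition is_swap (f : UD -> UA) : Prop :=
  [/\ alg_hom f, forall i, ID n i -> f (ED i) = EA (aswap n i),
  forall i, ID n i -> f (FD i) = FA (aswap n i) & forall mu, inLD mu -> f (KD mu) = KA (cmap mu)].

Lemma iota_exists : exists f, is_iota f.
Proof.
apply: (qg_transport HD HUD HUA (p := id) (c := id)) => //; first exact: ID_IA.
exact: inLD_LA.
Qed.

Lemma aswap_IA i : ID n i -> IA n (aswap n i).
Proof. by case/andP => _; apply: aswap_le. Qed.

Lemma cmap_ip mu i : inLD mu -> ID n i -> ip (cmap mu) (alpha n (aswap n i)) = ip mu (alpha n i).
Proof. by move=> _ hi; rewrite -cmap_alpha // ip_cmap. Qed.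

Lemma swap_exists : exists f, is_swap f.
Proof.
apply: (qg_transport HD HUD HUA (p := aswap n) (c := @cmap n)) => //.
- exact: aswap_IA.
- exact: aswap_inj.
- exact: cmap0.
- exact: cmapD.
- exact: inLA_cmap.
- exact: cmap_ip.
- exact: cmap_alpha.
Qed.

Variables (io ph : UD -> UA).
Hypotheses (Hio : is_iota io) (Hph : is_swap ph).

Lemma iota_ops s z : all (ID n) s -> posP (GE (ID n) ED) TD s z ->
  io (ops TD s z) = ops TA s (io z).
Proof.
move=> hs hz; case: Hio => h hE hF hK.
have := transport_ops (p := id) (c := id) n3 HD HA ID_IA (fun i j _ _ => id) (fun _ _ => erefl) h hE hF hK
   HTD HTA (fun _ _ _ _ => erefl) hs hz.
by rewrite map_id.
Qed.

Lemma swap_ops s z : all (ID n) s -> posP (GE (ID n) ED) TD s z ->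
  ph (ops TD s z) = ops TA (map (aswap n) s) (ph z).
Proof.
move=> hs hz; case: Hph => h hE hF hK.
apply: (transport_ops (c := @cmap n) n3 HD HA aswap_IA aswap_inj _ h hE hF hK HTD HTA) => //.
  exact: cmap_alpha.
by move=> i j /andP[_ hi] /andP[_ hj]; apply: aswap_adj.
Qed.

Lemma cut_all s1 t s2 : wD n = s1 ++ t :: s2 -> [/\ all (ID n) s1, ID n t & all (ID n) s2].
Proof.
by move=> E; have := all_wD n3; rewrite E all_cat /= => /and3P[].
Qed.

Lemma cut_pos s1 t s2 : wD n = s1 ++ t :: s2 -> posP (GE (ID n) ED) TD s1 (ED t).
Proof.
move=> E; have hl : (size s1 < 2 * n)%N by rewrite -(size_wD n3) E size_cat /=; lia.
have C := chain_T q0 q2 n3 HD HUD HTD (p := id) (fun _ => id) (fun _ _ _ _ => erefl) (fun _ _ _ _ => id).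
have [s1' [t' [s2' [E' Es H]]]] := wD_cases n3 hl.
have [<- <-] : s1' = s1 /\ t' = t.
  by move: E'; rewrite E => /eqP; rewrite eqseq_cat // => /andP[/eqP -> /eqP [-> _]].
have H' : pos n ED TD s1' (ED t').
  by case: H => [] [ht [-> _]]; [exact: (pos_xs n3 C)|exact: (pos_ys n3 C)].
by have := pos_posP (I := ID n) (p := id) (fun _ => id) H'; rewrite map_id.
Qed.

Lemma root_vec_fst l : (l < 2 * n)%N ->
  root_vec TA EA (wA n) l = io (root_vec TD ED (wD n) l).
Proof.
move=> hl; have [s1 [t [s2 [E -> _]]]] := wD_cases n3 hl.
have [h1 ht h2] := cut_all E.
rewrite (wAE n3) E -catA cat_cons !root_vecE iota_ops //; last exact: cut_pos E.
by case: Hio => _ -> .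
Qed.

Definition second_copy (z : UD) : UA := ops TA (wD n) (ph z).

Lemma second_copy_hom : alg_hom second_copy.
Proof.
case: Hph => h _ _ _; apply: (alg_hom_comp _ h); apply: ops_hom => i hi.
by apply: (T_hom HTA); apply: ID_IA; apply: (allP (all_wD n3)).
Qed.

Lemma root_vec_snd l : (l < 2 * n)%N ->
  root_vec TA EA (wA n) (2 * n + l) = second_copy (root_vec TD ED (wD n) l).
Proof.
move=> hl; have [s1 [t [s2 [E -> _]]]] := wD_cases n3 hl.
have [h1 ht h2] := cut_all E.
rewrite (wAE n3) {2}E map_cat catA map_cons.
rewrite (_ : 2 * n + size s1 = size (wD n ++ map (aswap n) s1))%N; last first.
  by rewrite size_cat size_map size_wD.
rewrite root_vecE ops_cat E root_vecE -E /second_copy swap_ops //; last exact: cut_pos E.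
by case: Hph => _ -> .
Qed.

(** The symmetry and T_{w_n} both exchange the indices 1 and 2 and both fix the indices from 3 to
    n. *)
Lemma second_copy_E j : (1 <= j <= n)%N -> second_copy (ED j) = EA j.
Proof.
move=> hj; have hID : ID n j by rewrite IDE; lia.
have CA := chain_T q0 q2 n3 HA HUA HTA (p := id) ID_IA (fun _ _ _ _ => erefl) (fun _ _ _ _ => id).
rewrite /second_copy; case: Hph => _ -> // _ _; rewrite aswap_s12 // /s12.
have [e12 e21 _ _] := wD_e12 n3 CA.
case: eqP => [->|j1]; first exact: e21.
case: eqP => [->|j2]; first exact: e12.
by have [] := wD_e n3 CA (j := j) ; first lia.
Qed.

End Copies.

(** * Commutation with the root vector of the second copy of [E_(n+1)] *)
Section AffineTop.
Variables (k : fieldType) (q : k) (n : nat).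
Hypotheses (q0 : q != 0) (q2 : q * q - 1 != 0) (n3 : (3 <= n)%N).
Notation N := n.+1.
Variables (UA : algType k) (EA FA : nat -> UA) (KA : W n -> UA).
Hypothesis HUA : is_QG q (IA n) (@inLA n) EA FA KA.
Variable TA : nat -> UA -> UA.
Hypothesis HTA : lusztig q (IA n) (@inLA n) EA FA KA TA.
Let HA := rd_A_type n3.
Let HR : qg_rels q (IA n) (@inLA n) EA FA KA := proj1 HUA.
Notation al := (alpha n).
Notation br := (qcomm q^-1).

Notation e0 := (fun i => EA (p0map n i)).
Notation op0 := (fun i => TA (p0map n i)).

Let C0 : chain n q^-1 e0 op0 :=
  chain_T q0 q2 n3 HA HUA HTA (@p0map_IA n) (p0map_adj n3) (@p0map_inj n).

Lemma gen_F_comm t z : ID n t -> gen n e0 (fun i => i != t) z -> FA t * z = z * FA t.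
Proof.
move=> ht; have htA : IA n t by case/andP: ht.
elim=> [_ [i [hi it ->]]||x y _ hx _ hy|c x _ hx|x y _ hx _ hy].
- apply/esym/(qg_EFij HR) => //; first exact: p0map_IA.
  by case/andP: ht => t0 _; case: (p0mapP n i) => [] [_ ->] //; rewrite eq_sym -lt0n.
- by rewrite mulr1 mul1r.
- by rewrite mulrDr mulrDl hx hy.
- by rewrite -scalerAr hx -scalerAl.
- by rewrite mulrA hx -mulrA hy mulrA.
Qed.

(** The letters of the relabelled chain are E_0, .., E_n, so E_{n+1} never occurs. *)
Lemma gen_FN_comm J z : gen n e0 J z -> FA N * z = z * FA N.
Proof.
elim=> [_ [i [hi it ->]]||x y _ hx _ hy|c x _ hx|x y _ hx _ hy].
- apply/esym/(qg_EFij HR); [exact: p0map_IA|by rewrite /IA|].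
  by move: (p0mapP n i); case/andP: hi => i0 hi; lia.
- by rewrite mulr1 mul1r.
- by rewrite mulrDr mulrDl hx hy.
- by rewrite -scalerAr hx -scalerAl.
- by rewrite mulrA hx -mulrA hy mulrA.
Qed.

Lemma ops_op0 s z : N \notin s -> ops TA s z = ops op0 s z.
Proof.
move=> hs; apply: eq_ops => i y hi; rewrite p0map_id //.
by apply: contraNneq hs => <-.
Qed.

Lemma TN_E0 : TA N (EA 0) = EA 0.
Proof.
rewrite (T_Ej n3 HA HTA) //; last by rewrite /IA.
by rewrite (adjC n3 N 0) adj_0 // ifF //; lia.
Qed.

Lemma ops_suffix s : ops TA (s ++ [:: N]) (EA 0) = ops TA s (EA 0).
Proof. by rewrite ops_cat /= TN_E0. Qed.

(** The last letter n + 1 of w_n fixes E_0, since these nodes are not adjacent. What remains avoids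
    n + 1 and can be read in the relabelled chain. *)
Lemma suffix1 t : (1 <= t <= N)%N ->
  ops TA (desc t.-1 0 ++ iota 3 (n - 1)) (EA 0) = ops op0 (desc t.-1 0) (zs e0 op0 N).
Proof.
move=> ht; have -> : (n - 1 = (n - 2) + 1)%N by lia.
rewrite iotaD (_ : 3 + (n - 2) = N)%N; last lia.
rewrite catA ops_suffix ops_op0; last by rewrite mem_cat mem_desc mem_iota; lia.
rewrite ops_cat /zs (_ : N - 3 = n - 2)%N; last lia.
by rewrite /p0map eqxx.
Qed.

Lemma suffix2 t : (3 <= t <= n)%N ->
  ops TA (iota t.+1 (N - t)) (EA 0) = Qs n e0 op0 t.+1.
Proof.
move=> ht; have -> : (N - t = (n - t) + 1)%N by lia.
rewrite iotaD (_ : t.+1 + (n - t) = N)%N; last lia.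
rewrite ops_suffix ops_op0; last by rewrite mem_iota; lia.
rewrite /Qs (_ : N - t.+1 = n - t)%N; last lia.
by rewrite /p0map eqxx.
Qed.

Lemma hasw_chainA s : (s.+3 <= n)%N ->
  hasw q (@inLA n) KA (chainA q^-1 e0 op0 s) (ecoord n s.+3 + ecoord n s.+2).
Proof.
have hE i : (1 <= i <= n)%N -> hasw q (@inLA n) KA (EA i) (al i).
  by move=> hi; apply: (hasw_E HUA); rewrite /IA; lia.
elim: s => [|s IH] hs.
  have -> : ecoord n 3 + ecoord n 2 = al 3 + al 1 + al 2.
    rewrite (@alpha_ge2 n 3) // (@alpha_ge2 n 2) // [al 1]/alpha /= [ecoord n 1 + _]addrC [X in _ = X + _]addrA subrK.
    by rewrite addrA addrAC addrK.
  by rewrite /= !p0map_id; try lia; do 2?apply: hasw_br => //; apply: hE; lia.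
have -> : ecoord n s.+4 + ecoord n s.+3 = sref s.+4 (ecoord n s.+3 + ecoord n s.+2) + al s.+3.
  rewrite srefD (sref_e_p n3 (i := s.+4)); last lia.
  rewrite (sref_e_id n3); try lia.
  by rewrite alpha_ge2 //= addrACA subrr addr0.
rewrite [chainA _ _ _ _]/=; apply: hasw_br => //; rewrite p0map_id; try lia.
  by apply: (hasw_T n3 HA HTA); [rewrite /IA; lia|apply: IH; lia].
by apply: hE; lia.
Qed.

Lemma hasw_Qs j : (3 <= j <= N)%N ->
  hasw q (@inLA n) KA (Qs n e0 op0 j) (delta n - ecoord n N - ecoord n j.-1).
Proof.
move=> hj; rewrite -(sw_Qs n3 hj) /Qs -ops_op0; last by rewrite mem_iota; lia.
rewrite /p0map eqxx; apply: (hasw_ops n3 HA HTA); last exact: (hasw_E HUA).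
by apply/allP => i; rewrite mem_iota /IA; lia.
Qed.

Lemma hasw_q z b (mu : W n) (c : int) : inLA mu -> hasw q (@inLA n) KA z b -> ip mu b = c ->
  KA mu * z = q ^ c *: (z * KA mu) /\ KA (- mu) * z = q ^ (- c) *: (z * KA (- mu)).
Proof.
by move=> hm hz <-; split; rewrite hz ?ipNl //; apply: inLA_N.
Qed.

(* Writing [z] as [[[Y, [E_(t-1), E_t]], Q]], the commutator with [F_t] turns
   [E_t] into Cartan elements, which the outer q-commutator with [Q] kills. *)
Lemma suffix_mid t : (3 <= t <= n)%N ->
  let z := ops op0 (desc t.-1 0) (zs e0 op0 N) in FA t * z = z * FA t.
Proof.
move=> ht z; have htD : ID n t by rewrite IDE; lia.
have htA : IA n t by rewrite /IA; lia.
have ht1 : (3 <= t < N)%N by lia.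
have -> : z = br (ops op0 (desc t.-1 0) (zs e0 op0 t)) (Qs n e0 op0 t.+1).
  exact: (desc_zs_split n3 C0).
have htN : (3 <= t <= N)%N by lia.
have [Y [gY HY ->]] := mid_form n3 C0 htN.
have hal := inLA_alpha n3 htA.
have gYt : gen n e0 (fun i => i != t) Y by apply: gen_sub gY => i; lia.
have FY := gen_F_comm htD gYt.
have gQ : gen n e0 (fun i => (t.+1 <= i)%N) (Qs n e0 op0 t.+1).
  by apply: (Qs_gen n3 C0); lia.
have gQt : gen n e0 (fun i => i != t) (Qs n e0 op0 t.+1) by apply: gen_sub gQ => i; lia.
have FQ := gen_F_comm htD gQt.
have hD : ID n t.-1 by rewrite IDE; lia.
have gD : gen n e0 (fun i => (i < t)%N) (e0 t.-1) by apply: gen_e => //; lia.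
have gDt : gen n e0 (fun i => i != t) (e0 t.-1) by apply: gen_e => //; lia.
have FD := gen_F_comm htD gDt.
have QC y : gen n e0 (fun i => (i < t)%N) y -> Qs n e0 op0 t.+1 * y = y * Qs n e0 op0 t.+1.
  move=> gy; apply: (gen_comm C0 _ gQ gy) => i j hi hj h1 h2; apply/andP; split; first lia.
  by rewrite /adj; move: hi hj; rewrite !IDE; lia.
have QY := QC _ gY; have QD := QC _ gD.
(* Q, Y and E_{t-1} all have weight pairing to -1 with alpha_t. The inner bracket therefore kills
   the K_{-alpha_t} term, and the outer one kills the K_{alpha_t} term. *)
have [KQ KQ'] : KA (al t) * Qs n e0 op0 t.+1 = q ^ (-1) *: (Qs n e0 op0 t.+1 * KA (al t)) /\
    KA (- al t) * Qs n e0 op0 t.+1 = q ^ 1 *: (Qs n e0 op0 t.+1 * KA (- al t)).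
  apply: (hasw_q hal (hasw_Qs _)); first lia.
  rewrite alpha_ge2 /= ?(ipDr, ipDl, ipNr, ipNl, ip_delta) ?ip_ecoord; lia.
have [KY KY'] : KA (al t) * Y = q ^ (-1) *: (Y * KA (al t)) /\
    KA (- al t) * Y = q ^ 1 *: (Y * KA (- al t)).
  case: HY => [[-> ->]|[s [Et ->]]].
    rewrite (p0map_id (i := 1)); last lia.
    apply: (hasw_q (b := al 1)); first by apply: (inLA_alpha n3); lia.
      exact: (hasw_E HUA).
    by rewrite (ip_adj n3 HA) // /IA; lia.
  rewrite Et in hal *.
  apply: (hasw_q hal (hasw_chainA _)); first lia.
  rewrite alpha_ge2 /= ?(ipDr, ipDl, ipNr, ipNl, ip_delta) ?ip_ecoord; lia.
have [KD KD'] : KA (al t) * e0 t.-1 = q ^ (-1) *: (e0 t.-1 * KA (al t)) /\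
    KA (- al t) * e0 t.-1 = q ^ 1 *: (e0 t.-1 * KA (- al t)).
  rewrite p0map_id; last lia.
  apply: (hasw_q (b := al t.-1)) => //; first by apply: (hasw_E HUA); rewrite /IA; lia.
  rewrite (ip_adj n3 HA) //; first by rewrite /IA; lia.
  by rewrite /adj; lia.
have EF : e0 t * FA t = FA t * e0 t + (q - q^-1)^-1 *: (KA (al t) - KA (- al t)).
  by rewrite p0map_id; [exact: (qg_EFii HR)|lia].
have qN1 : q ^ (-1) = q^-1 by [].
move: KQ KQ' KY KY' KD KD'; rewrite expr1z qN1 => KQ KQ' KY KY' KD KD'.
rewrite /qcomm.
have EF' := EF; move: (e0 t) (e0 t.-1) EF' KD KD' QD FD => e d EF' KD KD' QD FD.
have FY' := esym FY; have FQ' := esym FQ; have FD' := esym FD.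
nc (tt, EF', FY', FQ', FD', QY, QD, KQ, KQ', KY, KY', KD, KD').
Qed.

(** If t is 1 or 2, or a letter of the ascending factor, the suffix involves no E_t; if t = n + 1,
    no E_{n+1} is present at all. Only t from 3 to n in the descending factor requires
    [suffix_mid]. *)
Lemma suffix_F s1 t s2 : wD n = s1 ++ t :: s2 ->
  FA t * ops TA s2 (EA 0) = ops TA s2 (EA 0) * FA t.
Proof.
move=> E; have hl : (size s1 < 2 * n)%N by rewrite -(size_wD n3) E size_cat /=; lia.
have [s1' [t' [s2' [E' Es H]]]] := wD_cases n3 hl.
have [<- <-] : t' = t /\ s2' = s2.
  by move: E'; rewrite E => /eqP; rewrite eqseq_cat // => /andP[_ /eqP [-> ->]].
case: H => [] [ht [_ ->]].
  have htD : ID n t' by rewrite IDE; lia.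
  rewrite suffix1 //; have [t3|t3] := leqP 3 t'; last first.
    apply: (gen_F_comm htD).
    have [->|t1] := eqVneq t' 1%N.
      rewrite -[ops op0 _ _]/(zs e0 op0 N) zs_N.
      by apply: gen_sub (Qs_gen n3 C0 (j := 3) _) => [i|]; lia.
    have -> : t' = 2 by lia.
    rewrite -[ops op0 _ _]/(op0 1%N (zs e0 op0 N)) zs_N (Qs_rec n3 C0); last lia.
    rewrite (op_br C0) // [op0 1%N (e0 3)](ch_br C0) //; try by rewrite ?IDE /adj; lia.
    have g4 : gen n e0 (fun i => (4 <= i)%N) (Qs n e0 op0 4) by apply: (Qs_gen n3 C0); lia.
    rewrite (op_id C0 (J := fun i => (4 <= i)%N)) //; last first.
      by move=> i; rewrite IDE /adj; lia.
    apply: gen_br; last by apply: gen_sub g4 => i; lia.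
    by apply: gen_br; apply: gen_e; rewrite ?IDE; lia.
  have [->|tN] := eqVneq t' N; last by apply: suffix_mid; lia.
  apply: (gen_FN_comm (J := fun i => (i <= N)%N)).
  by apply: (desc_zs_gen n3 C0); lia.
have htD : ID n t' by rewrite IDE; lia.
have [->|tN] := eqVneq t' N.
  by rewrite subnn; apply/esym/(qg_EFij HR) => //; rewrite /IA.
rewrite suffix2; last lia.
by apply: (gen_F_comm htD); apply: gen_sub (Qs_gen n3 C0 (j := t'.+1) _) => [i|]; lia.
Qed.

(* After removing [T_(s1)] and writing [E_t = - T_t (K_t^-1 F_t)], the two factors
   commute up to the Cartan part. *)
Lemma top_qcomm s1 t s2 : wD n = s1 ++ t :: s2 ->
  ops TA (wD n) (EA 0) * ops TA s1 (EA t) =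
  q ^ (- ip (al N) (sw s1 (al t))) *: (ops TA s1 (EA t) * ops TA (wD n) (EA 0)).
Proof.
move=> E; have hF := suffix_F E.
have := all_wD n3; rewrite E all_cat /= => /and3P[h1 ht h2].
have sub i : ID n i -> IA n i by case/andP.
have hh1 : forall i, i \in s1 -> IA n i by move=> i /(allP h1) /sub.
have hhom := ops_hom (fun i hi => T_hom HTA (hh1 i hi)).
have {}hh1 : all (IA n) s1 by apply/allP.
have hh2 : all (IA n) s2 by apply/allP => i /(allP h2) /sub.
have htA := sub t ht; have hT := T_hom HTA htA.
have aT := inLA_alpha n3 htA; have aT' := inLA_N aT.
set z := ops TA s2 (EA 0) in hF *.
have wz : hasw q (@inLA n) KA z (sw s2 (al 0)) by apply: (hasw_ops n3 HA HTA) => //; apply: (hasw_E HUA).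
have -> : EA t = TA t (- (KA (- al t) * FA t)).
  rewrite (ahN hT) (ahM hT) (T_K HTA) // srefN sref_alpha // opprK (T_Fi HTA) //.
  by rewrite mulrN opprK mulrA (qg_KN HA HR) // mul1r.
rewrite ops_cat [ops TA (t :: s2) _]/= -/z -!(ahM hhom) -!(ahM hT) -(ahZ hhom) -(ahZ hT).
congr (ops TA s1 (TA t _)).
(* By [sw_wD], alpha_{n+1} is w_n alpha_0 up to delta. The isometry s1 cancels on both sides, and
   s_t gives the sign. *)
have -> : ip (al N) (sw s1 (al t)) = - ip (al t) (sw s2 (al 0)).
  have swI s (a b : W n) : all (IA n) s -> ip (sw s a) (sw s b) = ip a b.
    by elim: s => [//|i s IH] /= /andP[hi hs]; rewrite ip_sref // srefK // IH.
  have -> : al N = sw (wD n) (al 0) - delta n by rewrite sw_wD // addrK.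
  rewrite ipDl ipNl [X in _ - X]ipC ip_delta subr0 E sw_cat swI //.
  by rewrite [sw (t :: s2) _]/= ip_sref // sref_alpha // ipNr ipC.
rewrite opprK; have e1 := wz _ aT'; rewrite ipNl in e1.
rewrite mulrN mulNr scalerN; congr (- _).
rewrite -[in RHS]mulrA hF [in RHS]mulrA e1 -scalerAl scalerA -expfzDr // addrN expr0z scale1r.
by rewrite mulrA.
Qed.

End AffineTop.

(** * The action of [U_D^{>=0}] on [U_q^{w_n}] *)
Section Action.
Variables (k : fieldType) (q : k) (n : nat).
Hypotheses (q0 : q != 0) (q2 : q * q - 1 != 0) (n3 : (3 <= n)%N).
Notation N := n.+1.
Variables (UD : algType k) (ED FD : nat -> UD) (KD : W n -> UD).
Hypothesis HUD : is_QG q (ID n) (@inLD n) ED FD KD.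
Variable TD : nat -> UD -> UD.
Hypothesis HTD : lusztig q (ID n) (@inLD n) ED FD KD TD.
Let HD := rd_D_type n3.
Let HR : qg_rels q (ID n) (@inLD n) ED FD KD := proj1 HUD.
Notation al := (alpha n).
Notation ec := (ecoord n).
Notation br := (qcomm q^-1).
Notation xs := (xs n ED TD).
Notation ys := (ys n ED TD).
Notation actK := (actK KD).
Notation actE := (actE ED KD).
Notation Uwn := (Uwn n ED TD).
Notation hasw := (hasw q (@inLD n) KD).

Lemma chain_D : chain n q^-1 ED TD.
Proof. exact: (chain_T q0 q2 n3 HD HUD HTD (p := id)). Qed.
Let C := chain_D.

Let serreD i j : ID n i -> ID n j -> adj n i j ->
  ED i * br (ED j) (ED i) = q^-1 *: (br (ED j) (ED i) * ED i).
Proof. exact: (chain_serre q0 n3 HD HUD (p := id)). Qed.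

Lemma actK_hasw mu v b : inLD mu -> hasw v b -> actK mu v = q ^ (ip mu b) *: v.
Proof.
by move=> hm hv; rewrite /actK hv // -scalerAl -mulrA (qg_KN HD HR) // mulr1.
Qed.

Lemma actK_hom mu : inLD mu -> alg_hom (actK mu).
Proof.
move=> hm; split; first by rewrite /actK mulr1 (qg_KN HD HR).
split=> [x y _ _|c x _]; last by rewrite /actK -scalerAr -scalerAl.
split; first by rewrite /actK mulrDr mulrDl.
rewrite /actK !mulrA; congr (_ * _); congr (_ * _).
by rewrite -[in RHS]mulrA (qg_NK HD HR) // mulr1.
Qed.

Lemma weights_E i : ID n i -> hasw (ED i) (al i).
Proof. exact: (hasw_E HUD). Qed.

Lemma hasw_xs j : (1 <= j <= n)%N -> hasw (xs j) (ec N - ec j).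
Proof.
have [i Ei] : exists i, (n - j = i)%N by exists (n - j)%N.
elim: i j Ei => [|i IH] j Ei hj.
  have -> : j = n by lia.
  rewrite xs_n (_ : ec N - ec n = al N); first by apply: weights_E; rewrite IDE; lia.
  by rewrite alpha_ge2 //; lia.
rewrite (xs_rec n3 C); last lia.
have -> : ec N - ec j = (ec N - ec j.+1) + al j.+1.
  by rewrite alpha_ge2 ?addrA ?subrK //; lia.
apply: hasw_br => //; first by apply: IH; lia.
by apply: weights_E; rewrite IDE; lia.
Qed.

Lemma hasw_ys j : (1 <= j <= n)%N -> hasw (ys j) (ec N + ec j).
Proof.
elim: j => [//|j IH] hj; have [j0|j0] := eqVneq j 0%N.
  rewrite j0 (ys1E n3 C) (_ : ec N + ec 1 = (ec N - ec 2) + al 1).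
    apply: hasw_br => //; first by apply: hasw_xs; lia.
    exact: weights_E.
  by rewrite [al 1]/alpha /= [ec 1 + _]addrC addrA subrK.
have -> : ec N + ec j.+1 = (ec N + ec j) + al j.+1.
  by rewrite alpha_ge2 /= ?[ec j.+1 - _]addrC ?addrA ?addrK //; lia.
have [j1|j1] := eqVneq j 1%N.
  subst j; rewrite (ys2E n3 C); apply: hasw_br => //; first by apply: IH; lia.
  by apply: weights_E; rewrite IDE; lia.
rewrite (ys_rec n3 C); last lia.
apply: hasw_br => //; first by apply: IH; lia.
by apply: weights_E; rewrite IDE; lia.
Qed.

Lemma Uwn_root l : (l < 2 * n)%N -> Uwn (root_vec TD ED (wD n) l).
Proof. by move=> hl; apply: ga_gen; exists l; rewrite size_wD. Qed.

Lemma Uwn_xs j : (1 <= j <= n)%N -> Uwn (xs j).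
Proof. by move=> hj; rewrite -(root_vec_x n3) //; apply: Uwn_root; lia. Qed.

Lemma Uwn_ys j : (1 <= j <= n)%N -> Uwn (ys j).
Proof. by move=> hj; rewrite -(root_vec_y n3) //; apply: Uwn_root; lia. Qed.

Lemma Uwn_ind (P : UD -> Prop) :
  (forall j, (1 <= j <= n)%N -> P (xs j)) -> (forall j, (1 <= j <= n)%N -> P (ys j)) ->
  P 1 -> (forall a b, Uwn a -> Uwn b -> P a -> P b -> P (a + b)) ->
  (forall c a, Uwn a -> P a -> P (c *: a)) ->
  (forall a b, Uwn a -> Uwn b -> P a -> P b -> P (a * b)) -> forall a, Uwn a -> P a.
Proof.
move=> Hx Hy H1 HD' HZ HM a; elim=> [_ [l [hl ->]]||x y hx IHx hy IHy|c x hx IHx|x y hx IHx hy IHy] //.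
- rewrite size_wD // in hl; have [i [hi [->|->]]] := root_vec_xy n3 TD ED hl; [exact: Hx|exact: Hy].
- exact: HD'.
- exact: HZ.
- exact: HM.
Qed.

Lemma Uwn_actK mu a : inLD mu -> Uwn a -> Uwn (actK mu a).
Proof.
move=> hm; have h := actK_hom hm; move: a; apply: Uwn_ind.
- by move=> j hj; rewrite (actK_hasw hm (hasw_xs hj)); apply/ga_scale/Uwn_xs.
- by move=> j hj; rewrite (actK_hasw hm (hasw_ys hj)); apply/ga_scale/Uwn_ys.
- by rewrite (ah1 h); apply: ga_one.
- by move=> a b _ _ ha hb; rewrite (ahD h); apply: ga_add.
- by move=> c a _ ha; rewrite (ahZ h); apply: ga_scale.
- by move=> a b _ _ ha hb; rewrite (ahM h); apply: ga_mul.
Qed.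

Lemma actE_1 i : ID n i -> actE i 1 = 0.
Proof.
move=> hi; rewrite /actE; case: ifP => // _.
by rewrite !mulr1 (qg_NK HD HR) ?mul1r ?subrr // (rd_alpha HD).
Qed.

Lemma actE_D i a b : actE i (a + b) = actE i a + actE i b.
Proof.
rewrite /actE; case: ifP => _; last by rewrite addr0.
by rewrite !mulrDr !mulrDl opprD addrACA.
Qed.

Lemma actE_Z i c a : actE i (c *: a) = c *: actE i a.
Proof.
rewrite /actE; case: ifP => _; last by rewrite scaler0.
by rewrite -!scalerAr -!scalerAl -scalerBr.
Qed.

(** The twisted Leibniz rule dictated by the coproduct of E_i. *)
Lemma actE_M i a b : ID n i ->
  actE i (a * b) = actE i a * b + actK (- al i) a * actE i b.
Proof.
move=> hi; rewrite /actE /Defs.actK; case: ifP => _; last by rewrite mul0r mulr0 addr0.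
rewrite opprK; set K := KD (al i); set K' := KD (- al i).
have KK : K * K' = 1 by apply: (qg_KN HD HR); apply: (rd_alpha HD).
by nc (tt, KK).
Qed.

Lemma actE_hasw i v b c : (1 <= i <= n)%N -> hasw v b -> ip (al i) b = c ->
  actE i v = ED i * v - q ^ (- c) *: (v * ED i).
Proof.
move=> hi hv <-; have hD : ID n i by rewrite IDE; lia.
rewrite /actE (_ : (i <= n)%N); last lia.
have ha := rd_alpha HD hD.
by rewrite hv ?(rd_N HD) // ipNl -!scalerAl -[v * _ * _]mulrA (qg_NK HD HR) // mulr1.
Qed.

Let actE_0 i v b c : (1 <= i <= n)%N -> hasw v b -> ip (al i) b = c ->
  ED i * v = q ^ (- c) *: (v * ED i) -> Uwn (actE i v).
Proof. by move=> hi hv hc e; rewrite (actE_hasw hi hv hc) e subrr; apply: ga_zero. Qed.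

(** Here the action is E_i v - q v E_i, which is - q times the bracket producing the next root
    vector. *)
Let actE_N i v b v' : (1 <= i <= n)%N -> hasw v b -> ip (al i) b = -1 ->
  v' = br v (ED i) -> Uwn v' -> Uwn (actE i v).
Proof.
move=> hi hv hc e h; rewrite (actE_hasw hi hv hc).
have -> : ED i * v - q ^ (- -1) *: (v * ED i) = (- q) *: v'.
  by rewrite opprK expr1z e /qcomm; nc tt.
exact: ga_scale.
Qed.

Let ip1_xs j : (1 <= j <= n)%N -> ip (al 1) (ec N - ec j) = - (j == 1%N)%:R - (j == 2)%:R.
Proof.
move=> hj; rewrite /alpha /= !(ipDl, ipDr, ipNr) !ip_ecoord; lia.
Qed.

Let ip1_ys j : (1 <= j <= n)%N -> ip (al 1) (ec N + ec j) = (j == 1%N)%:R + (j == 2)%:R.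
Proof.
move=> hj; rewrite /alpha /= !(ipDl, ipDr, ipNr) !ip_ecoord; lia.
Qed.

Let ip_xs i j : (2 <= i <= n)%N -> (1 <= j <= n)%N ->
  ip (al i) (ec N - ec j) = (i == j.+1)%:R - (i == j)%:R.
Proof.
move=> hi hj; rewrite alpha_ge2 ?(ipDl, ipDr, ipNr, ipNl) ?ip_ecoord; lia.
Qed.

Let ip_ys i j : (2 <= i <= n)%N -> (1 <= j <= n)%N ->
  ip (al i) (ec N + ec j) = (i == j)%:R - (i == j.+1)%:R.
Proof.
move=> hi hj; rewrite alpha_ge2 ?(ipDl, ipDr, ipNr, ipNl) ?ip_ecoord; lia.
Qed.

(** Up to the factor - q, E_i sends x_i to x_{i-1} for i >= 2, while E_1 sends x_1 to y_2 and x_2 to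
    y_1. In all other cases E_i q-commutes with x_j and acts by zero. *)
Lemma actE_xs i j : (1 <= i <= n)%N -> (1 <= j <= n)%N -> Uwn (actE i (xs j)).
Proof.
move=> hi hj; have hw := hasw_xs hj; have [i1|i1] := eqVneq i 1%N.
  subst i; have hip := ip1_xs hj.
  have [j1|j1] := eqVneq j 1%N.
    subst j; apply: (actE_N hi hw hip (ys2E' n3 C)); apply: Uwn_ys; lia.
  have [j2|j2] := eqVneq j 2.
    subst j; apply: (actE_N hi hw hip (ys1E n3 C)); apply: Uwn_ys; lia.
  rewrite (negPf j1) (negPf j2) in hip.
  by apply: (actE_0 hi hw hip); rewrite expr0z scale1r; apply: (e_xs_comm n3 C); lia.
have hi2 : (2 <= i <= n)%N by lia.
have hip := ip_xs hi2 hj.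
have [ij|ij] := eqVneq i j.
  subst j; rewrite eqxx (_ : (i == i.+1) = false) in hip; last lia.
  have hx : xs i.-1 = br (xs i) (ED i) by rewrite (xs_rec n3 C) ?prednK //; lia.
  by apply: (actE_N hi hw hip hx); apply: Uwn_xs; lia.
have [ij1|ij1] := eqVneq i j.+1.
  subst i; rewrite eqxx (_ : (j.+1 == j) = false) in hip; last lia.
  apply: (actE_0 hi hw hip); apply: (e_xs_kcomm n3 C serreD); lia.
rewrite (negPf ij) (negPf ij1) in hip.
by apply: (actE_0 hi hw hip); rewrite expr0z scale1r; apply: (e_xs_comm n3 C); lia.
Qed.

(** Only E_{j+1} acts nontrivially on y_j, giving y_{j+1} up to the factor - q. *)
Lemma actE_ys i j : (1 <= i <= n)%N -> (1 <= j <= n)%N -> Uwn (actE i (ys j)).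
Proof.
move=> hi hj; have hw := hasw_ys hj; have [i1|i1] := eqVneq i 1%N.
  subst i; have hip := ip1_ys hj.
  have [j1|j1] := eqVneq j 1%N.
    subst j; exact: (actE_0 hi hw hip (e1_ys1 n3 C serreD)).
  have [j2|j2] := eqVneq j 2.
    subst j; exact: (actE_0 hi hw hip (e1_ys2 n3 C serreD)).
  rewrite (negPf j1) (negPf j2) in hip.
  by apply: (actE_0 hi hw hip); rewrite expr0z scale1r; apply: (e12_ys_comm n3 C); lia.
have hi2 : (2 <= i <= n)%N by lia.
have hip := ip_ys hi2 hj.
have [ij|ij] := eqVneq i j.
  subst j; rewrite eqxx (_ : (i == i.+1) = false) in hip; last lia.
  apply: (actE_0 hi hw hip).
  have [->|i2] := eqVneq i 2; first exact: (e2_ys2 n3 C serreD).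
  by apply: (e_ys_kcomm n3 C serreD); lia.
have [ij1|ij1] := eqVneq i j.+1.
  subst i; rewrite eqxx (_ : (j.+1 == j) = false) in hip; last lia.
  apply: (actE_N hi hw hip (v' := ys j.+1)); last by apply: Uwn_ys; lia.
  have [->|j1] := eqVneq j 1%N; first exact: (ys2E n3 C).
  by rewrite (ys_rec n3 C) //; lia.
rewrite (negPf ij) (negPf ij1) in hip.
apply: (actE_0 hi hw hip); rewrite expr0z scale1r.
have [i2|i2] := eqVneq i 2; first by apply: (e12_ys_comm n3 C); lia.
have [->|j1] := eqVneq j 1%N; first by apply: (e_ys1_comm n3 C); lia.
by apply: (e_ys_comm n3 C); lia.
Qed.

Lemma Uwn_actE i a : ID n i -> Uwn a -> Uwn (actE i a).
Proof.
move=> hi; have [iN|iN] := leqP i n; last first.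
  by move=> _; rewrite /actE ifF; [exact: ga_zero|lia].
have hin : (1 <= i <= n)%N by move: hi; rewrite IDE; lia.
move: a; apply: Uwn_ind.
- by move=> j; apply: actE_xs.
- by move=> j; apply: actE_ys.
- by rewrite actE_1 //; apply: ga_zero.
- by move=> a b _ _ ha hb; rewrite actE_D; apply: ga_add.
- by move=> c a _ ha; rewrite actE_Z; apply: ga_scale.
- move=> a b ha hb ha' hb'; rewrite actE_M //; apply: ga_add; apply: ga_mul => //.
  by apply: Uwn_actK ha; apply: (rd_N HD); apply: (rd_alpha HD).
Qed.

Lemma E_mul i a : (1 <= i <= n)%N -> ED i * a = actK (- al i) a * ED i + actE i a.
Proof. by case/andP=> _ hi; rewrite /actE hi /Defs.actK opprK addrC subrK. Qed.

Lemma Uwn_pos a : Uwn a -> GE (ID n) ED a.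
Proof.
have sub x : gen n ED xpredT x -> GE (ID n) ED x.
  by apply: ga_sub => _ [i [hi _ ->]]; apply: GE_E.
move: a; apply: Uwn_ind.
- move=> j hj; apply/sub/(pos_gen (pos_xs n3 C (t := j.+1) _)); lia.
- move=> j hj; apply: sub; have [->|j1] := eqVneq j 1%N.
    by rewrite (_ : ys 1 = ops TD (desc N 1) (ED 1)) //; apply: (pos_gen (pos_xs n3 C (t := 1) _)).
  have ht : (3 <= j.+1 <= N)%N by lia.
  rewrite (ys_zs n3); last lia.
  rewrite /zs -ops_cat; exact: (pos_gen (pos_ys n3 C ht)).
- exact: ga_one.
- by move=> a b _ _; apply: ga_add.
- by move=> c x _; apply: ga_scale.
- by move=> a b _ _; apply: ga_mul.
Qed.

End Action.

(** * Separating the negative part from the second copy of the positive part *)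
Section WordEval.
Variables (k : fieldType) (q : k) (n : nat) (A : algType k) (e : nat -> A).

(** The product is taken from right to left, matching the reading of words in [tri_fun]. *)
Definition wordev (w : seq nat) : A := foldr (fun i x => x * e i) 1 w.

Lemma wordev_cat s t : wordev (s ++ t) = wordev t * wordev s.
Proof. by elim: s => [|i s IH] /=; rewrite ?mulr1 // IH mulrA. Qed.

Lemma serre_lin i j (V : lmodType k) (L : V -> V) (g : seq nat -> V) : lin_map L ->
  serre q n i j (fun s => L (g s)) = L (serre q n i j g).
Proof.
move=> [LD LZ]; have LN x : L (- x) = - L x by rewrite -scaleN1r LZ scaleN1r.
by rewrite /serre; case: ifP => _; rewrite !LD !LN ?LZ.
Qed.

Lemma wordev_serre i j : (e i = 0 \/ e j = 0 \/
   (adj n i j -> e i * e i * e j = (q + q^-1) *: (e i * e j * e i) - e j * e i * e i) /\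
   (~~ adj n i j -> e i * e j = e j * e i)) ->
  serre q n i j wordev = 0.
Proof.
rewrite /serre /= !mul1r; case=> [->|[->|[h1 h2]]].
- by rewrite !(mulr0, mul0r, scaler0) !subr0 ?addr0 if_same.
- by rewrite !(mulr0, mul0r, scaler0) !subr0 ?addr0 if_same.
- case: ifP => [/h1 ->|/negbT/h2 ->]; last by rewrite subrr.
  by rewrite addrAC subrK subrr.
Qed.

End WordEval.

Section Separate.
Variables (k : fieldType) (q : k) (n : nat).
Hypotheses (q0 : q != 0) (q2 : q * q - 1 != 0) (n3 : (3 <= n)%N).
Notation N := n.+1.
Variables (UD : algType k) (ED FD : nat -> UD) (KD : W n -> UD).
Hypothesis HUD : is_QG q (ID n) (@inLD n) ED FD KD.
Variables (UA : algType k) (EA FA : nat -> UA) (KA : W n -> UA).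
Hypothesis HUA : is_QG q (IA n) (@inLA n) EA FA KA.
Let HD := rd_D_type n3.
Let HA := rd_A_type n3.
Let HR : qg_rels q (ID n) (@inLD n) ED FD KD := proj1 HUD.
Variables (io ph : UD -> UA).
Hypotheses (Hio : is_iota ED FD KD EA FA KA io) (Hph : is_swap ED FD KD EA FA KA ph).

Definition GFK : UD -> Prop :=
  gen_alg (fun x => (exists i, ID n i /\ x = FD i) \/ (exists mu, inLD mu /\ x = KD mu)).

Definition eF (i : nat) : UD := if ID n i then FD i else 0.
Definition eE (i : nat) : UD := if ID n (aswap n i) then ED (aswap n i) else 0.

Lemma eF_serre i j : IA n i -> IA n j -> i != j -> serre q n i j (wordev eF) = 0.
Proof.
move=> hi hj ij; apply: wordev_serre; rewrite /eF.
case: (boolP (ID n i)) => hi'; last by left.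
case: (boolP (ID n j)) => hj'; last by right; left.
right; right; split=> a; first exact: (qg_Fserre q0 n3 HD HR).
exact: (qg_Fcomm n3 HD HR).
Qed.

Lemma eE_serre i j : IA n i -> IA n j -> i != j -> serre q n i j (wordev eE) = 0.
Proof.
move=> hi hj ij; apply: wordev_serre; rewrite /eE.
case: (boolP (ID n (aswap n i))) => hi'; last by left.
case: (boolP (ID n (aswap n j))) => hj'; last by right; left.
have ae := aswap_adj n3 hi hj.
right; right; split=> a; first by apply: (qg_Eserre q0 n3 HD HR) => //; rewrite ae.
apply: (qg_Ecomm n3 HD HR) => //; last by rewrite ae.
by apply: contraNneq ij => e; rewrite -(aswapK n3 hi) e (aswapK n3 hj).
Qed.

Section Functional.
Variable L : UD -> k.
Hypotheses (LD : forall x y, L (x + y) = L x + L y) (LZ : forall c x, L (c *: x) = c * L x).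

(* The functional [F K E |-> L (F K) * (E g)] of the triangular decomposition,
   in which the letters outside the finite part, resp. its swapped copy, act as 0. *)
Definition sepfun (g : UD) : tri_fun n UD :=
  fun u mu w => L (wordev eF u * KD (pr mu)) *: (wordev eE w * g).

Lemma sepfun_serre g : sepfun g \in serre_pred q (IA n) (R := UD).
Proof.
apply/serre_predP => i j hi hj ij; split=> [u mu w w'|u u' mu w].
  pose M (z : UD) : UD := L (wordev eF u * KD (pr mu)) *: (wordev eE w' * z * wordev eE w * g).
  have ML : lin_map M.
    split=> [x y|c x]; rewrite /M; first by rewrite mulrDr !mulrDl scalerDr.
    by rewrite -scalerAr -!scalerAl !scalerA mulrC.
  rewrite -[RHS](_ : M 0 = 0); last by rewrite /M mulr0 !mul0r scaler0.
  rewrite -(eE_serre hi hj ij) -(serre_lin q n i j _ ML); congr (serre _ _ _ _).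
  by apply: funext => s; rewrite /sepfun /M !wordev_cat.
pose M (z : UD) : UD := L (wordev eF u' * z * wordev eF u * KD (pr mu)) *: (wordev eE w * g).
have ML : lin_map M.
  split=> [x y|c x]; rewrite /M; first by rewrite mulrDr !mulrDl LD scalerDl.
  by rewrite -scalerAr -!scalerAl LZ scalerA.
have L0 : L 0 = 0 by rewrite -(scale0r (0 : UD)) LZ mul0r.
rewrite -[RHS](_ : M 0 = 0); last by rewrite /M mulr0 !mul0r L0 scale0r.
rewrite -(eF_serre hi hj ij) -(serre_lin q n i j _ ML); congr (serre _ _ _ _).
by apply: funext => s; rewrite /sepfun /M !wordev_cat.
Qed.

End Functional.

(** With L dual to [b j0], the sum acts on [sepfun L 1]. Its value at the empty words is the
    combination of the h_j with coefficients L (b_j), that is [h j0]. *)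
Lemma separate m (b h : 'I_m -> UD) : (forall j, GFK (b j) /\ GE (ID n) ED (h j)) ->
  lin_indep b -> \sum_j io (b j) * ph (h j) = 0 -> forall j, h j = 0.
Proof.
move=> Hbh bfree E0 j0; have [L [LD LZ Lb]] := exists_dual j0 bfree.
have [ioH ioE ioF ioK] := Hio; have [phH phE phF phK] := Hph.
have [act [actP actD actZ actM [act1 actE actF actK]]] :=
  tri_action q0 q2 n3 HA (oner_neq0 UD) HUA.
have sepP g := sepfun_serre LD LZ g.
have act_ph z : GE (ID n) ED z -> forall g, act (ph z) (sepfun L g) = sepfun L (z * g).
  elim=> [_ [i [hi ->]]||x y hx IHx hy IHy|c x hx IHx|x y hx IHx hy IHy] g.
  - rewrite phE // actE ?sepP //; last exact: (aswap_IA n3).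
    apply: tri_ext => u mu w; rewrite /Eop /sepfun /= /eE (aswapK n3); last by case/andP: hi.
    by rewrite hi mulrA.
  - by rewrite (ah1 phH) act1 ?sepP // mul1r.
  - rewrite (ahD phH) actD IHx IHy; apply: tri_ext => u mu w.
    by rewrite tri_addE /sepfun mulrDl mulrDr scalerDr.
  - rewrite (ahZ phH) actZ IHx; apply: tri_ext => u mu w.
    by rewrite tri_scaleE /sepfun -scalerAl -scalerAr !scalerA mulrC.
  - by rewrite (ahM phH) actM // IHy IHx mulrA.
(* The map M is arbitrary so that the induction passes products: the second factor is absorbed into
   M as right multiplication. *)
have act_io x : GFK x -> forall (M : UD -> UD) f, lin_map M ->
    f \in serre_pred q (IA n) (R := UD) ->
    (forall u mu, inLA mu -> f u mu [::] = M (wordev eF u * KD (pr mu))) ->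
    forall u mu, inLA mu -> act (io x) f u mu [::] = M (wordev eF u * KD (pr mu) * x).
  elim=> [y [[i [hi ->]]|[nu [hnu ->]]]||y z hy IHy hz IHz|c y hy IHy|y z hy IHy hz IHz] M f ML hf fE u mu hm.
  - rewrite ioF // actF //; last exact: ID_IA.
    have eFi : eF i = FD i by rewrite /eF hi.
    rewrite /Fop /= fE // -[wordev eF (i :: u)]/(wordev eF u * eF i) eFi.
    have [_ <-] := ML; congr (M _).
    have e1 := qg_KF HR (inLD_pr hm) hi; rewrite ip_pr in e1.
    by rewrite -!mulrA e1 -scalerAr.
  - rewrite ioK // actK //; last exact: inLD_LA.
    rewrite /Kop /= ip0r oppr0 qz0 scale1r fE; last by apply: inLA_D => //; apply: inLD_LA.
    by rewrite prD (pr_id hnu) -mulrA (qg_KD HR) // inLD_pr.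
  - by rewrite (ah1 ioH) act1 // mulr1 fE.
  - have [MD _] := ML.
    by rewrite (ahD ioH) actD tri_addE (IHy M) // (IHz M) // -MD mulrDr.
  - have [_ MZ] := ML.
    by rewrite (ahZ ioH) actZ tri_scaleE (IHy M) // -MZ scalerAr.
  - rewrite (ahM ioH) actM // (IHy (fun v => M (v * z))) ?mulrA //; first last.
    + by move=> u' mu' hm'; rewrite (IHz M).
    + exact: actP.
    have [MD MZ] := ML; split=> [v v'|c v]; first by rewrite mulrDl MD.
    by rewrite -scalerAl MZ.
have act0 f : act 0 f = 0 by rewrite -(scale0r 0) actZ scale0r.
have key : act (\sum_j io (b j) * ph (h j)) (sepfun L 1) [::] 0 [::] = h j0.
  have act_sum (J : finType) (z : J -> UA) f : act (\sum_j z j) f [::] 0 [::] = \sum_j act (z j) f [::] 0 [::].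
    apply: (big_morph (fun x => act x f [::] 0 [::])) => [x y|].
      by rewrite actD tri_addE.
    by rewrite act0.
  rewrite act_sum (bigD1 j0) //= big1 => [|j jj0].
    have [hb hh] := Hbh j0; rewrite addr0 actM // act_ph //.
    rewrite (act_io _ hb (fun v => L v *: h j0)) //; last exact: inLA_0.
    - by rewrite /= pr0 (qg_K0 HR) !mul1r Lb eqxx scale1r.
    - split=> [x y|c x]; first by rewrite LD scalerDl.
      by rewrite LZ scalerA.
    - by move=> u mu _; rewrite /sepfun /= mul1r mulr1.
  have [hb hh] := Hbh j; rewrite actM // act_ph //.
  rewrite (act_io _ hb (fun v => L v *: h j)) //; last exact: inLA_0.
  - by rewrite /= pr0 (qg_K0 HR) !mul1r Lb (negPf jj0) scale0r.
  - split=> [x y|c x]; first by rewrite LD scalerDl.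
    by rewrite LZ scalerA.
  - by move=> u mu _; rewrite /sepfun /= mul1r mulr1.
by rewrite -key E0 act0.
Qed.

End Separate.

Lemma inverse_family (k : fieldType) (q : k) (n : nat) (I : nat -> bool) (inL : W n -> bool)
  (q0 : q != 0) (q2 : q * q - 1 != 0) (n3 : (3 <= n)%N) (HI : root_datum I inL)
  (U : algType k) (E F : nat -> U) (K : W n -> U) (HU : is_QG q I inL E F K)
  (T : nat -> U -> U) (HT : lusztig q I inL E F K T) :
  exists S' S : nat -> U -> U, forall i, I i -> is_proper_inverse q I inL E F K T i (S' i) (S i).
Proof.
have H i : exists p : (U -> U) * (U -> U), I i -> is_proper_inverse q I inL E F K T i p.1 p.2.
  case: (boolP (I i)) => hi; last by exists (id, id).
  by have [p Hp] := proper_inverse q0 q2 n3 HI HU HT hi; exists p.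
have [p Hp] := choice H.
by exists (fun i => (p i).1), (fun i => (p i).2) => i hi; apply: Hp.
Qed.

Lemma qg_rels_hom (k : fieldType) (q : k) (n : nat) (I : nat -> bool) (inL : W n -> bool)
  (A B : algType k) (f : A -> B) (E F : nat -> A) (K : W n -> A) : alg_hom f ->
  qg_rels q I inL E F K ->
  qg_rels q I inL (fun i => f (E i)) (fun i => f (F i)) (fun mu => f (K mu)).
Proof.
move=> fH [r0 [rD [rE [rF [rC [rS rEF]]]]]].
split; last split; last split; last split; last split; last split.
- by rewrite r0 (ah1 fH).
- by move=> mu la hm hl; rewrite -(ahM fH) rD.
- by move=> mu i hm hi; rewrite -!(ahM fH) rE // (ahZ fH).
- by move=> mu i hm hi; rewrite -!(ahM fH) rF // (ahZ fH).
- by move=> i j hi hj /(rC i j hi hj) [h1 h2]; rewrite -!(ahM fH) h1 h2.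
- move=> i j hi hj /(rS i j hi hj) [h1 h2].
  by rewrite -!(ah_qbr fH) -!(ahM fH) h1 h2 !(ahZ fH).
- move=> i j hi hj; rewrite -!(ahM fH) -[LHS](ahB fH) rEF //.
  by case: ifP => _; rewrite ?(ah0 fH) ?(ahZ fH) ?(ahB fH).
Qed.

(** * Independence of the two copies *)
Section Independence.
Variables (k : fieldType) (q : k) (n : nat).
Hypotheses (q0 : q != 0) (q2 : q * q - 1 != 0) (n3 : (3 <= n)%N).
Notation N := n.+1.
Variables (UD : algType k) (ED FD : nat -> UD) (KD : W n -> UD).
Hypothesis HUD : is_QG q (ID n) (@inLD n) ED FD KD.
Variable TD : nat -> UD -> UD.
Hypothesis HTD : lusztig q (ID n) (@inLD n) ED FD KD TD.
Variables (UA : algType k) (EA FA : nat -> UA) (KA : W n -> UA).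
Hypothesis HUA : is_QG q (IA n) (@inLA n) EA FA KA.
Variable TA : nat -> UA -> UA.
Hypothesis HTA : lusztig q (IA n) (@inLA n) EA FA KA TA.
Let HD := rd_D_type n3.
Let HA := rd_A_type n3.
Let HRD : qg_rels q (ID n) (@inLD n) ED FD KD := proj1 HUD.
Variables (io ph : UD -> UA).
Hypotheses (Hio : is_iota ED FD KD EA FA KA io) (Hph : is_swap ED FD KD EA FA KA ph).
Variables (SD' SD : nat -> UD -> UD) (SA' SA : nat -> UA -> UA).
Hypotheses
  (HSD : forall i, ID n i -> is_proper_inverse q (ID n) (@inLD n) ED FD KD TD i (SD' i) (SD i))
  (HSA : forall i, IA n i -> is_proper_inverse q (IA n) (@inLA n) EA FA KA TA i (SA' i) (SA i)).
Notation al := (alpha n).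
Notation Uwn := (Uwn n ED TD).
Notation Psi := (second_copy n TA ph).

(** Holds on all of U_D by comparing generators, which needs explicit values at every F_j; this is
    the gain of [S] over the inverse of T_i. *)
Lemma SA_iota i z : ID n i -> SA i (io z) = io (SD i z).
Proof.
move=> hi; have hiA := ID_IA hi.
have [ioH ioE ioF ioK] := Hio.
have [_ hSD _ _ [D1 D2 D3 D4 D5]] := HSD hi.
have [_ hSA _ _ [A1 A2 A3 A4 A5]] := HSA hiA.
have h1 : alg_hom (fun z => SA i (io z)) by apply: alg_hom_comp.
have h2 : alg_hom (fun z => io (SD i z)) by apply: alg_hom_comp.
have ha := rd_alpha HD hi; have hna := rd_N HD ha.
case: HUD => _ /(_ UA (fun j => io (SD i (ED j))) (fun j => io (SD i (FD j)))
  (fun mu => io (SD i (KD mu)))) HH.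
have [|_ U] := HH.
  exact: (qg_rels_hom h2 HRD).
apply: (U _ _ h1 h2) => //; split=> [j hj|mu hm]; last first.
  by rewrite ioK // A5 ?inLD_LA // D5 // ioK // inLD_sref.
have hjA := ID_IA hj.
rewrite ioE // ioF //; have [->|ji] := eqVneq j i.
  by rewrite A1 A2 D1 D2 !(ahN ioH) !(ahM ioH) !ioK // ioE // ioF.
rewrite A3 // A4 // D3 // D4 //; case: ifP => _; last by rewrite ioE // ioF.
by rewrite (ah_qbr ioH) (ahB ioH) (ahZ ioH) !(ahM ioH) !ioE // !ioF.
Qed.

Lemma ops_SA_iota s z : all (ID n) s -> ops SA s (io z) = io (ops SD s z).
Proof. by elim: s => [//|i s IH] /= /andP[hi hs]; rewrite IH // SA_iota. Qed.

(** The middle part of the word is [pos_ys] for the relabelled chain. The last letter n + 1 fixes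
    E_0, and the first one is not a letter of that chain, so T_{n+1} is applied to E_0, .., E_n
    separately. *)
Lemma pos_wD_E0 : posP (GE (IA n) EA) TA (wD n) (EA 0).
Proof.
have C0 := chain_T q0 q2 n3 HA HUA HTA (@p0map_IA n) (p0map_adj n3) (@p0map_inj n).
have TN0 := TN_E0 n3 HTA.
have -> : wD n = N :: (desc n 0 ++ iota 3 (n - 2)) ++ [:: N].
  rewrite wDE descS // (_ : n - 1 = (n - 2) + 1)%N; last lia.
  by rewrite iotaD (_ : 3 + (n - 2) = N)%N ?cat_cons ?catA //; lia.
have hN : (3 <= N <= N)%N by lia.
have := pos_ys n3 C0 hN; rewrite descS //= => -[hp _].
have hp' := pos_posP (I := IA n) (@p0map_IA n) hp.
have E1 : map (p0map n) (desc n 0 ++ iota 3 (N - 3)) = desc n 0 ++ iota 3 (n - 2).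
  rewrite (_ : N - 3 = n - 2)%N; last lia.
  rewrite -[RHS]map_id; apply/eq_in_map => i; rewrite mem_cat mem_desc mem_iota => hi.
  by rewrite p0map_id //; lia.
have E2 : p0map n N = 0%N by rewrite /p0map eqxx.
rewrite E1 E2 in hp'.
have hp2 : posP (GE (IA n) EA) TA ((desc n 0 ++ iota 3 (n - 2)) ++ [:: N]) (EA 0).
  apply/posP_cat; rewrite /= TN0; split=> //; split; exact: GE_E.
split=> //; rewrite [ops _ _ _]/= -/(ops _ _ _) ops_cat [ops _ [:: N] _]/= TN0 ops_cat.
have g : gen n (fun i => EA (p0map n i)) (fun i => (i <= N)%N)
    (ops (fun i => TA (p0map n i)) (desc n 0) (zs (fun i => EA (p0map n i)) (fun i => TA (p0map n i)) N)).
  by apply: (desc_zs_gen n3 C0); lia.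
have {g} : gen n (fun i => EA (p0map n i)) (fun i => (i <= N)%N)
    (ops TA (desc n 0) (ops TA (iota 3 (n - 2)) (EA 0))).
  move: g; rewrite /zs E2 (_ : N - 3 = n - 2)%N; last lia.
  rewrite -(ops_op0 (n := n)); last by rewrite mem_desc; lia.
  by rewrite -(ops_op0 (n := n)) // mem_iota; lia.
have hNA : IA n N by rewrite /IA.
apply: ga_hom (T_hom HTA hNA) _ => _ [i [hi _ ->]].
have hp0 := p0map_IA hi; rewrite (T_Ej n3 HA HTA) //; last first.
  by move: (p0mapP n i); case/andP: hi => i0 hi; lia.
by case: ifP => _; [apply: ga_qbr|]; apply: GE_E.
Qed.

Lemma posA_id s x : pos n EA TA s x -> posP (GE (IA n) EA) TA s x.
Proof. by move=> h; have := pos_posP (p := id) (@ID_IA n) h; rewrite map_id. Qed.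

Lemma wD_allA : all (IA n) (wD n).
Proof. by apply/allP => i /(allP (all_wD n3)) /ID_IA. Qed.

Lemma undo_Psi h : GE (ID n) ED h -> ops SA (rev (wD n)) (Psi h) = ph h.
Proof.
have [phH phE _ _] := Hph.
have H1 : alg_hom (ops SA (rev (wD n))).
  by apply: ops_hom => i; rewrite mem_rev => /(allP wD_allA); apply: (S_hom HSA).
have H2 := second_copy_hom n3 HTA Hph.
apply: (ga_eq (alg_hom_comp H1 H2) phH) => _ [i [hi ->]].
rewrite /second_copy phE //; apply: (ops_S_T HTA HSA wD_allA).
have CA := chain_T q0 q2 n3 HA HUA HTA (p := id) (@ID_IA n) (fun _ _ _ _ => erefl) (fun _ _ _ _ => id).
case: (boolP (i == N)) => [/eqP ->|iN]; first by rewrite /aswap eqxx; apply: pos_wD_E0.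
have hin : (1 <= i <= n)%N by move: hi; rewrite IDE; lia.
rewrite aswap_s12 // /s12; have [e12 e21 p1 p2] := wD_e12 n3 CA.
case: eqP => [_|j1]; first exact: posA_id.
case: eqP => [_|j2]; first exact: posA_id.
by apply: posA_id; apply: (proj2 (wD_e n3 CA _)); lia.
Qed.

Lemma undo_iota a : ops SA (rev (wD n)) (io a) = io (ops SD (rev (wD n)) a).
Proof. by apply: ops_SA_iota; rewrite all_rev all_wD. Qed.

(** The reverse of w_n is w_n with the letters 1 and 2 exchanged. Reversed suffixes are thus
    prefixes of the relabelled word, possibly after dropping or commuting the letters at the fork,
    and the positivity lemmas apply to the F's under [SD]. *)
Lemma undo_neg s1 t s2 : wD n = s1 ++ t :: s2 -> GFK FD KD (ops SD (rev s2) (FD t)).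
Proof.
move=> E; have hl : (size s1 < 2 * n)%N by rewrite -(size_wD n3) E size_cat /=; lia.
have sID i : ID n i -> ID n (s12 i) by case: (s12P n3 i) => [] [h ->]; rewrite !IDE; lia.
have sinj i j : ID n i -> ID n j -> i != j -> s12 i != s12 j.
  by case: (s12P n3 i) => [] [h1 ->]; case: (s12P n3 j) => [] [h2 ->]; lia.
have CS := chain_S q0 q2 n3 HD HUD sID (s12_adj n3) sinj HSD.
have sub z : gen n (fun i => FD (s12 i)) xpredT z -> GFK FD KD z.
  by apply: ga_sub => _ [i [hi _ ->]]; apply: ga_gen; left; exists (s12 i); split=> //; apply: sID.
have mapd m j : (2 <= j)%N -> map s12 (desc m j) = desc m j.
  by move=> hj; apply: map_desc => i hi; case: (s12P n3 i); lia.
have mapi m j : (3 <= m)%N -> map s12 (iota m j) = iota m j.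
  by move=> hj; apply: map_iota => i hi; case: (s12P n3 i); lia.
have opsE w x : ops SD (map s12 w) x = ops (fun i => SD (s12 i)) w x by apply: ops_map.
have rev_iota m j : rev (iota m.+1 (j - m)) = desc j m.
  elim: j => [|j IH]; first by rewrite sub0n.
  have [jm|jm] := leqP m j; last by rewrite /desc (_ : j.+1 - m = 0)%N //; lia.
  rewrite subSn // descS // -IH -[(j - m).+1]addn1 iotaD rev_cat /=.
  by congr (_ :: _); lia.
have rev_desc m j : rev (desc j m) = iota m.+1 (j - m) by rewrite -rev_iota revK.
have [s1' [t' [s2' [E' Es H]]]] := wD_cases n3 hl.
have [<- <-] : t' = t /\ s2' = s2.
  by move: E'; rewrite E => /eqP; rewrite eqseq_cat // => /andP[_ /eqP [-> ->]].
case: H => [] [ht [_ ->]]; last first.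
  have ht1 : (1 <= t' <= N)%N by lia.
  rewrite rev_iota -mapd; last lia.
  have {2}-> : t' = s12 t' by case: (s12P n3 t'); lia.
  by rewrite opsE; apply/sub/(pos_gen (pos_xs n3 CS ht1)).
rewrite rev_cat rev_desc subn0 (_ : n - 1 = N - 2)%N; last lia.
rewrite rev_iota.
have [t1|t1] := eqVneq t' 1%N.
  have h2 : (1 <= 2 <= N)%N by lia.
  by rewrite t1 cats0 -mapd // opsE; apply/sub/(pos_gen (pos_xs n3 CS h2)).
have [t2|t2] := eqVneq t' 2.
  have h1 : (1 <= 1 <= N)%N by lia.
  have -> : desc N 2 ++ iota 1 t'.-1 = map s12 (desc N 1).
    rewrite t2 (@desc_cat N 2 1) //; last lia.
    by rewrite map_cat (mapd N 2).
  by rewrite t2 opsE; apply/sub/(pos_gen (pos_xs n3 CS h1)).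
have h3 : (3 <= t' <= N)%N by lia.
have -> : desc N 2 ++ iota 1 t'.-1 = map s12 (desc N 0 ++ iota 3 (t' - 3)).
  rewrite (@desc_cat N 2 0) //; last lia.
  rewrite !map_cat (mapd N 2) // mapi // -catA; congr (_ ++ _).
  rewrite (_ : t'.-1 = 2 + (t' - 3))%N; last lia.
  by rewrite iotaD.
have {2}-> : t' = s12 t' by case: (s12P n3 t'); lia.
by rewrite opsE; apply/sub/(pos_gen (pos_ys n3 CS h3)).
Qed.

(** For a root vector T_{s1} E_t, undoing s1 leaves E_t, undoing t gives - K F_t with K of weight -
    alpha_t, and the rest is [undo_neg]. *)
Lemma undo_Uwn a : Uwn a -> GFK FD KD (ops SD (rev (wD n)) a).
Proof.
have hom s : all (ID n) s -> alg_hom (ops SD s).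
  by move=> /allP hs; apply: ops_hom => i /hs; apply: (S_hom HSD).
have hw : all (ID n) (rev (wD n)) by rewrite all_rev all_wD.
apply: ga_hom (hom _ hw) _ => _ [l [hl ->]].
rewrite size_wD // in hl; have [s1 [t [s2 [E -> _]]]] := wD_cases n3 hl.
have [h1 ht h2] := cut_all n3 E.
rewrite E root_vecE rev_cat rev_cons -cats1 -catA !ops_cat.
rewrite (ops_S_T HTD HSD h1); last exact: (cut_pos q0 q2 n3 HUD HTD E).
have [_ _ _ _ [SE _ _ _ _]] := HSD ht.
rewrite /= SE; have hr : all (ID n) (rev s2) by rewrite all_rev.
have h := hom _ hr; rewrite (ahN h) (ahM h); apply/ga_opp/ga_mul; last exact: undo_neg E.
have ha : inLD (- al t) by apply: (rd_N HD); apply: (rd_alpha HD).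
suff [mu [hm ->]] : exists mu, inLD mu /\ ops SD (rev s2) (KD (- al t)) = KD mu.
  by apply: ga_gen; right; exists mu.
elim: (rev s2) hr => [|i s IH] /= => [_|/andP[hi hs]]; first by exists (- al t).
have [mu [hm ->]] := IH hs; exists (sref i mu); split; first exact: (rd_sref HD).
by have [_ _ _ _ [_ _ _ _ ->]] := HSD hi.
Qed.

Lemma independent m (a h : 'I_m -> UD) : (forall j, Uwn (a j) /\ GE (ID n) ED (h j)) ->
  lin_indep a -> \sum_j io (a j) * Psi (h j) = 0 -> forall j, h j = 0.
Proof.
move=> Hah afree E0.
pose b j := ops SD (rev (wD n)) (a j).
have Sh : alg_hom (ops SA (rev (wD n))).
  by apply: ops_hom => i; rewrite mem_rev => /(allP wD_allA); apply: (S_hom HSA).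
have Th : alg_hom (ops SD' (wD n)).
  by apply: ops_hom => i /(allP (all_wD n3)); apply: (S'_hom HSD).
apply: (separate q0 q2 n3 HUD HUA Hio Hph (b := b)).
- by move=> j; have [h1 h2] := Hah j; split=> //; apply: undo_Uwn.
(* The operators [SD'] invert the passage from a_j to b_j, so a dependency among the b_j comes back
   to the a_j. *)
- move=> c Ec; apply: afree.
  transitivity (ops SD' (wD n) (\sum_j c j *: b j)); last by rewrite Ec (ah0 Th).
  rewrite (ah_sum Th); apply: eq_bigr => j _.
  by rewrite (ahZ Th) (ops_S'_S HSD) // all_wD.
- transitivity (ops SA (rev (wD n)) (\sum_j io (a j) * Psi (h j))); last by rewrite E0 (ah0 Sh).
  rewrite (ah_sum Sh); apply: eq_bigr => j _; have [_ h2] := Hah j.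
  by rewrite (ahM Sh) undo_iota undo_Psi.
Qed.

End Independence.

(** * The isomorphism *)
Section Main.
Variables (k : fieldType) (q : k) (n : nat).
Hypotheses (q0 : q != 0) (q2 : q * q - 1 != 0) (n3 : (3 <= n)%N).
Notation N := n.+1.
Variables (UD : algType k) (ED FD : nat -> UD) (KD : W n -> UD).
Hypothesis HUD : is_QG q (ID n) (@inLD n) ED FD KD.
Variable TD : nat -> UD -> UD.
Hypothesis HTD : lusztig q (ID n) (@inLD n) ED FD KD TD.
Variables (UA : algType k) (EA FA : nat -> UA) (KA : W n -> UA).
Hypothesis HUA : is_QG q (IA n) (@inLA n) EA FA KA.
Variable TA : nat -> UA -> UA.
Hypothesis HTA : lusztig q (IA n) (@inLA n) EA FA KA TA.
Variables (S : algType k) (iA iH : UD -> S).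
Hypothesis HS : smash_spec ED KD TD iA iH.
Let HD := rd_D_type n3.
Let HA := rd_A_type n3.
Variables (io ph : UD -> UA).
Hypotheses (Hio : is_iota ED FD KD EA FA KA io) (Hph : is_swap ED FD KD EA FA KA ph).
Notation al := (alpha n).
Notation Uwn := (Uwn n ED TD).
Notation GE := (GE (ID n) ED).
Notation Psi := (second_copy n TA ph).
Let io_hom : alg_hom io := let: And4 h _ _ _ := Hio in h.
Let Psi_hom : alg_hom Psi := second_copy_hom n3 HTA Hph.
Let iA_hom : alg_hom_on Uwn iA := proj1 HS.
Let iH_hom : alg_hom_on (UDge0 ED KD) iH := proj1 (proj2 HS).

Lemma GE_ge0 h : GE h -> UDge0 ED KD h.
Proof. by apply: ga_sub => _ [i [hi ->]]; apply: ga_gen; left; exists i. Qed.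

Lemma iH1 : iH 1 = 1. Proof. exact: aho1 iH_hom. Qed.
Lemma iHD x y : GE x -> GE y -> iH (x + y) = iH x + iH y.
Proof. by move=> hx hy; apply: (ahoD iH_hom); apply: GE_ge0. Qed.
Lemma iHM x y : GE x -> GE y -> iH (x * y) = iH x * iH y.
Proof. by move=> hx hy; apply: (ahoM iH_hom); apply: GE_ge0. Qed.
Lemma iHZ c x : GE x -> iH (c *: x) = c *: iH x.
Proof. by move=> hx; apply: (ahoZ iH_hom); apply: GE_ge0. Qed.
Lemma iH0 : iH 0 = 0.
Proof. by rewrite -(scale0r (1 : UD)) iHZ ?scale0r //; apply: ga_one. Qed.

(** For i <= n, Psi fixes E_i and this is an identity of U_D. For i = n + 1 the action vanishes
    since pi kills E_{n+1}, and [top_qcomm] gives the remaining term on root vectors. *)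
Lemma Psi_swap i a : ID n i -> Uwn a ->
  Psi (ED i) * io a = io (actK KD (- al i) a) * Psi (ED i) + io (actE ED KD i a) * Psi 1.
Proof.
move=> hi ha; have [_ ioE _ _] := Hio; rewrite (ah1 Psi_hom) mulr1.
have [iN|iN] := eqVneq i N; last first.
  have hin : (1 <= i <= n)%N by move: hi; rewrite IDE; lia.
  rewrite (second_copy_E q0 q2 n3 HUA HTA Hph hin) -(ioE _ hi) -!(ahM io_hom) -(ahD io_hom).
  by rewrite -(E_mul ED KD a hin).
rewrite iN /actE ltnn (ah0 io_hom) addr0.
have hN : ID n N by rewrite IDE; lia.
have hal : inLD (- al N) by apply: (rd_N HD); apply: (rd_alpha HD).
have hK := actK_hom n3 HUD hal.
have [_ phE _ _] := Hph.
have EN : Psi (ED N) = ops TA (wD n) (EA 0) by rewrite /second_copy phE // /aswap eqxx.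
elim: ha => [_ [l [hl ->]]||x y hx IHx hy IHy|c x hx IHx|x y hx IHx hy IHy].
- rewrite size_wD // in hl; have [s1 [t [s2 [E -> _]]]] := wD_cases n3 hl.
  have [h1 ht _] := cut_all n3 E.
  rewrite E root_vecE (actK_hasw n3 HUD hal (b := sw s1 (al t))); last first.
    by apply: (hasw_ops n3 HD HTD) => //; apply: (hasw_E HUD).
  rewrite (ahZ io_hom) -scalerAl.
  rewrite (iota_ops n3 HTD HTA Hio) //; last exact: (cut_pos q0 q2 n3 HUD HTD E).
  by rewrite ioE // EN (top_qcomm q0 q2 n3 HUA HTA E) ipNl.
- by rewrite (ah1 hK) (ah1 io_hom) mulr1 mul1r.
- by rewrite (ahD hK) !(ahD io_hom) mulrDl mulrDr IHx IHy.
- by rewrite (ahZ hK) !(ahZ io_hom) -scalerAl -scalerAr IHx.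
- by rewrite (ahM hK) (ahM io_hom x) (ahM io_hom (actK KD _ x)) mulrA IHx -mulrA IHy mulrA.
Qed.

Lemma iH_swap i a : ID n i -> Uwn a ->
  iH (ED i) * iA a = iA (actK KD (- al i) a) * iH (ED i) + iA (actE ED KD i a) * iH 1.
Proof. by case: HS => _ [_ [_ [_ [_ H]]]]; apply: H. Qed.

(* The graph of the isomorphism, as a subspace of the product algebra. *)
Inductive graph : UA -> S -> Prop :=
| graph0 : graph 0 0
| graphS x s a h : graph x s -> Uwn a -> GE h ->
    graph (io a * Psi h + x) (iA a * iH h + s).

Lemma graph_term a h : Uwn a -> GE h -> graph (io a * Psi h) (iA a * iH h).
Proof. by move=> ha hh; rewrite -[X in graph X _]addr0 -[X in graph _ X]addr0; apply: graphS graph0 _ _. Qed.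

Lemma graphD x s y t : graph x s -> graph y t -> graph (x + y) (s + t).
Proof.
by move=> hx hy; elim: hx => [|x' s' a h _ IH ha hh]; rewrite ?add0r // -!addrA; apply: graphS.
Qed.

Lemma graphZ c x s : graph x s -> graph (c *: x) (c *: s).
Proof.
elim=> [|x' s' a h _ IH ha hh]; first by rewrite !scaler0; apply: graph0.
rewrite !scalerDr; apply: graphD IH.
rewrite !scalerAl -(ahZ io_hom) -(ahoZ iA_hom) //; apply: graph_term => //.
exact: ga_scale.
Qed.

Lemma graphB x s y t : graph x s -> graph y t -> graph (x - y) (s - t).
Proof. by move=> hx hy; rewrite -(scaleN1r y) -(scaleN1r t); apply: graphD => //; apply: graphZ. Qed.

Lemma graph1 : graph 1 1.
Proof.
have h1 : Uwn 1 := ga_one _; have h2 : GE 1 := ga_one _.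
by have := graph_term h1 h2; rewrite (ah1 io_hom) (ah1 Psi_hom) (aho1 iA_hom) iH1 !mulr1.
Qed.

Lemma graph_iA b x s : Uwn b -> graph x s -> graph (io b * x) (iA b * s).
Proof.
move=> hb; elim=> [|x' s' a h _ IH ha hh]; first by rewrite !mulr0; apply: graph0.
rewrite !mulrDr; apply: graphD IH; rewrite !mulrA -(ahM io_hom) -(ahoM iA_hom) //.
by apply: graph_term => //; apply: ga_mul.
Qed.

Lemma graph_iHr g x s : GE g -> graph x s -> graph (x * Psi g) (s * iH g).
Proof.
move=> hg; elim=> [|x' s' a h _ IH ha hh]; first by rewrite !mul0r; apply: graph0.
rewrite !mulrDl; apply: graphD IH; rewrite -!mulrA -(ahM Psi_hom) -iHM //.
by apply: graph_term => //; apply: ga_mul.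
Qed.

(** Reduces to one generator E_i, for which [Psi_swap] and [iH_swap] are the same exchange rule on
    the two sides. *)
Lemma graph_iH g x s : GE g -> graph x s -> graph (Psi g * x) (iH g * s).
Proof.
move=> hg; elim: hg x s => [_ [i [hi ->]]||u v hu IHu hv IHv|c u hu IHu|u v hu IHu hv IHv] x s hx.
- elim: hx => [|x' s' a h _ IH ha hh]; first by rewrite !mulr0; apply: graph0.
  rewrite !mulrDr; apply: graphD IH; rewrite !mulrA Psi_swap // iH_swap // !mulrDl.
  have hE : GE (ED i) by apply: GE_E.
  apply: graphD; apply: graph_iHr => //; apply: graph_term => //; last exact: ga_one.
    by apply: (Uwn_actK q0 q2 n3 HUD HTD) ha; apply: (rd_N HD); apply: (rd_alpha HD).
  exact: (Uwn_actE q0 q2 n3 HUD HTD).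
- by rewrite (ah1 Psi_hom) iH1 !mul1r.
- by rewrite (ahD Psi_hom) iHD // !mulrDl; apply: graphD; [apply: IHu|apply: IHv].
- by rewrite (ahZ Psi_hom) iHZ // -!scalerAl; apply/graphZ/IHu.
- by rewrite (ahM Psi_hom) iHM // -!mulrA; apply/IHu/IHv.
Qed.

Lemma graphM x s y t : graph x s -> graph y t -> graph (x * y) (s * t).
Proof.
move=> hx hy; elim: hx => [|x' s' a h _ IH ha hh]; first by rewrite !mul0r; apply: graph0.
by rewrite !mulrDl; apply: graphD IH; rewrite -!mulrA; apply/graph_iA/graph_iH.
Qed.

Lemma graph_sum x s : graph x s -> exists m (a h : 'I_m -> UD),
  [/\ forall j, Uwn (a j) /\ GE (h j), x = \sum_j io (a j) * Psi (h j) &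
      s = \sum_j iA (a j) * iH (h j)].
Proof.
elim=> [|x' s' a h _ [m [a' [h' [H -> ->]]]] ha hh].
  by exists 0%N, (fun=> 0), (fun=> 0); rewrite !big_ord0; split=> // -[].
exists m.+1, (fun j => oapp a' a (unlift ord0 j)), (fun j => oapp h' h (unlift ord0 j)).
split.
- by move=> j; case: unliftP => [j' _|_] /=; [apply: H|].
- by rewrite big_ord_recl unlift_none /=; congr (_ + _); apply: eq_bigr => j _; rewrite liftK.
- by rewrite big_ord_recl unlift_none /=; congr (_ + _); apply: eq_bigr => j _; rewrite liftK.
Qed.

(** Both sums are values of balanced maps on one tensor, so [tensor_free] makes the first factors
    independent on both sides at once. Then either sum vanishes only if all second factors do. *)
Lemma graph_zero x s : graph x s -> (x = 0 <-> s = 0).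
Proof.
move=> /graph_sum [m [a [h [H -> ->]]]].
have [m' [a' [h' [H' afree tensE]]]] := tensor_free (ga_zero _ : GE 0)
  (fun x y (hx : GE x) => @ga_add _ _ _ x y hx) (fun c x (hx : GE x) => ga_scale c hx) H.
rewrite (tensE UA (fun x y => io x * Psi y)); first last.
- move=> r c z y _ _ _; rewrite (ah_sum io_hom) mulr_suml; apply: eq_bigr => i _.
  by rewrite (ahZ io_hom) (ahZ Psi_hom) -scalerAl scalerAr.
- by move=> u v w _ _ _; rewrite (ahD Psi_hom) mulrDr.
rewrite (tensE S (fun x y => iA x * iH y)); first last.
- move=> r c z y hz _ hy; transitivity (\sum_i (c i *: iA (z i)) * iH y); last first.
    by apply: eq_bigr => i _; rewrite iHZ // -scalerAl scalerAr.
  rewrite -mulr_suml; congr (_ * _).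
  (* [iA] is linear on [Uwn] only, so membership of the partial sums is carried along. *)
  have [] : Uwn (\sum_i c i *: z i) /\ iA (\sum_i c i *: z i) = \sum_i c i *: iA (z i).
    elim/big_rec2: _ => [|i v w _ [hw <-]].
      split; first exact: ga_zero.
      by rewrite -(scale0r (1 : UD)) (ahoZ iA_hom) ?scale0r //; apply: ga_one.
    have hz1 : Uwn (z i) := hz i; have hc : Uwn (c i *: z i) by apply: ga_scale.
    by split; [apply: ga_add|rewrite (ahoD iA_hom) // (ahoZ iA_hom)].
  by [].
- by move=> u v w _ hv hw; rewrite iHD // mulrDr.
have [SD' [SD HSD]] := inverse_family q0 q2 n3 HD HUD HTD.
have [SA' [SA HSA]] := inverse_family q0 q2 n3 HA HUA HTA.
split=> E.
  have h0 := independent q0 q2 n3 HUD HTD HUA HTA Hio Hph HSD HSA H' afree E.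
  by apply: big1 => j _; rewrite h0 iH0 mulr0.
have [_ [_ [_ [ind _]]]] := HS.
have h0 : forall j, h' j = 0.
  apply: (ind _ _ _ _ afree E) => j; have [h1 h2] := H' j; split=> //; exact: GE_ge0.
by apply: big1 => j _; rewrite h0 (ah0 Psi_hom) mulr0.
Qed.

Lemma graph_fun x s t : graph x s -> graph x t -> s = t.
Proof.
move=> hs ht; have := graphB hs ht; rewrite subrr => /graph_zero [h _].
by apply/eqP; rewrite -subr_eq0 h.
Qed.

Lemma graph_inj x y s : graph x s -> graph y s -> x = y.
Proof.
move=> hx hy; have := graphB hx hy; rewrite subrr => /graph_zero [_ h].
by apply/eqP; rewrite -subr_eq0 h.
Qed.

Lemma graph_iota a : Uwn a -> graph (io a) (iA a).
Proof.
move=> ha; have h1 : GE 1 := ga_one _.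
by have := graph_term ha h1; rewrite (ah1 Psi_hom) iH1 !mulr1.
Qed.

Lemma graph_Psi a : Uwn a -> graph (Psi a) (iH a).
Proof.
move=> ha; have h1 : Uwn 1 := ga_one _.
have := graph_term h1 (Uwn_pos q0 q2 n3 HUD HTD ha).
by rewrite (ah1 io_hom) (aho1 iA_hom) !mul1r.
Qed.

Notation B := (DCKP TA EA (wA n)).
Notation shp := (@sharp k n UD ED TD S iA iH).

Lemma size_wA : size (wA n) = (4 * n)%N.
Proof. by rewrite wAE // size_cat size_map size_wD //; lia. Qed.

Lemma root_fst l : (l < 2 * n)%N ->
  root_vec TA EA (wA n) l = io (root_vec TD ED (wD n) l).
Proof. exact: (root_vec_fst q0 q2 n3 HUD HTD HTA Hio). Qed.

Lemma root_snd l : (l < 2 * n)%N ->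
  root_vec TA EA (wA n) (2 * n + l) = Psi (root_vec TD ED (wD n) l).
Proof. exact: (root_vec_snd q0 q2 n3 HUD HTD HTA Hph). Qed.

Lemma B_iota a : Uwn a -> B (io a).
Proof.
apply: ga_hom io_hom _ => _ [l [hl ->]]; rewrite size_wD // in hl.
by apply: ga_gen; exists l; rewrite size_wA root_fst //; split=> //; lia.
Qed.

Lemma B_Psi a : Uwn a -> B (Psi a).
Proof.
apply: ga_hom Psi_hom _ => _ [l [hl ->]]; rewrite size_wD // in hl.
by apply: ga_gen; exists (2 * n + l)%N; rewrite size_wA root_snd //; split=> //; lia.
Qed.

Lemma graph_total x : B x -> exists2 s, graph x s & shp s.
Proof.
elim=> [_ [l [hl ->]]||u v _ [s hs ss] _ [t ht st]|c u _ [s hs ss]|u v _ [s hs ss] _ [t ht st]].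
- rewrite size_wA in hl; case: (ltnP l (2 * n)) => h.
    exists (iA (root_vec TD ED (wD n) l)).
      by rewrite root_fst //; apply/graph_iota/(Uwn_root n3).
    by apply: ga_gen; exists (root_vec TD ED (wD n) l); split; [apply: (Uwn_root n3)|left].
  have h' : (l - 2 * n < 2 * n)%N by lia.
  exists (iH (root_vec TD ED (wD n) (l - 2 * n))).
    by rewrite -(subnKC h) root_snd // subnKC //; apply/graph_Psi/(Uwn_root n3).
  by apply: ga_gen; eexists; split; [apply: (Uwn_root n3 ED TD h')|right].
- by exists 1; [apply: graph1|apply: ga_one].
- by exists (s + t); [apply: graphD|apply: ga_add].
- by exists (c *: s); [apply: graphZ|apply: ga_scale].
- by exists (s * t); [apply: graphM|apply: ga_mul].
Qed.

Lemma graph_onto s : shp s -> exists2 x, graph x s & B x.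
Proof.
elim=> [_ [u [hu [->|->]]]||u v _ [x hx bx] _ [y hy by_]|c u _ [x hx bx]|u v _ [x hx bx] _ [y hy by_]].
- by exists (io u); [apply: graph_iota|apply: B_iota].
- by exists (Psi u); [apply: graph_Psi|apply: B_Psi].
- by exists 1; [apply: graph1|apply: ga_one].
- by exists (x + y); [apply: graphD|apply: ga_add].
- by exists (c *: x); [apply: graphZ|apply: ga_scale].
- by exists (x * y); [apply: graphM|apply: ga_mul].
Qed.

Lemma iso_of_graph : exists phi : UA -> S,
  alg_iso_on B shp phi /\ (forall x s, graph x s -> phi x = s).
Proof.
(* Off the domain of the graph the value is an arbitrary default. *)
have H x : exists t, (exists s, graph x s) -> graph x t.
  by have [[s hs]|h] := pselect (exists s, graph x s); [exists s|exists 0].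
have [phi Hphi] := choice H.
have phiE x s : graph x s -> phi x = s.
  by move=> hs; apply: (graph_fun (x := x)) => //; apply: Hphi; exists s.
have phiG x : B x -> graph x (phi x).
  by move=> /graph_total [s hs _]; apply: Hphi; exists s.
exists phi; split=> //; split; [|split; [|split]].
- split; first exact/phiE/graph1.
  split=> [x y hx hy|c x hx]; last by apply/phiE/graphZ/phiG.
  by split; apply: phiE; [apply: graphD|apply: graphM]; apply: phiG.
- by move=> x y hx hy E; apply: (graph_inj (phiG x hx)); rewrite E; apply: phiG.
- by move=> x /graph_total [s hs ss]; rewrite (phiE _ _ hs).
- by move=> s /graph_onto [x hx bx]; exists x; split=> //; apply: phiE.
Qed.

End Main.

(** Transcendence is applied to X and X^2 - 1. Their coefficients 0, 1 and -1 are carried to [k] one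
    by one, through integers. *)
Lemma transcendental_neq0 (k : fieldType) (q : k)
  (Hq : forall p : {poly rat}, p != 0 -> ~~ root (map_poly ratr p) q) :
  q != 0 /\ q * q - 1 != 0.
Proof.
have r0 : (ratr (0 : rat) : k) = 0 by rewrite -[0 : rat]/(0%:~R) ratr_int.
have r1 : (ratr (1 : rat) : k) = 1 by rewrite -[1 : rat]/(1%:~R) ratr_int.
have rN1 : (ratr (- 1 : rat) : k) = - 1 by rewrite -[- 1 : rat]/((-1)%:~R) ratr_int.
split.
  have := Hq 'X (negbT (polyX_eq0 _)).
  have -> : map_poly (ratr : rat -> k) 'X = 'X.
    by apply/polyP => i; rewrite coef_map_id0 // !coefX; case: eqP.
  by rewrite rootE hornerX.
have p0 : ('X * 'X - 1 : {poly rat}) != 0.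
  by apply/eqP => /(congr1 (fun p : {poly rat} => p`_2)); rewrite -expr2 coefB coefXn coefC coef0.
have := Hq _ p0.
have -> : map_poly (ratr : rat -> k) ('X * 'X - 1) = 'X * 'X - 1.
  apply/polyP => i; rewrite coef_map_id0 // -!expr2 !coefB !coefXn !coefC.
  by case: i => [|[|[|i]]] /=; rewrite ?sub0r ?subr0 ?oppr0 ?rN1 ?r1 ?r0 ?oppr0.
by rewrite rootE !hornerE.
Qed.

Theorem theorem4p4 (k : closedFieldType) (q : k) (n : nat)
  (Hchar : [pchar k] =i pred0)
  (Hq : forall p : {poly rat}, p != 0 -> ~~ root (map_poly ratr p) q)
  (Hn : (3 <= n)%N)
  (* U_q(so_{2n+2}) with its Lusztig automorphisms *)
  (UD : algType k) (ED FD : nat -> UD) (KD : W n -> UD)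
  (HUD : is_QG q (ID n) (@inLD n) ED FD KD)
  (TD : nat -> UD -> UD) (HTD : lusztig q (ID n) (@inLD n) ED FD KD TD)
  (* U_q(\hat so_{2n+2}) with its Lusztig automorphisms *)
  (UA : algType k) (EA FA : nat -> UA) (KA : W n -> UA)
  (HUA : is_QG q (IA n) (@inLA n) EA FA KA)
  (TA : nat -> UA -> UA) (HTA : lusztig q (IA n) (@inLA n) EA FA KA TA)
  (* the smash product U_q^{w_n} # U_D^{>=0} *)
  (S : algType k) (iA iH : UD -> S)
  (HS : smash_spec ED KD TD iA iH) :
  exists phi : UA -> S,
    alg_iso_on (DCKP TA EA (wA n)) (@sharp k n UD ED TD S iA iH) phi /\
    (forall i, (1 <= i <= n)%N ->
       phi (root_vec TA EA (wA n) (n - i)) = iA (root_vec TD ED (wD n) (n - i)) /\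
       phi (root_vec TA EA (wA n) (n + i - 1)) = iA (root_vec TD ED (wD n) (n + i - 1)) /\
       phi (root_vec TA EA (wA n) (3 * n - i)) = iH (root_vec TD ED (wD n) (n - i)) /\
       phi (root_vec TA EA (wA n) (3 * n + i - 1)) = iH (root_vec TD ED (wD n) (n + i - 1))).
Proof.
have [q0 q2] := transcendental_neq0 Hq.
have [io Hio] := iota_exists Hn HUD HUA; have [ph Hph] := swap_exists Hn HUD HUA.
have [phi [isoP phiE]] := iso_of_graph q0 q2 Hn HUD HTD HUA HTA HS Hio Hph.
exists phi; split=> // i hi.
have h1 : (n - i < 2 * n)%N by lia.
have h2 : (n + i - 1 < 2 * n)%N by lia.
(* Counting from 0, the second copy starts at 2 * n, the length of w_n. *)
have -> : (3 * n - i = 2 * n + (n - i))%N by lia.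
have -> : (3 * n + i - 1 = 2 * n + (n + i - 1))%N by lia.
rewrite (root_fst q0 q2 Hn HUD HTD HTA Hio h1) (root_fst q0 q2 Hn HUD HTD HTA Hio h2).
rewrite (root_snd q0 q2 Hn HUD HTD HTA Hph h1) (root_snd q0 q2 Hn HUD HTD HTA Hph h2).
have U1 := Uwn_root Hn ED TD h1; have U2 := Uwn_root Hn ED TD h2.
split; first by apply: phiE; apply: (graph_iota Hn HTA HS io Hph).
split; first by apply: phiE; apply: (graph_iota Hn HTA HS io Hph).
by split; apply: phiE; apply: (graph_Psi q0 q2 Hn HUD HTD TA HS ph Hio).
Qed.
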